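(* Let $\lambda(u)=(\lambda_1(u),\lambda_2(u))$ be a restricted tuple. The irreducible $Y^{[p]}$-module $L^{[p]}(\lambda_1(u),\lambda_2(u))$ is finite dimensional if and only if there exist monic polynomials $P_1(u),P_2(u)\in k[u]$ of the same degree and with no common roots such that $\frac{\lambda_1(u)}{\lambda_2(u)}=\frac{P_1(u)}{P_2(u)}$.
   Context: Let $k$ be an algebraically closed field of characteristic $p>2$, parities $|1|=0$, $|2|=1$. $Y=Y_{1|1}$ is the superalgebra over $k$ with generators $t_{i,j}^{(r)}$ ($1\le i,j\le2$, $r>0$, parity $|i|+|j|$) and relations $[t_{i,j}^{(r)},t_{k,l}^{(s)}]=(-1)^{|i||j|+|i||k|+|j||k|}\sum_{t=0}^{\min(r,s)-1}(t_{k,j}^{(t)}t_{i,l}^{(r+s-1-t)}-t_{k,j}^{(r+s-1-t)}t_{i,l}^{(t)})$, $t_{i,j}^{(0)}=\delta_{ij}$; $t_{i,j}(u)=\sum_{r\ge0}t_{i,j}^{(r)}u^{-r}$. Drinfeld generators $d_i^{(r)},e^{(r)},f^{(r)}$ are the coefficients of $d_i(u)$, $e(u)$, $f(u)$ defined by $t_{1,1}=d_1$, $t_{1,2}=d_1e$, $t_{2,1}=fd_1$, $t_{2,2}=fd_1e+d_2$. With $b_1(u)=d_1(u)\cdots d_1(u-p+1)$, $b_2(u)=d_2(u)^{-1}\cdots d_2(u-p+1)^{-1}$, the restricted super Yangian $Y^{[p]}$ is $Y$ modulo the ideal generated by the central elements $b_i^{(rp)}$ ($i=1,2$, $r>0$).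 A series $g(u)\in k[[u^{-1}]]$ is restricted if $g(u)g(u-1)\cdots g(u-p+1)=1$; a tuple $(\lambda_1(u),\lambda_2(u))$, $\lambda_i(u)=1+\sum_{r\ge1}\lambda_i^{(r)}u^{-r}$, is restricted if both entries are. The baby Verma module $Z^{[p]}(\lambda(u))$ is $Y^{[p]}$ modulo the left ideal generated by all $e^{(r)}$ and $d_i^{(r)}-\lambda_i^{(r)}$ ($i=1,2$, $r>0$); it has a unique simple quotient $L^{[p]}(\lambda(u))$. *)

(* Defs.v *)
From HB Require Import structures.
From Stdlib Require Import List.
From mathcomp Require Import all_boot all_order all_algebra.
Set Implicit Arguments. Unset Strict Implicit. Unset Printing Implicit Defensive.
Import Order.TTheory GRing.Theory Num.Theory.
Local Open Scope ring_scope.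

(* The free associative k-algebra A = k<t_{ij}^{(r)} : i,j in {1,2}, r > 0>. *)
(* Index 1 is encoded by [false] (parity 0), index 2 by [true] (parity 1).   *)
(* The generator (i, j, r) stands for t_{ij}^{(r.+1)}.                       *)
(* An element of A is a finitely supported function from words (seq gen) to  *)
(* k; we work inside the space F of all such functions (noncommutative power *)
(* series), whose product is the concatenation product, and restrict to      *)
(* finitely supported ones (predicate [fin_supp]) where it matters.          *)

Definition gen := (bool * bool * nat)%type.

Section FreeAlg.
Variable K : fieldType.

Definition F := seq gen -> K.

Definition eqF (f g : F) : Prop := forall w, f w = g w.
Definition zeroF : F := fun _ => 0.
Definition oneF : F := fun w => (w == [::])%:R.
Definition addF (f g : F) : F := fun w => f w + g w.
Definition scaleF (c : K) (f : F) : F := fun w => c * f w.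
Definition oppF (f : F) : F := scaleF (-1) f.
Definition mulF (f g : F) : F :=
  fun w => \sum_(i < (size w).+1) f (take i w) * g (drop i w).
Definition XF (x : gen) : F := fun w => (w == [:: x])%:R.
Definition sumF (l : seq F) : F := foldr addF zeroF l.

Definition fin_supp (f : F) : Prop :=
  exists s : seq (seq gen), forall w, w \notin s -> f w = 0.

Definition tt (i j : bool) (r : nat) : F :=
  if r is r'.+1 then XF (i, j, r') else scaleF (i == j)%:R oneF.

(* series in u^{-1} with coefficients in F: a(u) = sum_r a r u^{-r} *)
Definition SerF := nat -> F.
Definition oneSer : SerF := fun n => if n == 0%N then oneF else zeroF.
Definition mulSer (a b : SerF) : SerF :=
  fun n => sumF [seq mulF (a i) (b (n - i)%N) | i <- iota 0 n.+1].
Definition subSer (a b : SerF) : SerF := fun n => addF (a n) (oppF (b n)).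

(* inverse of a series with a 0 = 1: c_0 = 1, c_n = - sum_{s=1}^n a_s c_{n-s} *)
Fixpoint invSer_list (a : SerF) (n : nat) : seq F :=
  match n with
  | 0 => [:: oneF]
  | n'.+1 => let l := invSer_list a n' in
      rcons l (oppF (sumF [seq mulF (a s) (nth zeroF l (n'.+1 - s)%N)
                          | s <- iota 1 n'.+1]))
  end.
Definition invSer (a : SerF) : SerF := fun n => nth zeroF (invSer_list a n) n.

(* a(u - c): coefficient of u^{-n} is a_0 if n = 0, and
   sum_{r=1}^{n} binom(n-1, r-1) c^(n-r) a_r otherwise *)
Definition shiftSer (a : SerF) (c : K) : SerF :=
  fun n => if n is n'.+1 then
    sumF [seq scaleF ('C(n', r)%:R * c ^+ (n' - r)) (a r.+1) | r <- iota 0 n]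
  else a 0%N.

Definition prodShift (a : SerF) (m : nat) : SerF :=
  foldr (fun j acc => mulSer (shiftSer a j%:R) acc) oneSer (iota 0 m).

(* Drinfeld generators as elements of the free algebra:
   t11 = d1, t12 = d1 e, t21 = f d1, t22 = f d1 e + d2 *)
Definition tS (i j : bool) : SerF := tt i j.
Definition d1S : SerF := tS false false.
Definition eS : SerF := mulSer (invSer d1S) (tS false true).
Definition fS : SerF := mulSer (tS true false) (invSer d1S).
Definition d2S : SerF := subSer (tS true true) (mulSer (mulSer fS d1S) eS).
Definition dS (i : bool) : SerF := if i then d2S else d1S.

Definition b1S (p : nat) : SerF := prodShift d1S p.
Definition b2S (p : nat) : SerF := prodShift (invSer d2S) p.
Definition bS (p : nat) (i : bool) : SerF := if i then b2S p else b1S p.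

Definition sgn (e : nat) : K := (-1) ^+ e.
Definition supercomm (x y : F) (px py : nat) : F :=
  addF (mulF x y) (scaleF (- sgn (px * py)) (mulF y x)).
Definition relY (i j k l : bool) (r s : nat) : F :=
  addF (supercomm (tt i j r) (tt k l s) (i + j) (k + l))
    (oppF (scaleF (sgn (i * j + i * k + j * k))
      (sumF [seq addF (mulF (tt k j q) (tt i l (r + s - 1 - q)))
                      (oppF (mulF (tt k j (r + s - 1 - q)) (tt i l q)))
            | q <- iota 0 (minn r s)]))).

Definition relYp (p : nat) (g : F) : Prop :=
  (exists i j k l r s, (0 < r)%N /\ (0 < s)%N /\ g = relY i j k l r s)
  \/ (exists i r, (0 < r)%N /\ g = bS p i (r * p)%N).

Definition ideal2 (S : F -> Prop) (f : F) : Prop :=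
  exists l : seq (F * F * F),
    (forall x, In x l -> [/\ fin_supp x.1.1, S x.1.2 & fin_supp x.2]) /\
    eqF f (sumF [seq mulF (mulF x.1.1 x.1.2) x.2 | x <- l]).

Definition idealL (S : F -> Prop) (f : F) : Prop :=
  exists l : seq (F * F),
    (forall x, In x l -> fin_supp x.1 /\ S x.2) /\
    eqF f (sumF [seq mulF x.1 x.2 | x <- l]).

(* Z^{[p]}(lambda) = A / KZ: KZ is the left ideal generated by the relations
   of Y^{[p]} (a two-sided ideal), the e^{(r)} and the d_i^{(r)} - lambda_i^{(r)} *)
Definition KZ (p : nat) (lam : bool -> nat -> K) : F -> Prop :=
  idealL (fun g =>
    ideal2 (relYp p) g
    \/ (exists r, (0 < r)%N /\ g = eS r)
    \/ (exists i r, (0 < r)%N /\ g = addF (dS i r) (scaleF (- lam i r) oneF))).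

(* L^{[p]}(lambda) = A / ML, where ML is the unique maximal proper left ideal
   containing KZ, i.e. the union of all proper left ideals containing KZ:
   a lies in such an ideal iff KZ + A a is proper. *)
Definition ML (p : nat) (lam : bool -> nat -> K) (a : F) : Prop :=
  fin_supp a /\ ~ idealL (fun g => KZ p lam g \/ g = a) oneF.

Definition L_fin_dim (p : nat) (lam : bool -> nat -> K) : Prop :=
  exists vs : seq F, (forall v, In v vs -> fin_supp v) /\
    forall f, fin_supp f -> exists cs : seq K,
      ML p lam (addF f (oppF (sumF [seq scaleF x.1 x.2 | x <- zip cs vs]))).

End FreeAlg.

Section Series.
Variable K : fieldType.
Definition oneK : nat -> K := fun n => (n == 0%N)%:R.
Definition mulK (a b : nat -> K) : nat -> K :=
  fun n => \sum_(i < n.+1) a i * b (n - i)%N.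
Definition shiftK (a : nat -> K) (c : K) : nat -> K :=
  fun n => if n is n'.+1 then
    \sum_(r < n) 'C(n', r)%:R * c ^+ (n' - r) * a r.+1
  else a 0%N.
Definition prodShiftK (a : nat -> K) (m : nat) : nat -> K :=
  foldr (fun j acc => mulK (shiftK a j%:R) acc) oneK (iota 0 m).
Definition restricted (p : nat) (g : nat -> K) : Prop :=
  forall n, prodShiftK g p n = oneK n.
(* coefficient of u^{deg P - j} in P(u), i.e. of u^{-j} in u^{-deg P} P(u) *)
Definition rcoef (P : {poly K}) (j : nat) : K :=
  if (j < size P)%N then P`_((size P).-1 - j) else 0.
End Series.

(* Main.v *)
(* The series h(u) = d_1(u)^-1 d_2(u) commutes with f(v), the f^(r) anticommute and square to 0,
   and e^(r) f^(s) + f^(s) e^(r) = h^(r+s-1). So the baby Verma module is spanned by the products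
   of the f^(r) applied to the highest weight vector, on which h(u) acts by
   m(u) = lambda_2(u) / lambda_1(u). It is local, because an element with nonzero constant term
   of an exterior algebra is invertible; hence ML is a subspace. If L is finite dimensional, some
   nontrivial combination sum_s a_s f^(s+1) dies in L, and applying e^(r+1) to it gives
   sum_s a_s m_(r+s+1) = 0 for all r: m(u) has a finite Hankel recurrence, so it is rational.
   Conversely, if lambda_1 / lambda_2 = prod (u - x_i) / prod (u - y_i), a tensor product of
   two-dimensional evaluation modules, rescaled by a series, has dimension 2^n and contains a
   vector w of weight lambda. The coefficients of b_1 and b_2 commute with the f^(r) and, lambda
   being restricted, kill w; so w defines a finite-dimensional quotient of the baby Verma module,
   which has L as a quotient. *)

From HB Require Import structures.
From Stdlib Require Import List.
From mathcomp Require Import all_boot all_order all_algebra generic_quotient ring_quotient.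
From mathcomp Require Import boolp.
Require Import Defs.
Set Implicit Arguments. Unset Strict Implicit. Unset Printing Implicit Defensive.
Import GRing.Theory.
Local Open Scope ring_scope.

(** The core argument runs in an arbitrary ring with series t_ij(u) satisfying the RTT relation and
    a left ideal [J] containing the highest weight relations. It is used twice: in Y^[p] with the
    image of [KZ], and in a matrix ring with the annihilator of a vector. All rings are ordinary
    associative rings; super signs are explicit factors, and a parity operator produces those of
    tensor products. Relations between series in u and v live in power series in x = 1/u and y =
    1/v, where u - v has no meaning. They are multiplied by xy, so that z = (u - v)xy = y - x and w
    = xy are central. Consequences of RTT come out multiplied by such factors, which must be
    cancelled. A factor like (u - m - v)xy is a nonzerodivisor in a strong sense: if its multiple of
    H involves only one positive power of y, then H = 0. An unknown remainder in a single power of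
    one variable thus does no harm, and this is the key both to f(v)^2 = 0 and to the commutation of
    b_1(u) with f(v). *)

Definition central (R : pzRingType) (c : R) := forall x, c * x = x * c.

(** * Normalization of noncommutative polynomial identities *)

Inductive ncexp :=
  | NCvar of nat | NCcst of nat | NCzero | NCone
  | NCadd of ncexp & ncexp | NCopp of ncexp | NCmul of ncexp & ncexp
  | NCmuln of ncexp & nat.

(* A monomial is an integer times a sorted product of central letters times a
   word in the noncommuting letters. *)
Definition ncmon := (int * (seq nat * seq nat))%type.

Section NCRing.
Variables (R : pzRingType) (cs vs : seq R).

Fixpoint nceval (e : ncexp) : R :=
  match e with
  | NCvar i => nth 0 vs i
  | NCcst i => nth 0 cs i
  | NCzero => 0
  | NCone => 1
  | NCadd a b => nceval a + nceval b
  | NCopp a => - nceval a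
  | NCmul a b => nceval a * nceval b
  | NCmuln a n => nceval a *+ n
  end.

Fixpoint ncinsert (i : nat) (s : seq nat) : seq nat :=
  if s is j :: s' then if (i <= j)%N then i :: s else j :: ncinsert i s'
  else [:: i].

Definition ncmonM (m1 m2 : ncmon) : ncmon :=
  (m1.1 * m2.1, (foldr ncinsert m2.2.1 m1.2.1, m1.2.2 ++ m2.2.2)).

Fixpoint ncnf (e : ncexp) : seq ncmon :=
  match e with
  | NCvar i => [:: (1, ([::], [:: i]))]
  | NCcst i => [:: (1, ([:: i], [::]))]
  | NCzero => [::]
  | NCone => [:: (1, ([::], [::]))]
  | NCadd a b => ncnf a ++ ncnf b
  | NCopp a => [seq (- m.1, m.2) | m <- ncnf a]
  | NCmul a b => [seq ncmonM m1 m2 | m1 <- ncnf a, m2 <- ncnf b]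
  | NCmuln a n => [seq (m.1 * n%:Z, m.2) | m <- ncnf a]
  end.

Fixpoint nccollect (m : ncmon) (l : seq ncmon) : seq ncmon :=
  if l is m' :: l' then
    if m.2 == m'.2 then (m.1 + m'.1, m.2) :: l' else m' :: nccollect m l'
  else [:: m].

Definition ncnull (e : ncexp) : bool :=
  all (fun m => m.1 == 0) (foldr nccollect [::] (ncnf e)).

Definition ncprod (l : seq R) (w : seq nat) : R := foldr (fun i a => l`_i * a) 1 w.
Definition ncmeval (m : ncmon) : R := ncprod cs m.2.1 * ncprod vs m.2.2 *~ m.1.
Definition ncleval (l : seq ncmon) : R := \sum_(m <- l) ncmeval m.

Hypothesis cs_central : foldr (fun c P => central c /\ P) True cs.

Lemma nc_nth_central i : central cs`_i.
Proof.
elim: cs cs_central i => [_ i|c l IH [Hc /IH Hl] [|i]] //=.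
by move=> x; rewrite nth_nil mulr0 mul0r.
Qed.

Lemma ncprod_central w : central (ncprod cs w).
Proof.
elim: w => [|i w IH] x /=; first by rewrite mulr1 mul1r.
by rewrite -mulrA IH !mulrA nc_nth_central.
Qed.

Lemma ncprod_cat (l : seq R) w1 w2 : ncprod l (w1 ++ w2) = ncprod l w1 * ncprod l w2.
Proof. by elim: w1 => [|i w IH] /=; rewrite ?mul1r // IH mulrA. Qed.

Lemma ncprod_insert i w : ncprod cs (ncinsert i w) = cs`_i * ncprod cs w.
Proof.
elim: w => [|j w IH] //=; case: ifP => //= _.
by rewrite IH !mulrA (nc_nth_central i cs`_j).
Qed.

Lemma ncmevalM m1 m2 : ncmeval (ncmonM m1 m2) = ncmeval m1 * ncmeval m2.
Proof.
rewrite /ncmeval /= ncprod_cat mulrzAl mulrzAr -mulrzA mulrC; congr (_ *~ _).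
have -> : ncprod cs (foldr ncinsert m2.2.1 m1.2.1) = ncprod cs m1.2.1 * ncprod cs m2.2.1.
  by elim: m1.2.1 => [|i w IH] /=; rewrite ?mul1r // ncprod_insert IH mulrA.
rewrite -!mulrA; congr (_ * _).
by rewrite mulrA (ncprod_central m2.2.1) -mulrA.
Qed.

Lemma ncleval_nf e : ncleval (ncnf e) = nceval e.
Proof.
rewrite /ncleval; elim: e => [i|i|||a IHa b IHb|a IHa|a IHa b IHb|a IHa n] /=.
- by rewrite big_seq1 /ncmeval /= mulr1 mul1r mulr1z.
- by rewrite big_seq1 /ncmeval /= !mulr1 mulr1z.
- by rewrite big_nil.
- by rewrite big_seq1 /ncmeval /= mul1r mulr1z.
- by rewrite big_cat /= IHa IHb.
- by rewrite big_map -IHa -sumrN; apply: eq_bigr => m _; rewrite /ncmeval /= mulrNz.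
- rewrite big_allpairs_dep /= -IHa -IHb big_distrl /=; apply: eq_bigr => m1 _.
  by rewrite big_distrr /=; apply: eq_bigr => m2 _; rewrite ncmevalM.
- rewrite big_map -IHa -sumrMnl; apply: eq_bigr => m _.
  by rewrite /ncmeval /= mulrzA -pmulrn.
Qed.

Lemma ncleval_collect m l : ncleval (nccollect m l) = ncmeval m + ncleval l.
Proof.
rewrite /ncleval; elim: l => [|m' l IH] /=; first by rewrite big_seq1 big_nil addr0.
case: eqP => [E|_]; rewrite !big_cons.
  by rewrite addrA; congr (_ + _); rewrite /ncmeval /= -E mulrzDr.
by rewrite IH addrCA.
Qed.

(** The test sees only free expansion in the noncommuting letters; a relation between letters is
    invisible to it. This is why the proofs below first write a goal as an explicit combination of
    known relations and leave only the expansion to [ncring]. *)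
Lemma ncringP e1 e2 : ncnull (NCadd e1 (NCopp e2)) -> nceval e1 = nceval e2.
Proof.
move=> H; apply/eqP; rewrite -subr_eq0.
rewrite -[_ - _]/(nceval (NCadd e1 (NCopp e2))) -ncleval_nf.
have -> : ncleval (ncnf (NCadd e1 (NCopp e2)))
        = ncleval (foldr nccollect [::] (ncnf (NCadd e1 (NCopp e2)))).
  elim: (ncnf _) => [|m l IH] //=; rewrite ncleval_collect -IH.
  by rewrite /ncleval big_cons.
rewrite /ncleval big1_seq // => m /andP[_ Hm].
by move/allP/(_ m Hm)/eqP: H => E; rewrite /ncmeval E mulr0z.
Qed.

End NCRing.

Ltac nc_find x l k :=
  lazymatch l with
  | nil => constr:(@None nat)
  | x :: _ => constr:(Some k)
  | _ :: ?l' => nc_find x l' (S k)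
  end.

Ltac nc_vars cs e vs :=
  lazymatch e with
  | (?a + ?b)%R => let vs' := nc_vars cs a vs in nc_vars cs b vs'
  | (- ?a)%R => nc_vars cs a vs
  | (?a * ?b)%R => let vs' := nc_vars cs a vs in nc_vars cs b vs'
  | (?a *+ _)%R => nc_vars cs a vs
  | 0%R => vs
  | 1%R => vs
  | _ => lazymatch nc_find e cs O with
         | Some _ => vs
         | None => lazymatch nc_find e vs O with
                   | Some _ => vs
                   | None => constr:(e :: vs)
                   end
         end
  end.

Ltac nc_reify cs vs e :=
  lazymatch e with
  | (?a + ?b)%R => let a' := nc_reify cs vs a in let b' := nc_reify cs vs b in
                   constr:(NCadd a' b')
  | (- ?a)%R => let a' := nc_reify cs vs a in constr:(NCopp a')
  | (?a * ?b)%R => let a' := nc_reify cs vs a in let b' := nc_reify cs vs b in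
                   constr:(NCmul a' b')
  | (?a *+ ?n)%R => let a' := nc_reify cs vs a in constr:(NCmuln a' n)
  | 0%R => constr:(NCzero)
  | 1%R => constr:(NCone)
  | _ => lazymatch nc_find e cs O with
         | Some ?k => constr:(NCcst k)
         | None => lazymatch nc_find e vs O with
                   | Some ?k => constr:(NCvar k)
                   end
         end
  end.

(* [ncring cs H] proves an identity of noncommutative polynomials over the
   integers, where [H] proves that the elements of the list [cs] are central. *)
Ltac ncring cs H :=
  lazymatch goal with
  | |- @eq ?T ?l ?r =>
    let R := lazymatch type of cs with seq ?R => R end in
    let vs := nc_vars cs l (@nil R) in
    let vs := nc_vars cs r vs in
    let e1 := nc_reify cs vs l in
    let e2 := nc_reify cs vs r in
    exact (@ncringP _ cs vs H e1 e2 (erefl true <: ncnull (NCadd e1 (NCopp e2)) = true))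
  end.

(** * Power series in the central variable u^-1 *)

Definition ser (R : Type) := nat -> R.

HB.instance Definition _ (R : Type) := gen_eqMixin (ser R).
HB.instance Definition _ (R : Type) := gen_choiceMixin (ser R).

Section SerRing.
Variable R : pzRingType.
Implicit Types a b : ser R.

Definition ser0 : ser R := fun=> 0.
Definition ser1 : ser R := fun n => (n == 0)%N%:R.
Definition ser_add a b : ser R := fun n => a n + b n.
Definition ser_opp a : ser R := fun n => - a n.
Definition ser_mul a b : ser R := fun n => \sum_(i < n.+1) a i * b (n - i)%N.
Definition ser_tail a : ser R := fun n => a n.+1.

Fact ser_addA : associative ser_add.
Proof. by move=> a b c; apply: funext => n; rewrite /ser_add addrA. Qed.
Fact ser_addC : commutative ser_add.
Proof. by move=> a b; apply: funext => n; rewrite /ser_add addrC. Qed.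
Fact ser_add0 : left_id ser0 ser_add.
Proof. by move=> a; apply: funext => n; rewrite /ser_add add0r. Qed.
Fact ser_addN : left_inverse ser0 ser_opp ser_add.
Proof. by move=> a; apply: funext => n; rewrite /ser_add addNr. Qed.

Lemma ser_mul0 a b : ser_mul a b 0%N = a 0%N * b 0%N.
Proof. by rewrite /ser_mul big_ord1. Qed.

Lemma ser_mulS a b n :
  ser_mul a b n.+1 = a 0%N * b n.+1 + ser_mul (ser_tail a) b n.
Proof. by rewrite /ser_mul big_ord_recl subn0. Qed.

Fact ser_mulDl : left_distributive ser_mul ser_add.
Proof.
move=> a b c; apply: funext => n; rewrite /ser_add /ser_mul -big_split.
by apply: eq_bigr => i _; rewrite mulrDl.
Qed.
Fact ser_mulDr : right_distributive ser_mul ser_add.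
Proof.
move=> a b c; apply: funext => n; rewrite /ser_add /ser_mul -big_split.
by apply: eq_bigr => i _; rewrite mulrDr.
Qed.
(** Induction on the coefficient through a = a_0 + x tail(a) avoids reindexing a triple sum. *)
Fact ser_mulA : associative ser_mul.
Proof.
suff E n a b c : ser_mul a (ser_mul b c) n = ser_mul (ser_mul a b) c n.
  by move=> a b c; apply: funext => n.
elim: n a b c => [|n IH] a b c; first by rewrite !ser_mul0 mulrA.
rewrite !ser_mulS ser_mul0 IH mulrDr mulrA -addrA; congr (_ + _).
have -> : ser_tail (ser_mul a b) =
    ser_add (fun n => a 0%N * ser_tail b n) (ser_mul (ser_tail a) b).
  by apply: funext => m; rewrite /ser_tail ser_mulS.
rewrite ser_mulDl; congr (_ + _).
by rewrite /ser_mul mulr_sumr; apply: eq_bigr => i _; rewrite mulrA.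
Qed.
Fact ser_mul1 : left_id ser1 ser_mul.
Proof.
move=> a; apply: funext => n; rewrite /ser_mul big_ord_recl subn0 mul1r.
by rewrite big1 ?addr0 // => i _; rewrite mul0r.
Qed.
Fact ser_mulr1 : right_id ser1 ser_mul.
Proof.
move=> a; apply: funext => n; rewrite /ser_mul big_ord_recr subnn /= mulr1.
rewrite big1 ?add0r // => i _; rewrite /ser1.
by rewrite (_ : (_ == _) = false) ?mulr0 // subn_eq0 leqNgt ltn_ord.
Qed.

HB.instance Definition _ := GRing.isZmodule.Build (ser R)
  ser_addA ser_addC ser_add0 ser_addN.
HB.instance Definition _ := GRing.Zmodule_isPzRing.Build (ser R)
  ser_mulA ser_mul1 ser_mulr1 ser_mulDl ser_mulDr.

Lemma serD a b n : (a + b) n = a n + b n. Proof. by []. Qed.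
Lemma serN a n : (- a) n = - a n. Proof. by []. Qed.
Lemma serB a b n : (a - b) n = a n - b n. Proof. by []. Qed.
Lemma ser1E n : (1 : ser R) n = (n == 0)%N%:R. Proof. by []. Qed.
Lemma serM a b n : (a * b) n = \sum_(i < n.+1) a i * b (n - i)%N.
Proof. by []. Qed.
Lemma serM0 a b : (a * b) 0%N = a 0%N * b 0%N. Proof. exact: ser_mul0. Qed.
Lemma serMS a b n : (a * b) n.+1 = a 0%N * b n.+1 + (ser_tail a * b) n.
Proof. exact: ser_mulS. Qed.
Lemma serMn a m n : (a *+ m) n = a n *+ m.
Proof. by elim: m => [|m IH] //; rewrite !mulrS serD IH. Qed.
Definition serC (r : R) : ser R := fun n => if n == 0%N then r else 0.
Definition serX : ser R := fun n => (n == 1)%N%:R.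

Lemma serCM r a n : (serC r * a) n = r * a n.
Proof.
rewrite serM big_ord_recl subn0 big1 ?addr0 // => i _; exact: mul0r.
Qed.

Lemma serMC r a n : (a * serC r) n = a n * r.
Proof.
rewrite serM big_ord_recr subnn /= big1 ?add0r // => i _.
by rewrite /serC subn_eq0 leqNgt ltn_ord mulr0.
Qed.

Fact serC_zmod : zmod_morphism serC.
Proof. by move=> r s; apply: funext => -[|n]; rewrite serB /serC /= ?subrr. Qed.
HB.instance Definition _ := GRing.isZmodMorphism.Build R (ser R) serC serC_zmod.

Fact serC_monoid : monoid_morphism serC.
Proof.
split; first by apply: funext => -[|n].
by move=> r s; apply: funext => n; rewrite serCM /serC; case: eqP; rewrite ?mulr0.
Qed.
HB.instance Definition _ := GRing.isMonoidMorphism.Build R (ser R) serC serC_monoid.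

Lemma serXM0 a : (serX * a) 0%N = 0. Proof. by rewrite serM0 mul0r. Qed.
Lemma serXMS a n : (serX * a) n.+1 = a n.
Proof.
by rewrite serMS mul0r add0r (_ : ser_tail serX = 1) ?mul1r //; apply: funext; case.
Qed.

Lemma serX_central : central serX.
Proof.
move=> a; apply: funext => -[|n]; first by rewrite serXM0 serM0 mulr0.
rewrite serXMS serM big_ord_recr subnn /= mulr0 addr0 big_ord_recr /= subSnn.
rewrite mulr1 big1 ?add0r // => i _.
rewrite /serX /= subSn; last exact: ltnW.
by rewrite eqSS subn_eq0 leqNgt ltn_ord mulr0.
Qed.

Lemma serC_central r : central r -> central (serC r).
Proof. by move=> Hr a; apply: funext => n; rewrite serCM serMC Hr. Qed.

Lemma ser_central a : (forall n, central (a n)) -> central a.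
Proof.
move=> Ha b; apply: funext => n; rewrite !serM (reindex_inj rev_ord_inj) /=.
apply: eq_bigr => i _; rewrite Ha subSS subKn //; exact: (ltn_ord i).
Qed.

Lemma ser_tailM a b : ser_tail (a * b) = serC (a 0%N) * ser_tail b + ser_tail a * b.
Proof. by apply: funext => n; rewrite serD serCM /ser_tail serMS. Qed.

Fixpoint ser_inv_seq a n : seq R :=
  if n is n'.+1 then
    let l := ser_inv_seq a n' in
    rcons l (- \sum_(i < n) a i.+1 * l`_(n' - i))
  else [:: 1].
Definition ser_inv a : ser R := fun n => (ser_inv_seq a n)`_n.

Lemma size_ser_inv_seq a n : size (ser_inv_seq a n) = n.+1.
Proof. by elim: n => //= n IH; rewrite size_rcons IH. Qed.

Lemma nth_ser_inv_seq a m n : (m <= n)%N -> (ser_inv_seq a n)`_m = ser_inv a m.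
Proof.
elim: n => [|n IH]; first by rewrite leqn0 => /eqP->.
rewrite leq_eqVlt => /predU1P[->|Hm] //=.
by rewrite nth_rcons size_ser_inv_seq Hm IH.
Qed.

Lemma ser_inv0 a : ser_inv a 0%N = 1. Proof. by []. Qed.
Lemma ser_invS a n :
  ser_inv a n.+1 = - \sum_(i < n.+1) a i.+1 * ser_inv a (n - i)%N.
Proof.
rewrite {1}/ser_inv /= nth_rcons size_ser_inv_seq ltnn eqxx; congr (- _).
by apply: eq_bigr => i _; rewrite nth_ser_inv_seq ?leq_subr.
Qed.

Lemma ser_mulrV a : a 0%N = 1 -> a * ser_inv a = 1.
Proof.
move=> a0; apply: funext => -[|n]; first by rewrite serM0 a0 mul1r.
by rewrite serMS a0 mul1r ser_invS addrC subrr.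
Qed.

Lemma ser_mulVr a : a 0%N = 1 -> ser_inv a * a = 1.
Proof.
move=> a0; set b := ser_inv a; have Hab : a * b = 1 := ser_mulrV a0.
have Hbc : b * ser_inv b = 1 by apply: ser_mulrV.
by rewrite -[a]mulr1 -Hbc (mulrA a) Hab mul1r.
Qed.

Lemma ser_inv_uniq a b : a * b = 1 -> a 0%N = 1 -> b = ser_inv a.
Proof.
by move=> Hab a0; rewrite -[b]mul1r -(ser_mulVr a0) -mulrA Hab mulr1.
Qed.

(* The substitution u |-> u - c, i.e. x |-> x / (1 - c x) for x = 1/u. *)
Definition ser_shift (c : nat) a : ser R := fun n =>
  if n is n'.+1 then \sum_(r < n) 'C(n', r)%:R * c%:R ^+ (n' - r) * a r.+1
  else a 0%N.

(** Pascal's rule; this is the coefficient form of the functional equation [ser_shift_rec]. *)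
Lemma ser_shift_tail c a n :
  ser_shift c a n.+1 = c%:R * (ser_shift c a n - serC (a 0%N) n)
                       + ser_shift c (ser_tail a) n.
Proof.
case: n => [|n].
  by rewrite /= !big_ord1 subrr mulr0 add0r !subnn expr0 bin0 !mul1r.
rewrite [serC _ _]/= subr0.
rewrite -[LHS]/(\sum_(r < n.+2) 'C(n.+1, r)%:R * c%:R ^+ (n.+1 - r) * a r.+1).
rewrite -[ser_shift c a n.+1]/(\sum_(r < n.+1) 'C(n, r)%:R * c%:R ^+ (n - r) * a r.+1).
rewrite -[ser_shift c _ _]/(\sum_(r < n.+1) 'C(n, r)%:R * c%:R ^+ (n - r) * a r.+2).
have E i : 'C(n.+1, i.+1)%:R * c%:R ^+ (n.+1 - i.+1) * a i.+2
    = 'C(n, i.+1)%:R * c%:R ^+ (n - i) * a i.+2 + 'C(n, i)%:R * c%:R ^+ (n - i) * a i.+2.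
  by rewrite binS natrD !mulrDl.
rewrite big_ord_recl (eq_bigr (fun i : 'I_n.+1 => _) (fun i _ => E (val i))).
rewrite big_split addrA; congr (_ + _).
rewrite [in LHS]big_ord_recr /= (bin_small (ltnSn n)) !mul0r addr0 [in RHS]big_ord_recl mulrDr /=.
rewrite !bin0 !subn0 !mul1r mulrA -exprS; congr (_ + _).
rewrite mulr_sumr; apply: eq_bigr => i _; rewrite /bump add1n.
by rewrite -(subnSK (ltn_ord i)) exprS !mulrA mulr_natl mulr_natr.
Qed.

Fact ser_shift_zmod c : zmod_morphism (ser_shift c).
Proof.
move=> a b; apply: funext => -[|n]; rewrite serB //=.
by rewrite -sumrB; apply: eq_bigr => i _; rewrite -mulrBr.
Qed.
HB.instance Definition _ c :=
  GRing.isZmodMorphism.Build (ser R) (ser R) (ser_shift c) (ser_shift_zmod c).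

Lemma ser_shiftC c r : ser_shift c (serC r) = serC r.
Proof. by apply: funext => -[|n] //=; rewrite big1 // => i _; rewrite mulr0. Qed.

Lemma ser_nat_central n : central (n%:R : ser R).
Proof. by move=> a; rewrite mulr_natl mulr_natr. Qed.

(** The image x' = x / (1 - c x) of x satisfies x' = x (c x' + 1). Multiplying by the shift of
    tail(a), and using that x' times this shift is the shift of a minus a_0, gives the equation. *)
Lemma ser_shift_rec c a : ser_shift c a - serC (a 0%N) =
  serX * (c%:R * (ser_shift c a - serC (a 0%N)) + ser_shift c (ser_tail a)).
Proof.
apply: funext => -[|n]; first by rewrite serB serXM0 subrr.
rewrite serXMS [RHS]serD [X in X n + _]mulr_natl serMn !serB subr0 ser_shift_tail.
by rewrite mulr_natl.
Qed.

(** Here [u], [v] stand for constant terms, [U], [V], [W] for the shifts of two series and of their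
    product, and [T1], [T2], [T3] for shifts involving tails. The defect of multiplicativity
    [W - U * V] obeys the same recursion, with the first series replaced by its tail. *)
Lemma ser_shift_step (k X u v U V W T1 T2 T3 : ser R) : central k -> central X ->
  W - u * v = X * (k * (W - u * v) + (u * T2 + T3)) ->
  U - u = X * (k * (U - u) + T1) -> V - v = X * (k * (V - v) + T2) ->
  W - U * V = X * (k * (W - U * V) + (T3 - T1 * V)).
Proof.
move=> Hk HX E1 E2 E3.
have -> : W - U * V = (W - u * v) - (U - u) * V - u * (V - v).
  by ncring (@nil (ser R)) I.
rewrite {1}E1 {1}E2 {1}E3; ncring [:: k; X] (conj Hk (conj HX I)).
Qed.

(** The defect satisfies D(u, v) = x (c D(u, v) + D(tail u, v)), so its coefficients vanish by
    induction on the degree, for all u at once. *)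
Fact ser_shift_monoid c : monoid_morphism (ser_shift c).
Proof.
split=> [|a b]; first by rewrite -(rmorph1 serC) ser_shiftC.
pose D a b := ser_shift c (a * b) - ser_shift c a * ser_shift c b.
suff D0 n : forall a b, D a b n = 0.
  by apply/eqP; rewrite -subr_eq0; apply/eqP/funext => n; exact: D0.
have DX u v : D u v = serX * (c%:R * D u v + D (ser_tail u) v).
  have := ser_shift_rec c (u * v).
  have -> : ser_shift c (ser_tail (u * v)) =
      serC (u 0%N) * ser_shift c (ser_tail v) + ser_shift c (ser_tail u * v).
    rewrite ser_tailM raddfD /=; congr (_ + _).
    apply: funext => -[|m]; first by rewrite -[LHS]/((serC _ * _) 0%N) !serCM.
    rewrite serCM /= mulr_sumr; apply: eq_bigr => i _.
    by rewrite serCM -natrX -natrM !mulrA mulr_natl mulr_natr.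
  rewrite serM0 rmorphM => E1.
  exact: ser_shift_step (@ser_nat_central c) serX_central E1 (ser_shift_rec c u) (ser_shift_rec c v).
elim: n => [|n IH] u v; rewrite DX ?serXM0 // serXMS serD mulr_natl serMn.
by rewrite !IH mul0rn addr0.
Qed.
HB.instance Definition _ c := GRing.isMonoidMorphism.Build (ser R) (ser R)
  (ser_shift c) (ser_shift_monoid c).

End SerRing.

Arguments serX {R}.
Arguments ser_inv {R}.

Definition ser_map (R S : Type) (f : R -> S) (a : ser R) : ser S := fun n => f (a n).

Section SerMap.
Variables (R S : pzRingType) (f : {rmorphism R -> S}).

Fact ser_map_zmod : zmod_morphism (ser_map f).
Proof. by move=> a b; apply: funext => n; rewrite serB -raddfB. Qed.
HB.instance Definition _ :=
  GRing.isZmodMorphism.Build (ser R) (ser S) (ser_map f) ser_map_zmod.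

Fact ser_map_monoid : monoid_morphism (ser_map f).
Proof.
split=> [|a b]; apply: funext => n; first by rewrite /ser_map !ser1E rmorph_nat.
by rewrite /ser_map !serM rmorph_sum; apply: eq_bigr => i _; rewrite rmorphM.
Qed.
HB.instance Definition _ :=
  GRing.isMonoidMorphism.Build (ser R) (ser S) (ser_map f) ser_map_monoid.

Lemma ser_map_shift c a : ser_map f (ser_shift c a) = ser_shift c (ser_map f a).
Proof.
apply: funext => -[|n] //; rewrite /ser_map /= rmorph_sum; apply: eq_bigr => i _.
by rewrite !rmorphM rmorphXn !rmorph_nat.
Qed.

End SerMap.

Lemma ser_mulI (R : pzRingType) (a b c : ser R) : a 0%N = 1 -> a * b = a * c -> b = c.
Proof.
by move=> a0 E; rewrite -[b]mul1r -[c]mul1r -(ser_mulVr a0) -!mulrA E.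
Qed.

Lemma ser_mulIr (R : pzRingType) (a b c : ser R) : a 0%N = 1 -> b * a = c * a -> b = c.
Proof.
by move=> a0 E; rewrite -[b]mulr1 -[c]mulr1 -(ser_mulrV a0) !mulrA E.
Qed.

(** * Power series in two central variables [x = u^-1] (outer) and [y = v^-1] *)

Section Ser2.
Variable R : pzRingType.
Implicit Types (a b : ser R) (H K : ser (ser R)).

Definition ofx : ser R -> ser (ser R) := ser_map (@serC R).
Definition ofy : ser R -> ser (ser R) := @serC (ser R).
HB.instance Definition _ := GRing.RMorphism.on ofx.
HB.instance Definition _ := GRing.RMorphism.on ofy.

Definition xv : ser (ser R) := serX.
Definition yv : ser (ser R) := serC serX.
Definition wv := xv * yv.
(* The multiple [(u - m - v) x y] of [u - m - v]. *)
Definition zv (m : nat) := yv - xv - wv *+ m.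

Lemma xv_central : central xv. Proof. exact: serX_central. Qed.
Lemma yv_central : central yv. Proof. by apply: serC_central; exact: serX_central. Qed.

Lemma central_wv : central wv.
Proof. by move=> H; rewrite /wv -mulrA yv_central mulrA xv_central mulrA. Qed.

Lemma central_zv m : central (zv m).
Proof.
move=> H; rewrite /zv !(mulrBl, mulrBr) mulrnAl mulrnAr.
by rewrite xv_central yv_central central_wv.
Qed.

Lemma ofxM a b r s : (ofx a * ofy b) r s = a r * b s.
Proof. by rewrite serMC serCM. Qed.
Lemma ofyM a b r s : (ofy a * ofx b) r s = a s * b r.
Proof. by rewrite serCM serMC. Qed.

Lemma xvM H r s : (xv * H) r.+1 s = H r s.
Proof. by rewrite serXMS. Qed.
Lemma xvM0 H s : (xv * H) 0%N s = 0.
Proof. by rewrite serXM0. Qed.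
Lemma yvM H r s : (yv * H) r s.+1 = H r s.
Proof. by rewrite serCM serXMS. Qed.
Lemma yvM0 H r : (yv * H) r 0%N = 0.
Proof. by rewrite serCM serXM0. Qed.
Lemma wvM H r s : (wv * H) r.+1 s.+1 = H r s.
Proof. by rewrite -mulrA xvM yvM. Qed.
Lemma wvM0l H s : (wv * H) 0%N s = 0.
Proof. by rewrite -mulrA xvM0. Qed.
Lemma wvM0r H r : (wv * H) r 0%N = 0.
Proof. by rewrite /wv -yv_central -mulrA yvM0. Qed.

Definition ser2E := (xvM, xvM0, yvM, yvM0, wvM, wvM0l, wvM0r, serD, serN, serMn).

Lemma zvM m H r s :
  (zv m * H) r.+1 s.+1 = H r.+1 s - H r s.+1 - H r s *+ m.
Proof. by rewrite /zv !mulrBl mulrnAl !ser2E. Qed.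
Lemma zvM0l m H s : (zv m * H) 0%N s.+1 = H 0%N s.
Proof. by rewrite /zv !mulrBl mulrnAl !ser2E mul0rn !subr0. Qed.
Lemma zvM0r m H r : (zv m * H) r.+1 0%N = - H r 0%N.
Proof. by rewrite /zv !mulrBl mulrnAl !ser2E mul0rn subr0 add0r. Qed.

Lemma ser2P H K : (forall r s, H r s = K r s) -> H = K.
Proof. by move=> E; apply: funext => r; apply: funext => s. Qed.

Lemma ser2_eq H K : H = K -> forall r s, H r s = K r s.
Proof. by move->. Qed.

Lemma wv_reg H : wv * H = 0 -> H = 0.
Proof. by move=> E; apply: ser2P => r s; rewrite -wvM E. Qed.

(** Columns s >= N vanish by induction on the row, starting from row 0; columns s < N vanish by
    induction on s, starting from column 0. Neither induction uses the relation with s + 1 = N, so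
    the product may be arbitrary in that one column. *)
Lemma zv_reg_coef (H : nat -> nat -> R) (m N : nat) : (0 < N)%N ->
  (forall s, s.+1 != N -> H 0%N s = 0) -> (forall r, H r 0%N = 0) ->
  (forall r s, s.+1 != N -> H r.+1 s - H r s.+1 - H r s *+ m = 0) ->
  forall r s, H r s = 0.
Proof.
move=> N0 H0s Hr0 Hrs.
have Hbig r : forall s, (N <= s)%N -> H r s = 0.
  elim: r => [|r IH] s Ns; first by rewrite H0s // neq_ltn ltnS Ns orbT.
  have := Hrs r s; rewrite neq_ltn ltnS Ns orbT => /(_ isT).
  by rewrite (IH s) // (IH s.+1) ?leqW // mul0rn !subr0.
move=> r s; case: (leqP N s) => [/Hbig //|]; elim: s r => [|s IH] r Ns //.
have := Hrs r s; rewrite neq_ltn Ns => /(_ isT).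
rewrite !(IH _ (ltnW Ns)) mul0rn subr0 sub0r => /eqP.
by rewrite oppr_eq0 => /eqP.
Qed.

(* [u - m - v] is a nonzerodivisor, even modulo multiples of a single power of v. *)
Lemma zv_reg m N H K : (0 < N)%N -> (forall r s, s != N -> K r s = 0) ->
  zv m * H = K -> H = 0.
Proof.
move=> N0 K0 E; apply: ser2P; apply: (@zv_reg_coef H m N N0) => [s sN|r|r s sN].
- by rewrite -(zvM0l m) E K0.
- by apply/eqP; rewrite -oppr_eq0 -(zvM0r m) E K0 // neq_ltn N0.
- by rewrite -zvM E K0.
Qed.

Lemma zv_reg0 m H : zv m * H = 0 -> H = 0.
Proof. by apply: (@zv_reg m 1). Qed.

(** Exchanging u and v turns u - v + 1 into -(v - 1 - u) in the old order of the roles, so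
    [zv_reg_coef] applies with m = 1 to the transposed array. The product may now be arbitrary in
    one power of x. *)
Lemma zv_reg_swap H K N : (0 < N)%N -> (forall r s, r != N -> K r s = 0) ->
  (zv 0 + wv) * H = K -> H = 0.
Proof.
move=> N0 K0 E; have Ers r s : ((zv 0 + wv) * H) r s = K r s by rewrite E.
apply: ser2P => r s; apply: (@zv_reg_coef (fun s r => H r s) 1 N N0) => [q qN|q|q t tN] /=.
- have := Ers q.+1 0%N; rewrite mulrDl !serD zvM0r wvM0r addr0 K0 // => /eqP.
  by rewrite oppr_eq0 => /eqP.
- have := Ers 0%N q.+1; rewrite mulrDl !serD zvM0l wvM0l addr0 K0 //.
  by rewrite neq_ltn N0.
- have := Ers t.+1 q.+1; rewrite mulrDl !serD zvM wvM mulr0n subr0 K0 // => /eqP.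
  rewrite -oppr_eq0 !opprD !opprK mulr1n => /eqP <-.
  by rewrite [X in X - _]addrC.
Qed.

End Ser2.

(** * Drinfeld relations from RTT relations *)

Lemma eq_subr0 (V : zmodType) (x y : V) : x = y -> x - y = 0.
Proof. by move->; rewrite subrr. Qed.

(* Here z = (u - v)xy and w = xy, the letters a, f, e, k stand for d_1(u), f(u),
   e(u), d_2(u), and the primed ones for the same series in v. *)
Section DrinfeldRelations.
Variables (Q : pzRingType) (z w a a' ai ai' f f' e e' k k' : Q).
Hypotheses (Hz : central z) (Hw : central w).
Let c := f * a.
Let c' := f' * a'.
Let b := a * e.
Let b' := a' * e'.
Let d := f * a * e + k.
Let d' := f' * a' * e' + k'.
Hypotheses (Va : ai * a = 1) (aV : a * ai = 1) (Va' : ai' * a' = 1) (aV' : a' * ai' = 1).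
Hypothesis Haa : a * a' = a' * a.
Hypothesis H1121 : z * (a * c' - c' * a) = w * (c * a' - c' * a).
Hypothesis H1121' : (- z) * (a' * c - c * a') = w * (c' * a - c * a').
Hypothesis H1112 : z * (a * b' - b' * a) = w * (a * b' - a' * b).
Hypothesis H1112' : (- z) * (a' * b - b * a') = w * (a' * b - a * b').
Hypothesis H2121 : z * (c * c' + c' * c) = w * (- (c * c' - c' * c)).
Hypothesis H1221 : z * (b * c' + c' * b) = w * (- (d * a' - d' * a)).
Hypothesis H1122 : z * (a * d' - d' * a) = w * (c * b' - c' * b).

Let HC := conj Hz (conj Hw I).

Lemma mulrI_inv (g gi x y : Q) : gi * g = 1 -> g * x = g * y -> x = y.
Proof. by move=> V E; rewrite -[x]mul1r -[y]mul1r -V -!mulrA E. Qed.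
Lemma mulIr_inv (g gi x y : Q) : g * gi = 1 -> x * g = y * g -> x = y.
Proof. by move=> V E; rewrite -[x]mulr1 -[y]mulr1 -V !mulrA E. Qed.

Lemma drinfeld_df : z * a * f' = ((z - w) * f' + w * f) * a.
Proof.
apply: (mulIr_inv aV'); apply: subr0_eq.
rewrite -[RHS](addr0 0) -{1}(eq_subr0 H1121) -(mulr0 (- ((z - w) * f'))) -(eq_subr0 Haa).
rewrite /c /c'; ncring [:: z; w] HC.
Qed.

Lemma drinfeld_df' : (- z) * a' * f = ((- z - w) * f + w * f') * a'.
Proof.
apply: (mulIr_inv aV); apply: subr0_eq.
rewrite -[RHS](addr0 0) -{1}(eq_subr0 H1121') -(mulr0 ((- z - w) * f)) -(eq_subr0 Haa).
rewrite /c /c'; ncring [:: z; w] HC.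
Qed.

Lemma drinfeld_ed : z * e' * a = a * ((z - w) * e' + w * e).
Proof.
apply: (mulrI_inv Va'); apply: subr0_eq.
rewrite -[RHS](addr0 0) -{1}(eq_subr0 (esym H1112)) -(mul0r ((z - w) * e')) -(eq_subr0 Haa).
rewrite /b /b'; ncring [:: z; w] HC.
Qed.

Lemma drinfeld_ed' : (- z) * e * a' = a' * ((- z - w) * e + w * e').
Proof.
apply: (mulrI_inv Va); apply: subr0_eq.
rewrite -[RHS](addr0 0) -{1}(eq_subr0 (esym H1112')) -(mul0r (- ((- z - w) * e))) -(eq_subr0 Haa).
rewrite /b /b'; ncring [:: z; w] HC.
Qed.

Let Df := drinfeld_df.
Let Df' := drinfeld_df'.
Let Ed := drinfeld_ed.
Let Ed' := drinfeld_ed'.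

(** This is the RTT relation for t_21 = f d_1 with itself, after both factors d_1 are moved to the
    right of both factors f by [drinfeld_df] and [drinfeld_df'] and cancelled. *)
Lemma drinfeld_ff : (z + w) * ((z - w) * (f * f' + f' * f) + w * f * f) =
  w * (z - w) * f' * f'.
Proof.
apply: (mulIr_inv aV'); apply: (mulIr_inv aV); apply: subr0_eq.
have Haa0 := eq_subr0 Haa; have Df0 := eq_subr0 Df; have Df0' := eq_subr0 Df'.
have H0 := eq_subr0 H2121.
have E1 : (z + w) * f * (z * a * f' - ((z - w) * f' + w * f) * a) * a' = 0.
  by rewrite Df0 mulr0 mul0r.
have E2 : (z - w) * f' * (- z * a' * f - ((- z - w) * f + w * f') * a') * a = 0.
  by rewrite Df0' mulr0 mul0r.
have E3 : z * (z * (c * c' + c' * c) - w * - (c * c' - c' * c)) = 0 by rewrite H0 mulr0.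
have E4 g : g * (a * a' - a' * a) = 0 by rewrite Haa0 mulr0.
have -> : 0 = z * (z * (c * c' + c' * c) - w * - (c * c' - c' * c))
   - (z + w) * f * (z * a * f' - ((z - w) * f' + w * f) * a) * a'
   + (z - w) * f' * (- z * a' * f - ((- z - w) * f + w * f') * a') * a
   - ((z + w) * f * ((z - w) * f' + w * f)) * (a * a' - a' * a) :> Q.
  by rewrite E1 E2 E3 E4 !(addr0, subr0).
rewrite /c /c'; ncring [:: z; w] HC.
Qed.

(** In t_22(v) = f(v) d_1(v) e(v) + d_2(v) the series d_1(u) is moved past f(v) and e(v); what
    remains is its commutator with d_2(v). The exchanges cost the second factor z. *)
Lemma drinfeld_dd : z * z * (a * k' - k' * a) = 0.
Proof.
have Df0 := eq_subr0 Df; have Ed0 := eq_subr0 Ed.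
have H0 := eq_subr0 H1122; have Haa0 := eq_subr0 Haa.
have -> : z * z * (a * k' - k' * a) = z * (z * (a * d' - d' * a) - w * (c * b' - c' * b))
  - z * (z * a * f' - ((z - w) * f' + w * f) * a) * a' * e'
  + z * f' * a' * (z * e' * a - a * ((z - w) * e' + w * e))
  - z * ((z - w) * f') * (a * a' - a' * a) * e' - z * w * f' * (a' * a - a' * a) * e.
  rewrite /c /c' /b /b' /d /d'; ncring [:: z; w] HC.
by rewrite H0 Df0 Ed0 Haa0 subrr !(mulr0, mul0r, addr0, subr0).
Qed.

Lemma drinfeld_ef : z * z * (a * (e * f' + f' * e) * a') = z * w * (k' * a - k * a').
Proof.
apply: subr0_eq.
have Df0 := eq_subr0 Df; have Ed0 := eq_subr0 Ed; have Ed0' := eq_subr0 Ed'.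
have H0 := eq_subr0 H1221; have Haa0 := eq_subr0 Haa.
have -> : z * z * (a * (e * f' + f' * e) * a') - z * w * (k' * a - k * a') =
   z * (z * (b * c' + c' * b) - w * - (d * a' - d' * a))
 + z * (z * a * f' - ((z - w) * f' + w * f) * a) * e * a'
 - ((z - w) * f' + w * f) * a * (- z * e * a' - a' * ((- z - w) * e + w * e'))
 + w * f * a * (- z * e * a' - a' * ((- z - w) * e + w * e'))
 + w * f' * a' * (z * e' * a - a * ((z - w) * e' + w * e))
 + z * z * f' * (a * a' - a' * a) * e
 - w * f' * (a * a' - a' * a) * ((z - w) * e' + w * e).
  rewrite /c /c' /b /b' /d /d'; ncring [:: z; w] HC.
by rewrite H0 Df0 Ed0 Ed0' Haa0 !(mulr0, mul0r, addr0, subr0).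
Qed.

End DrinfeldRelations.

(** * Rings with a solution of the RTT relations *)

(* The RTT relation in the form
   (u - v) [t_ij(u), t_kl(v)] = +-(t_kj(u) t_il(v) - t_kj(v) t_il(u)). *)
Definition rtt (R : pzRingType) (t : bool -> bool -> ser R) : Prop :=
  (forall i j, t i j 0%N = (i == j)%:R) /\
  forall i j k l r s,
    (t i j r.+1 * t k l s - (-1) ^+ ((i + j) * (k + l)) * (t k l s * t i j r.+1))
    - (t i j r * t k l s.+1 - (-1) ^+ ((i + j) * (k + l)) * (t k l s.+1 * t i j r))
    = (-1) ^+ (i * j + i * k + j * k) * (t k j r * t i l s - t k j s * t i l r).

Section CommSer.
Variable R : pzRingType.
Implicit Types a b : ser R.

Lemma commC_coef a x : GRing.comm a (serC x) <-> forall n, GRing.comm (a n) x.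
Proof.
split=> [E n|E]; first by rewrite /GRing.comm -serMC E serCM.
by apply: funext => n; rewrite serMC serCM E.
Qed.

Lemma comm_xy a b : ofx a * ofy b = ofy b * ofx a <->
  forall r s, GRing.comm (a r) (b s).
Proof.
split=> [E r s|E]; first by rewrite /GRing.comm -ofxM E ofyM.
by apply: ser2P => r s; rewrite ofxM ofyM E.
Qed.

Lemma ser_comm a b : (forall r s, GRing.comm (a r) (b s)) -> GRing.comm a b.
Proof.
move=> H; apply: funext => n; rewrite !serM (reindex_inj rev_ord_inj).
by apply: eq_bigr => i _ /=; rewrite H subSS subKn // -ltnS.
Qed.

Lemma comm_ser_inv a b : a 0%N = 1 -> GRing.comm a b -> GRing.comm (ser_inv a) b.
Proof.
move=> a0 E; apply: (ser_mulI a0); rewrite mulrA ser_mulrV // mul1r.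
by rewrite mulrA E -mulrA ser_mulrV // mulr1.
Qed.

Lemma comm_ser_shift c a x : GRing.comm a (serC x) -> GRing.comm (ser_shift c a) (serC x).
Proof. by move=> E; rewrite /GRing.comm -(ser_shiftC c x) -!rmorphM E. Qed.

Lemma ser_sign n a r : ((-1) ^+ n * a) r = (-1) ^+ n * a r.
Proof. by rewrite -signr_odd -[in RHS]signr_odd !mulr_sign; case: odd. Qed.

End CommSer.

Section RTT.
Variables (R : pzRingType) (t : bool -> bool -> ser R).
Hypothesis t_rtt : rtt t.
Hypothesis R2 : forall x : R, x + x = 0 -> x = 0.

Let t0 i j : t i j 0%N = (i == j)%:R. Proof. by case: t_rtt. Qed.

Lemma rtt_const i j k l s : t i j 0%N * t k l s =
  (-1) ^+ ((i + j) * (k + l)) * (t k l s * t i j 0%N).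
Proof.
rewrite t0; case: i j => [] [] /=; rewrite ?mul0r ?mulr0 // mul1r mulr1 ?mul0n ?mul1r //.
by rewrite -signr_odd oddM /= mul1r.
Qed.

Lemma rtt_xy i j k l :
  zv R 0 * (ofx (t i j) * ofy (t k l) - (-1) ^+ ((i + j) * (k + l)) * (ofy (t k l) * ofx (t i j)))
  = wv R * ((-1) ^+ (i * j + i * k + j * k) *
            (ofx (t k j) * ofy (t i l) - ofy (t k j) * ofx (t i l))).
Proof.
have Z0 H : (zv R 0 * H) 0%N 0%N = 0 by rewrite /zv mulr0n subr0 mulrBl !ser2E subrr.
apply: ser2P => -[|r] [|s]; rewrite ?Z0 ?zvM ?zvM0l ?zvM0r ?wvM ?wvM0l ?wvM0r //;
  rewrite !(ser_sign, serB) !(ofxM, ofyM).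
- by rewrite rtt_const subrr.
- by rewrite (rtt_const k l i j) mulrA -exprD (mulnC (k + l)%N) addnn -muln2 exprM
    sqrr_sign mul1r subrr oppr0.
- by rewrite mulr0n subr0 (proj2 t_rtt).
Qed.

Lemma rtt_yx i j k l :
  (- zv R 0) * (ofy (t i j) * ofx (t k l) - (-1) ^+ ((i + j) * (k + l)) * (ofx (t k l) * ofy (t i j)))
  = wv R * ((-1) ^+ (i * j + i * k + j * k) *
            (ofy (t k j) * ofx (t i l) - ofx (t k j) * ofy (t i l))).
Proof.
have Z0 H : (zv R 0 * H) 0%N 0%N = 0 by rewrite /zv mulr0n subr0 mulrBl !ser2E subrr.
apply: ser2P => -[|r] [|s]; rewrite mulNr !serN ?Z0 ?zvM ?zvM0l ?zvM0r ?wvM ?wvM0l ?wvM0r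
  ?oppr0 //; rewrite !(ser_sign, serB) !(ofxM, ofyM).
- by rewrite (rtt_const k l i j) mulrA -exprD (mulnC (k + l)%N) addnn -muln2 exprM
    sqrr_sign mul1r subrr ?oppr0.
- by rewrite rtt_const subrr !oppr0.
- by rewrite addr0 opprB (proj2 t_rtt).
Qed.

Definition dr_d1 : ser R := t false false.
Definition dr_e : ser R := ser_inv dr_d1 * t false true.
Definition dr_f : ser R := t true false * ser_inv dr_d1.
Definition dr_d2 : ser R := t true true - dr_f * dr_d1 * dr_e.
Definition dr_h : ser R := ser_inv dr_d1 * dr_d2.

Local Notation d1 := dr_d1.
Local Notation d2 := dr_d2.
Local Notation e := dr_e.
Local Notation f := dr_f.
Local Notation h := dr_h.

Lemma dr_d1_0 : d1 0%N = 1. Proof. by rewrite /d1 t0. Qed.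
Lemma dr_e_0 : e 0%N = 0. Proof. by rewrite /e serM0 t0 mulr0. Qed.
Lemma dr_f_0 : f 0%N = 0. Proof. by rewrite /f serM0 t0 mul0r. Qed.
Lemma dr_d2_0 : d2 0%N = 1.
Proof. by rewrite /d2 serB !serM0 t0 dr_f_0 !mul0r subr0. Qed.
Lemma dr_h_0 : h 0%N = 1.
Proof. by rewrite /h serM0 ser_inv0 dr_d2_0 mul1r. Qed.

Lemma dr_t12 : t false true = d1 * e.
Proof. by rewrite /e mulrA ser_mulrV ?dr_d1_0 ?mul1r. Qed.
Lemma dr_t21 : t true false = f * d1.
Proof. by rewrite /f -mulrA ser_mulVr ?dr_d1_0 ?mulr1. Qed.
Lemma dr_t22 : t true true = f * d1 * e + d2.
Proof. by rewrite /d2 addrC subrK. Qed.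
Lemma dr_d2E : d2 = d1 * h.
Proof. by rewrite /h mulrA ser_mulrV ?dr_d1_0 ?mul1r. Qed.

Let a := ofx d1.
Let a' := ofy d1.
Let Va : ofx (ser_inv d1) * a = 1.
Proof. by rewrite -rmorphM ser_mulVr ?dr_d1_0 ?rmorph1. Qed.
Let aV : a * ofx (ser_inv d1) = 1.
Proof. by rewrite -rmorphM ser_mulrV ?dr_d1_0 ?rmorph1. Qed.
Let Va' : ofy (ser_inv d1) * a' = 1.
Proof. by rewrite -rmorphM ser_mulVr ?dr_d1_0 ?rmorph1. Qed.
Let aV' : a' * ofy (ser_inv d1) = 1.
Proof. by rewrite -rmorphM ser_mulrV ?dr_d1_0 ?rmorph1. Qed.

Let Hz : central (zv R 0). Proof. exact: central_zv. Qed.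
Let Hw : central (wv R). Proof. exact: central_wv. Qed.
Let HC := conj Hz (conj Hw I).

(** RTT says that u - v times the commutator equals the commutator, so u - v - 1 annihilates it. *)
Lemma dr_d1_comm : a * a' = a' * a.
Proof.
apply/eqP; rewrite -subr_eq0; apply/eqP.
apply: (@zv_reg0 _ 1); have := rtt_xy false false false false.
rewrite /= !expr0 !mul1r -/a -/a' => E.
have -> : zv R 1 = zv R 0 - wv R by rewrite /zv mulr0n subr0 mulr1n.
by rewrite mulrBl E subrr.
Qed.

Let H1121 : zv R 0 * (a * (ofy f * a') - ofy f * a' * a) = wv R * (ofx f * a * a' - ofy f * a' * a).
Proof. by have := rtt_xy false false true false; rewrite /= !expr0 !mul1r dr_t21 !rmorphM. Qed.
Let H1121' : - zv R 0 * (a' * (ofx f * a) - ofx f * a * a') = wv R * (ofy f * a' * a - ofx f * a * a').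
Proof. by have := rtt_yx false false true false; rewrite /= !expr0 !mul1r dr_t21 !rmorphM. Qed.
Let H1112 : zv R 0 * (a * (a' * ofy e) - a' * ofy e * a) = wv R * (a * (a' * ofy e) - a' * (a * ofx e)).
Proof. by have := rtt_xy false false false true; rewrite /= !expr0 !mul1r dr_t12 !rmorphM. Qed.
Let H1112' : - zv R 0 * (a' * (a * ofx e) - a * ofx e * a') =
  wv R * (a' * (a * ofx e) - a * (a' * ofy e)).
Proof. by have := rtt_yx false false false true; rewrite /= !expr0 !mul1r dr_t12 !rmorphM. Qed.
Let H2121 : zv R 0 * (ofx f * a * (ofy f * a') + ofy f * a' * (ofx f * a)) =
  wv R * (- (ofx f * a * (ofy f * a') - ofy f * a' * (ofx f * a))).
Proof.
by have := rtt_xy true false true false; rewrite /= !expr1 !mulN1r dr_t21 !rmorphM opprK.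
Qed.
Let H1221 : zv R 0 * (a * ofx e * (ofy f * a') + ofy f * a' * (a * ofx e)) =
  wv R * (- ((ofx f * a * ofx e + ofx d2) * a' - (ofy f * a' * ofy e + ofy d2) * a)).
Proof.
have := rtt_xy false true true false; rewrite /= !expr1 !mulN1r dr_t21 dr_t12 dr_t22.
by rewrite !rmorphD !rmorphM opprK.
Qed.
Let H1122 : zv R 0 * (a * (ofy f * a' * ofy e + ofy d2) - (ofy f * a' * ofy e + ofy d2) * a) =
  wv R * (ofx f * a * (a' * ofy e) - ofy f * a' * (a * ofx e)).
Proof.
have := rtt_xy false false true true; rewrite /= !expr0 !mul1r dr_t21 dr_t12 dr_t22.
by rewrite !rmorphD !rmorphM.
Qed.

Let Df := drinfeld_df Hz Hw aV' dr_d1_comm H1121.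

Lemma dr_df_xy : zv R 0 * ofx d1 * ofy f =
  ((zv R 0 - wv R) * ofy f + wv R * ofx f) * ofx d1.
Proof. exact: Df. Qed.

Lemma dr_df r s : d1 r.+1 * f s.+1 =
  d1 r * f s.+2 + f s.+1 * d1 r.+1 - f s.+2 * d1 r - f s.+1 * d1 r.
Proof.
have := ser2_eq Df r.+1 s.+2.
rewrite -mulrA zvM mulr0n subr0 !ofxM mulrDl !serD -!mulrA mulrBl !serB.
rewrite zvM !wvM xvM yvM mulr0n subr0 !ofyM.
have -> : (ofx f * a) r s.+1 = 0 by rewrite -rmorphM /= /ofx /ser_map.
by rewrite addr0 => /eqP; rewrite subr_eq => /eqP ->; rewrite addrC !addrA.
Qed.

(** With S the anticommutator, [drinfeld_ff] rearranges to (z + w)((z - w) S + w f(u)^2 - w f(v)^2)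
    = -2 w^2 f(v)^2. The right side involves x only as x^2, so [zv_reg_swap] with N = 2 kills the
    bracket; then 2 f(v)^2 = 0, and 2 is regular. Once f^2 = 0, both z + w and z - w can be
    cancelled from (z + w)(z - w) S = 0. *)
Lemma dr_ff_f2 : ofx f * ofy f + ofy f * ofx f = 0 /\ f * f = 0.
Proof.
have E := drinfeld_ff Hz Hw aV aV' dr_d1_comm H1121 H1121' H2121.
set S := ofx f * ofy f + ofy f * ofx f in E *.
have F2 : f * f = 0.
  have E2 : (zv R 0 + wv R) * ((zv R 0 - wv R) * S + wv R * ofx f * ofx f - wv R * ofy f * ofy f)
      = - (wv R * (wv R * (ofy (f * f) *+ 2))).
    rewrite mulrBr E [ofy (f * f)]rmorphM /=; move: (zv R 0) (wv R) Hz Hw => z w z_c w_c.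
    by ncring [:: z; w] (conj z_c (conj w_c I)).
  have P0 := E2; move: P0 => /(zv_reg_swap (N := 2) isT) P0.
  move: E2; rewrite P0; last first.
    move=> [|[|[|r]]] [|[|s]] // _; rewrite !serN !(wvM, wvM0l, wvM0r) ?oppr0 //.
    by rewrite !serMn -[ofy _ _ _]/(0 : R) mul0rn oppr0.
  rewrite mulr0 => /esym/eqP; rewrite oppr_eq0 => /eqP/wv_reg/wv_reg E3.
  apply: funext => s; apply: R2; have := ser2_eq E3 0 s.
  by rewrite serMn mulr2n.
split=> //; apply: (@zv_reg0 _ 1); apply: (@zv_reg_swap _ _ 0 1) => //.
have -> : zv R 1 = zv R 0 - wv R by rewrite /zv mulr0n subr0 mulr1n.
have -> : (zv R 0 + wv R) * ((zv R 0 - wv R) * S) =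
    (zv R 0 + wv R) * ((zv R 0 - wv R) * S + wv R * ofx f * ofx f)
    - (zv R 0 + wv R) * wv R * ofx (f * f).
  rewrite [ofx (f * f)]rmorphM /=; move: (zv R 0) (wv R) Hz Hw => z w z_c w_c.
  by ncring [:: z; w] (conj z_c (conj w_c I)).
have F2y : ofy f * ofy f = 0 by rewrite -rmorphM F2 rmorph0.
by rewrite E F2 rmorph0 mulr0 subr0 -mulrA F2y mulr0.
Qed.

Lemma dr_ff r s : f r * f s = - (f s * f r).
Proof.
apply/eqP; rewrite -addr_eq0 -ofxM -ofyM -serD -serD.
by rewrite (proj1 dr_ff_f2).
Qed.

Lemma dr_f2 r : f r * f r = 0.
Proof. by apply: R2; rewrite {1}dr_ff addNr. Qed.

Lemma dr_d1_d2 : a * ofy d2 = ofy d2 * a.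
Proof.
have := drinfeld_dd Hz Hw Va' aV' dr_d1_comm H1121 H1112 H1122.
by rewrite -mulrA => /zv_reg0/zv_reg0/subr0_eq.
Qed.

Lemma dr_d1C r s : GRing.comm (d1 r) (d1 s).
Proof. by move: r s; apply/comm_xy; exact: dr_d1_comm. Qed.

Lemma dr_d1_dr_h : a * ofy h = ofy h * a.
Proof.
rewrite /h rmorphM mulrA.
have -> : a * ofy (ser_inv d1) = ofy (ser_inv d1) * a.
  apply: (mulrI_inv Va'); rewrite !mulrA aV' mul1r -dr_d1_comm -mulrA aV' mulr1 //.
by rewrite -!mulrA dr_d1_d2.
Qed.

Lemma dr_d1_h r s : GRing.comm (d1 r) (h s).
Proof. by move: r s; apply/comm_xy; exact: dr_d1_dr_h. Qed.

Lemma dr_ef_xy : zv R 0 * (ofx e * ofy f + ofy f * ofx e) = wv R * (ofy h - ofx h).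
Proof.
have := drinfeld_ef Hz Hw Va Va' aV' dr_d1_comm H1121 H1112 H1112' H1221.
rewrite -!(mulrA (zv R 0)) => /eqP; rewrite -subr_eq0 -mulrBr => /eqP/zv_reg0/subr0_eq E.
apply: (mulrI_inv Va); apply: (mulIr_inv aV').
transitivity (wv R * (ofy d2 * a - ofx d2 * a')).
  by rewrite -E; move: (zv R 0) Hz (wv R) Hw => z z_c w w_c; ncring [:: z] (conj z_c I).
have -> : ofy d2 = a' * ofy h by rewrite {1}dr_d2E rmorphM.
have -> : ofx d2 = a * ofx h by rewrite {1}dr_d2E rmorphM.
have Hh : a' * ofy h = ofy h * a'.
  by rewrite -!rmorphM; congr ofy; apply: ser_comm => r s; apply: dr_d1_h.
rewrite Hh -(mulrA _ a') -dr_d1_comm mulrA -dr_d1_dr_h.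
by move: (wv R) Hw => w w_c; ncring [:: w] (conj w_c I).
Qed.

(** In (u - v)(e(u) f(v) + f(v) e(u)) = h(v) - h(u) the right side has no mixed terms. Hence the
    anticommutator depends only on the sum of the indices, and the coefficient of lowest order in
    1/u identifies it. *)
Lemma dr_ef r s : e r.+1 * f s.+1 + f s.+1 * e r.+1 = h (r + s).+1.
Proof.
have E q q' := ser2_eq dr_ef_xy q.+1 q'.+1.
have ofx0 x q q' : ofx x q q'.+1 = 0 :> R by [].
have ofy0 x q q' : ofy x q.+1 q' = 0 :> R by [].
elim: r s => [|r IH] s.
  have := E 0%N s.+1; rewrite zvM mulr0n subr0 wvM !serB !serD !(ofxM, ofyM).
  by rewrite dr_e_0 mul0r mulr0 addr0 subr0 => ->; rewrite ofx0 subr0.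
have := E r.+1 s.+1; rewrite zvM mulr0n subr0 wvM !serB !serD !(ofxM, ofyM) subr0 => /eqP.
rewrite IH addnS subr_eq => /eqP ->; rewrite addrC addSn.
by rewrite ofy0 ?addr0 ?add0r.
Qed.

(** Writing h as an anticommutator of e and f, the Jacobi identity gives [h^(r+q+1), f^(q'+1)] +
    [h^(r+q'+1), f^(q+1)] = [e^(r+1), f^(q+1) f^(q'+1) + f^(q'+1) f^(q+1)] = 0. Taking q = q' and
    dividing by 2 settles the case s <= n; taking r = 0 exchanges the two indices and settles the
    rest. *)
Lemma dr_hf n s : GRing.comm (h n) (f s).
Proof.
case: s => [|s]; first by rewrite dr_f_0 /GRing.comm mulr0 mul0r.
case: n => [|n]; first by rewrite dr_h_0; apply: commr_sym; exact: commr1.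
pose phi n s := h n.+1 * f s.+1 - f s.+1 * h n.+1.
have phiE r q q' : phi (r + q)%N q' + phi (r + q')%N q = 0.
  rewrite /phi -!dr_ef.
  have -> : forall x y y' : R, (x * y + y * x) * y' - y' * (x * y + y * x)
      + ((x * y' + y' * x) * y - y * (x * y' + y' * x))
    = x * (y * y' + y' * y) - (y * y' + y' * y) * x.
    by move=> x y y'; ncring (@nil R) I.
  by rewrite (dr_ff q.+1) addNr mulr0 mul0r subr0.
have phi0 q q' : (q' <= q)%N -> phi q q' = 0.
  by move=> /subnK E; apply: R2; have := phiE (q - q')%N q' q'; rewrite E.
apply: subr0_eq; rewrite -/(phi n s); case: (leqP s n) => [/phi0 //|/ltnW ns].
by have := phiE 0%N n s; rewrite !add0n (phi0 s n) // addr0.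
Qed.

End RTT.

(** * Commutation of b_1(u) with f(v) *)

Section ProdShift.
Variables (R : pzRingType) (a f : ser R).
Hypothesis a0 : a 0%N = 1.
Hypothesis Hdf : zv R 0 * ofx a * ofy f =
  ((zv R 0 - wv R) * ofy f + wv R * ofx f) * ofx a.

Lemma df_shift m : zv R m * ofx (ser_shift m a) * ofy f =
  ((zv R m - wv R) * ofy f + wv R * ofx (ser_shift m f)) * ofx (ser_shift m a).
Proof.
pose x' := ser_shift m (xv R).
have Ex : x' - xv R * (m%:R * x' + 1) = 0.
  have := ser_shift_rec m (xv R); rewrite -/x'.
  have -> : serC (xv R 0%N) = 0 by rewrite -[xv R 0%N]/(0 : ser R) rmorph0.
  have -> : ser_tail (xv R) = 1 by apply: funext => -[].
  by rewrite subr0 rmorph1 => /eq_subr0.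
have Z0 : zv R 0 = yv R - xv R by rewrite /zv mulr0n subr0.
have := congr1 (ser_shift m) Hdf.
rewrite Z0 /wv !(rmorphM, rmorphB, rmorphD) /= -!ser_map_shift !ser_shiftC.
rewrite -/x' -/(ofx (ser_shift m a)) -/(ofx (ser_shift m f)) -/(yv R) -/(ofy f).
move: (ofx (ser_shift m a)) (ofx (ser_shift m f)) (ofy f) => A G F' /eq_subr0 E.
apply: subr0_eq.
have -> : zv R m = yv R - xv R - m%:R * (xv R * yv R).
  by rewrite /zv /wv mulr_natl.
rewrite /wv; move: (@ser_nat_central (ser R) m) Ex E (@xv_central R) (@yv_central R).
move: (m%:R : ser (ser R)) (xv R) (yv R) x' => k x y x' k_c Ex E x_c y_c.
(* Since (1 - m x) x' = x, one has (1 - m x)(y - x') = y - x - m x y: the shifted relation times 1 -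
   m x is the claim, up to a multiple of [Ex]. *)
have -> : (y - x - k * (x * y)) * A * F' -
    ((y - x - k * (x * y) - x * y) * F' + x * y * G) * A =
  (1 - k * x) * ((y - x') * A * F' - ((y - x' - x' * y) * F' + x' * y * G) * A)
  + (x' - x * (k * x' + 1)) * (A * F' - (F' + y * F' - y * G) * A).
  by ncring [:: k; x; y] (conj k_c (conj x_c (conj y_c I))).
by rewrite Ex E mulr0 mul0r addr0.
Qed.

Definition prod_shift m : ser R := \prod_(j < m) ser_shift j a.

Lemma prod_shift0 m : prod_shift m 0%N = 1.
Proof.
rewrite /prod_shift; elim: m => [|m IH]; first by rewrite big_ord0.
by rewrite big_ord_recr /= serM0 IH mul1r.
Qed.

(* Conjugation by [prod_shift m] maps [f(v)] to
   [((u - m - v) f(v) + g(u)) / (u - v)], where [g] does not depend on [v]. *)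
Lemma prod_shift_df m : exists g : ser R, zv R 0 * ofx (prod_shift m) * ofy f =
  (zv R m * ofy f + wv R * ofx g) * ofx (prod_shift m).
Proof.
elim: m => [|m [g IH]].
  by exists 0; rewrite /prod_shift big_ord0 !rmorph1 rmorph0 mulr0 addr0 !mulr1.
set D := prod_shift m in IH *; set s := ser_shift m a.
have -> : prod_shift m.+1 = D * s by rewrite /prod_shift big_ord_recr.
(* The conjugate of f(u - m) by D(u): it lets the new contribution be written to the left of the
   product. *)
pose q := D * ser_shift m f * ser_inv D.
have qE : ofx D * ofx (ser_shift m f) = ofx q * ofx D.
  by rewrite -!rmorphM -mulrA ser_mulVr ?mulr1 //; exact: prod_shift0.
exists (g + q); rewrite rmorphM /=; apply: subr0_eq.
(* Multiplied by u - m - v, the difference of the two sides becomes w^2 times a series in u alone,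
   hence is concentrated in y^2. *)
apply: (@zv_reg R m 2 _ (wv R * (wv R * ofx ((q *+ m - g) * D * s)))) => // [r t t2|].
  case: r t t2 => [|[|r]] [|[|[|t]]] // _; rewrite !(wvM, wvM0l, wvM0r) //.
have Sm := df_shift m; rewrite -/s in Sm.
have -> : zv R m.+1 = zv R m - wv R by rewrite /zv mulrSr opprD addrA.
rewrite [ofx (g + q)]rmorphD [ofx (_ * s)]rmorphM /= [ofx (_ * D)]rmorphM /=.
rewrite [ofx (_ - g)]rmorphB rmorphMn /=.
have Z0 : zv R 0 = zv R m + wv R *+ m by rewrite /zv subr0 subrK.
have -> : ofx q *+ m = m%:R * ofx q by rewrite mulr_natl.
move: (@central_zv R m) (@central_wv R) (@ser_nat_central (ser R) m) IH Sm qE.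
rewrite Z0 -[wv R *+ m]mulr_natl.
move: (ofx D) (ofx s) (ofx g) (ofx q) (ofx (ser_shift m f)) (ofy f) => {D s g q Z0}.
move: (m%:R : ser (ser R)) (zv R m) (wv R) => k z w D s g q f1 f' z_c w_c k_c.
move=> /eq_subr0 IH /eq_subr0 Sm /eq_subr0 qE; apply: subr0_eq.
have -> : z * ((z + k * w) * (D * s) * f' - ((z - w) * f' + w * (g + q)) * (D * s))
    - w * (w * ((k * q - g) * D * s)) =
  (z + k * w) * D * (z * s * f' - ((z - w) * f' + w * f1) * s)
  + (z - w) * ((z + k * w) * D * f' - (z * f' + w * g) * D) * s
  + (z + k * w) * w * (D * f1 - q * D) * s.
  by ncring [:: z; w; k] (conj z_c (conj w_c (conj k_c I))).
by rewrite IH Sm qE !(mulr0, mul0r, addr0).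
Qed.

(** As p = 0, the factors u - p - v and u - v agree, so [prod_shift_df] becomes z [D(u), f(v)] = w
    g(u) D(u) for the product D of p shifts. The right side is concentrated in y^1, and regularity
    makes the commutator vanish whatever g is. *)
Lemma prod_shift_comm p : p%:R = 0 :> R ->
  forall r s, GRing.comm (prod_shift p r) (f s).
Proof.
move=> p0; have [g E] := prod_shift_df p; set D := prod_shift p in E *.
apply/comm_xy; apply: subr0_eq.
apply: (@zv_reg R 0 1 _ (wv R * ofx (g * D))) => // [[|r] [|[|s]]|] //.
- by rewrite wvM0l.
- by rewrite wvM0l.
- by rewrite wvM0r.
- by rewrite wvM.
have Zp : zv R p = zv R 0.
  congr (_ - _); apply: ser2P => r s; rewrite mulr0n !serMn -mulr_natl p0.
  by rewrite mul0r.
rewrite [ofx (g * D)]rmorphM /= mulrBr (mulrA (zv R 0)) E Zp.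
by ncring [:: zv R 0; wv R] (conj (@central_zv R 0) (conj (@central_wv R) I)).
Qed.

End ProdShift.

(** * Highest weight left ideals *)

Section HighestWeight.
Variables (K : fieldType) (R : pzRingType) (io : {rmorphism K -> R}).
Hypothesis io_central : forall c, central (io c).
Variable t : bool -> bool -> ser R.
Hypothesis t_rtt : rtt t.
Hypothesis R2 : forall x : R, x + x = 0 -> x = 0.
Variable J : R -> Prop.
Hypotheses (J0 : J 0) (JD : forall x y, J x -> J y -> J (x + y))
  (JM : forall x y, J y -> J (x * y)).

Lemma J_opp x : J x -> J (- x).
Proof. by move=> Hx; rewrite -mulN1r; apply: JM. Qed.
Lemma J_sub x y : J x -> J y -> J (x - y).
Proof. by move=> Hx /J_opp; apply: JD. Qed.
Lemma J_sum I (r : seq I) (P : pred I) (F : I -> R) :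
  (forall i, P i -> J (F i)) -> J (\sum_(i <- r | P i) F i).
Proof. by move=> H; elim/big_ind: _. Qed.

Definition Jser (a : ser R) := forall n, J (a n).

Lemma Jser_mul a b : Jser b -> Jser (a * b).
Proof. by move=> Hb n; rewrite serM; apply: J_sum => i _; apply: JM. Qed.

Lemma Jser_shift c a : Jser a -> Jser (ser_shift c a).
Proof. by move=> Ha [|n] //=; apply: J_sum => i _; apply: JM. Qed.

(** The series a(u) acts on the class of 1 in R / J by the scalar series [ka]. Products are
    respected because [J] is a left ideal and scalars are central. *)
Definition Jeq (a : ser R) (ka : ser K) := Jser (a - ser_map io ka).

Lemma ser_map_central (ka : ser K) : central (ser_map io ka).
Proof. by apply: ser_central => n; apply: io_central. Qed.

Lemma JeqM a b ka kb : Jeq a ka -> Jeq b kb -> Jeq (a * b) (ka * kb).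
Proof.
move=> Ha Hb n; rewrite rmorphM /=.
have -> : a * b - ser_map io ka * ser_map io kb =
    a * (b - ser_map io kb) + ser_map io kb * (a - ser_map io ka).
  have c1 := @ser_map_central ka; have c2 := @ser_map_central kb.
  by ncring [:: ser_map io ka; ser_map io kb] (conj c1 (conj c2 I)).
by rewrite serD; apply: JD; apply: Jser_mul.
Qed.

Lemma Jeq1 : Jeq 1 1.
Proof. by move=> n; rewrite rmorph1 subrr. Qed.

Lemma Jeq_inv (a : ser R) (ka : ser K) :
  a 0%N = 1 -> ka 0%N = 1 -> Jeq a ka -> Jeq (ser_inv a) (ser_inv ka).
Proof.
move=> a0 k0 H n; set k' := ser_map io (ser_inv ka).
have kV : ser_map io ka * k' = 1 by rewrite -rmorphM ser_mulrV // rmorph1.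
have -> : ser_inv a - k' = - (k' * ser_inv a * (a - ser_map io ka)).
  rewrite mulrBr -(mulrA k' _ a) ser_mulVr // mulr1.
  by rewrite -mulrA -(ser_map_central ka) mulrA -(ser_map_central ka) kV mul1r opprB.
by apply: J_opp; apply: Jser_mul.
Qed.

Lemma Jeq_shift c a ka : Jeq a ka -> Jeq (ser_shift c a) (ser_shift c ka).
Proof. by move=> H; rewrite /Jeq ser_map_shift -rmorphB; apply: Jser_shift. Qed.

Lemma Jeq_prod_shift m a ka : Jeq a ka -> Jeq (prod_shift a m) (prod_shift ka m).
Proof.
move=> H; rewrite /prod_shift; elim: m => [|m IH]; first by rewrite !big_ord0; exact: Jeq1.
by rewrite !big_ord_recr; apply: JeqM => //; apply: Jeq_shift.
Qed.

Variable lam : bool -> ser K.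
Hypothesis lam0 : forall i, lam i 0%N = 1.
Hypothesis Je : forall r, J (dr_e t r.+1).
Hypothesis Jd1 : Jeq (dr_d1 t) (lam false).
Hypothesis Jd2 : Jeq (dr_d2 t) (lam true).

Local Notation d1 := (dr_d1 t).
Local Notation d2 := (dr_d2 t).
Local Notation e := (dr_e t).
Local Notation f := (dr_f t).
Local Notation h := (dr_h t).

Definition mu : ser K := ser_inv (lam false) * lam true.

Lemma Jh : Jeq h mu.
Proof.
apply: JeqM => //; apply: Jeq_inv => //; exact: dr_d1_0.
Qed.

(* Stability under every t_ij^(r) ([fstable_t]) is the spanning half of the PBW theorem for the
   baby Verma module. *)
Inductive fspan : R -> Prop :=
  | fspan_J x : J x -> fspan x
  | fspan_1 : fspan 1
  | fspan_D x y : fspan x -> fspan y -> fspan (x + y)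
  | fspan_Z c x : fspan x -> fspan (io c * x)
  | fspan_f s x : fspan x -> fspan (f s * x).

Lemma fspan_opp x : fspan x -> fspan (- x).
Proof. by move/(fspan_Z (- 1)); rewrite rmorphN1 mulN1r. Qed.
Lemma fspan0 : fspan 0. Proof. exact: fspan_J. Qed.

Definition fstable (a : ser R) := forall n x, fspan x -> fspan (a n * x).

Lemma fstableM a b : fstable a -> fstable b -> fstable (a * b).
Proof.
move=> Ha Hb n x Hx; rewrite serM mulr_suml; elim/big_ind: _ => [|*|i _].
- exact: fspan0.
- exact: fspan_D.
- by rewrite -mulrA; apply: Ha; apply: Hb.
Qed.

Lemma fstable_h : fstable h.
Proof.
move=> n x; elim=> {x} [x Hx||x y _ IHx _ IHy|c x _ IH|s x _ IH].
- by apply: fspan_J; apply: JM.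
- have -> : h n * 1 = (h n - io (mu n)) + io (mu n) * 1 by rewrite !mulr1 subrK.
  by apply: fspan_D; [apply: fspan_J; apply: Jh|apply: fspan_Z; apply: fspan_1].
- by rewrite mulrDr; apply: fspan_D.
- by rewrite mulrA -io_central -mulrA; apply: fspan_Z.
- by rewrite mulrA (dr_hf t_rtt R2) -mulrA; apply: fspan_f.
Qed.

(** The inner induction on n uses [dr_df], which lowers the index of d_1 at the price of raising
    that of f; the other terms have f on the left. *)
Lemma fstable_d1 : fstable d1.
Proof.
move=> n x Hx; elim: Hx n => {x} [x Hx||x y _ IHx _ IHy|c x _ IH|s x Hx IH] n.
- by apply: fspan_J; apply: JM.
- have -> : d1 n * 1 = (d1 n - io (lam false n)) + io (lam false n) * 1.
    by rewrite !mulr1 subrK.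
  by apply: fspan_D; [apply: fspan_J; apply: Jd1|apply: fspan_Z; apply: fspan_1].
- by rewrite mulrDr; apply: fspan_D.
- by rewrite mulrA -io_central -mulrA; apply: fspan_Z.
- case: s => [|s]; first by rewrite (dr_f_0 t_rtt) mul0r mulr0; apply: fspan0.
  elim: n s => [|n IHn] s; first by rewrite (dr_d1_0 t_rtt) mul1r; apply: fspan_f.
  rewrite mulrA (dr_df t_rtt) !mulrBl mulrDl -!mulrA.
  apply: fspan_D; last by apply: fspan_opp; apply: fspan_f; apply: IH.
  apply: fspan_D; last by apply: fspan_opp; apply: fspan_f; apply: IH.
  by apply: fspan_D; [apply: IHn|apply: fspan_f; apply: IH].
Qed.

Lemma fstable_e : fstable e.
Proof.
case=> [x _|n x]; first by rewrite (dr_e_0 t_rtt) mul0r; apply: fspan0.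
elim=> {x} [x Hx||x y _ IHx _ IHy|c x _ IH|s x Hx IH].
- by apply: fspan_J; apply: JM.
- by rewrite mulr1; apply: fspan_J.
- by rewrite mulrDr; apply: fspan_D.
- by rewrite mulrA -io_central -mulrA; apply: fspan_Z.
- case: s => [|s]; first by rewrite (dr_f_0 t_rtt) mul0r mulr0; apply: fspan0.
  have E : e n.+1 * f s.+1 = h (n + s).+1 - f s.+1 * e n.+1.
    by rewrite -(dr_ef t_rtt) addrK.
  rewrite mulrA E mulrBl -mulrA; apply: fspan_D; first exact: fstable_h.
  by apply: fspan_opp; apply: fspan_f.
Qed.

Lemma fstable_f : fstable f. Proof. by move=> n x; apply: fspan_f. Qed.

Lemma fstable_t i j : fstable (t i j).
Proof.
have fe := fstable_e; have fd1 := fstable_d1; have ff := fstable_f.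
have fd2 : fstable d2 by rewrite (dr_d2E t_rtt); apply: fstableM => //; exact: fstable_h.
case: i j => [] [].
- rewrite (dr_t22 t) => n x Hx; rewrite serD mulrDl.
  by apply: fspan_D; [apply: (fstableM (fstableM ff fd1) fe)|apply: fd2].
- by rewrite (dr_t21 t_rtt); apply: fstableM.
- by rewrite (dr_t12 t_rtt); apply: fstableM.
- exact: fd1.
Qed.

(** An element commuting with every f^(s) and killing the highest weight vector kills everything
    spanned from that vector by the f^(s). *)
Lemma J_of_comm b x : (forall s, GRing.comm b (f s)) -> J b -> fspan x -> J (b * x).
Proof.
move=> bf Jb; elim=> {x} [x Hx||x y _ IHx _ IHy|c x _ IH|s x Hx IH].
- exact: JM.
- by rewrite mulr1.
- by rewrite mulrDr; apply: JD.
- by rewrite mulrA -io_central -mulrA; apply: JM.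
- by rewrite mulrA bf -mulrA; apply: JM.
Qed.

(** * The coefficients of b_1 and b_2 annihilate restricted highest weight modules *)

Section Center.
Variable p : nat.
Hypothesis Kp : p%:R = 0 :> K.
Hypothesis lam_restricted : forall i, prod_shift (lam i) p = 1.

Let Rp : p%:R = 0 :> R. Proof. by rewrite -(rmorph_nat io) Kp rmorph0. Qed.

Let b1 := prod_shift d1 p.
Let b2 := prod_shift (ser_inv d2) p.

Lemma comm_prod_shift (a : ser R) x m :
  GRing.comm a (serC x) -> GRing.comm (prod_shift a m) (serC x).
Proof.
move=> H; rewrite /prod_shift; elim: m => [|m IH].
  by rewrite big_ord0; apply: commr_sym; apply: commr1.
rewrite big_ord_recr /=; apply: commr_sym.
by apply: commrM; apply: commr_sym => //; apply: comm_ser_shift.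
Qed.

Lemma b1_f n s : GRing.comm (b1 n) (f s).
Proof. exact: (prod_shift_comm (dr_d1_0 t_rtt) (dr_df_xy t_rtt) Rp). Qed.

Lemma d1_h_comm : GRing.comm d1 h.
Proof. by apply: ser_comm => r s; apply: dr_d1_h. Qed.

Lemma d1_d2V : d1 * ser_inv d2 = ser_inv h.
Proof.
have h0 := dr_h_0 t_rtt; have d20 := dr_d2_0 t_rtt.
apply: ser_inv_uniq => //; rewrite mulrA -d1_h_comm -dr_d2E //.
exact: ser_mulrV.
Qed.

Lemma d1_d2V_comm m r s : GRing.comm (prod_shift (ser_inv d2) m s) (d1 r).
Proof.
move: s; apply/commC_coef; apply: comm_prod_shift; apply: comm_ser_inv.
  exact: dr_d2_0.
rewrite dr_d2E //; apply: commr_sym; apply: commrM; apply: commr_sym; apply/commC_coef => n.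
  exact: (dr_d1C t_rtt).
by apply: commr_sym; apply: (dr_d1_h t_rtt).
Qed.

(** The shifts of d_1 commute with those of 1/d_2, so the factors can be paired, and d_1 / d_2 =
    1/h. *)
Lemma b12 : b1 * b2 = prod_shift (ser_inv h) p.
Proof.
rewrite /b1 /b2; elim: p => [|m IH]; first by rewrite /prod_shift !big_ord0 mulr1.
have c : GRing.comm (ser_shift m d1) (prod_shift (ser_inv d2) m).
  apply: ser_comm => r s; move: r; apply/commC_coef; apply: comm_ser_shift.
  by apply/commC_coef => r; apply: commr_sym; apply: d1_d2V_comm.
move: IH c; rewrite /prod_shift !big_ord_recr /= => IH c.
by rewrite mulrA -(mulrA _ (ser_shift m d1)) c mulrA IH -mulrA -rmorphM d1_d2V.
Qed.

(** By [b12], b_2 is the inverse of b_1 times a product of shifts of 1/h, and both commute with f.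
    This takes the place of an exchange relation between d_2 and f. *)
Lemma b2_f n s : GRing.comm (b2 n) (f s).
Proof.
have b10 : b1 0%N = 1 by apply: prod_shift0; exact: dr_d1_0.
have -> : b2 = ser_inv b1 * prod_shift (ser_inv h) p.
  by rewrite -b12 mulrA ser_mulVr // mul1r.
move: n; apply/commC_coef; apply: commr_sym; apply: commrM; apply: commr_sym.
  by apply: comm_ser_inv => //; apply/commC_coef => n; apply: b1_f.
apply: comm_prod_shift; apply: comm_ser_inv; first exact: dr_h_0.
by apply/commC_coef => n; apply: dr_hf.
Qed.

Lemma J_b1 n x : (0 < n)%N -> fspan x -> J (b1 n * x).
Proof.
move=> n0; apply: J_of_comm => [s|]; first exact: b1_f.
have := @Jeq_prod_shift p _ _ Jd1 n; rewrite lam_restricted rmorph1 serB ser1E.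
by rewrite -[n == 0%N]negbK -lt0n n0 subr0.
Qed.

Lemma prod_shift_lamV i : prod_shift (ser_inv (lam i)) p = 1.
Proof.
rewrite -[LHS]mulr1 -[X in _ * X](lam_restricted i) /prod_shift.
have mulC (a b : ser K) : a * b = b * a by apply: ser_comm => r s; apply: mulrC.
elim: p => [|m IH]; first by rewrite !big_ord0 mulr1.
rewrite !big_ord_recr /= -(mulrA (\prod_(_ < m) _)) (mulrA (ser_shift _ _)).
rewrite (mulC (ser_shift m _)) -!mulrA -rmorphM ser_mulVr // rmorph1 mulr1.
exact: IH.
Qed.

Lemma J_b2 n x : (0 < n)%N -> fspan x -> J (b2 n * x).
Proof.
move=> n0; apply: J_of_comm => [s|]; first exact: b2_f.
have d20 := dr_d2_0 t_rtt.
have := @Jeq_prod_shift p _ _ (Jeq_inv d20 (lam0 true) Jd2) n.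
rewrite prod_shift_lamV rmorph1 serB ser1E.
by rewrite -[n == 0%N]negbK -lt0n n0 subr0.
Qed.

End Center.

(** * Anticommuting words in the f^(s) and locality of the highest weight module *)

Definition fword (w : seq nat) : R := foldr (fun s x => f s * x) 1 w.

Lemma fword_cat w1 w2 : fword (w1 ++ w2) = fword w1 * fword w2.
Proof. by elim: w1 => [|s w IH] /=; rewrite ?mul1r // IH mulrA. Qed.

Lemma f_fword s w : s \in w -> f s * fword w = 0.
Proof.
elim: w => [|r w IH] //=; rewrite inE => /predU1P[->|/IH E].
  by rewrite mulrA (dr_f2 t_rtt R2) mul0r.
by rewrite mulrA (dr_ff t_rtt R2) mulNr -mulrA E mulr0 oppr0.
Qed.

Lemma fword_dup w : ~~ uniq w -> fword w = 0.
Proof.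
by elim: w => [|s w IH] //=; rewrite negb_and negbK => /orP[/f_fword|/IH->]; rewrite ?mulr0.
Qed.

(** The k-th power of the augmentation ideal in the algebra generated by the finitely many f^(s)
    with s in S. It is 0 once k exceeds the size of S, since a longer word repeats a letter. *)
Definition nilspan (S : seq nat) (k : nat) (x : R) : Prop :=
  exists2 l : seq (K * seq nat),
    all (fun cw => (k <= size cw.2)%N && all (mem S) cw.2) l &
    x = \sum_(cw <- l) io cw.1 * fword cw.2.

Lemma nilspan0 S k : nilspan S k 0.
Proof. by exists [::]; rewrite ?big_nil. Qed.

Lemma nilspanD S k x y : nilspan S k x -> nilspan S k y -> nilspan S k (x + y).
Proof.
by move=> [l Hl ->] [l' Hl' ->]; exists (l ++ l'); rewrite ?all_cat ?Hl // big_cat.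
Qed.

Lemma nilspanW S S' k k' x : {subset S <= S'} -> (k' <= k)%N ->
  nilspan S k x -> nilspan S' k' x.
Proof.
move=> SS kk [l Hl ->]; exists l => //; apply: sub_all Hl => cw /andP[/(leq_trans kk) -> /=].
by apply: sub_all.
Qed.

Lemma nilspanM S k k' x y : nilspan S k x -> nilspan S k' y -> nilspan S (k + k') (x * y).
Proof.
move=> [l Hl ->] [l' Hl' ->].
exists [seq (c.1 * c'.1, c.2 ++ c'.2) | c <- l, c' <- l'].
  apply/allP => _ /allpairsP[[c c'] /= [cl cl' ->]] /=; rewrite size_cat all_cat.
  by have /andP[? ->] := allP Hl _ cl; have /andP[? ->] := allP Hl' _ cl'; rewrite leq_add.
rewrite big_allpairs_dep /= big_distrl /=; apply: eq_bigr => c _.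
rewrite big_distrr /=; apply: eq_bigr => c' _; rewrite rmorphM fword_cat -!mulrA.
by congr (_ * _); rewrite !mulrA io_central.
Qed.

Lemma nilspan_Z S k c x : nilspan S k x -> nilspan S k (io c * x).
Proof.
move=> H; rewrite -[k]add0n; apply: nilspanM => //.
by exists [:: (c, [::])]; rewrite // big_seq1 mulr1.
Qed.

Lemma nilspan_eq0 S k x : (size S < k)%N -> nilspan S k x -> x = 0.
Proof.
move=> Sk [l Hl ->]; rewrite big1_seq // => -[c w] /andP[_ /(allP Hl) /= /andP[kw wS]].
case: (boolP (uniq w)) => [Uw|/fword_dup->]; last by rewrite mulr0.
by have := uniq_leq_size Uw (allP wS); rewrite leqNgt (leq_trans Sk).
Qed.

Lemma nilspanX S x m : nilspan S 1 x -> nilspan S m (x ^+ m).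
Proof.
move=> H; elim: m => [|m IH]; last by rewrite exprS -add1n; apply: nilspanM.
by exists [:: (1, [::])]; rewrite // big_seq1 rmorph1 mulr1.
Qed.

Lemma fspan_decomp x : fspan x ->
  exists c S n, nilspan S 1 n /\ J (x - (io c + n)).
Proof.
elim=> {x} [x Hx||x y _ [c [S [n [Hn Hx]]]] _ [c' [S' [n' [Hn' Hy]]]]
  |k x _ [c [S [n [Hn Hx]]]]|s x _ [c [S [n [Hn Hx]]]]].
- exists 0, [::], 0; split; first exact: nilspan0.
  by rewrite rmorph0 addr0 subr0.
- exists 1, [::], 0; split; first exact: nilspan0.
  by rewrite rmorph1 addr0 subrr.
- exists (c + c'), (S ++ S'), (n + n'); split.
    apply: nilspanD; [apply: nilspanW Hn|apply: nilspanW Hn'] => // i; rewrite mem_cat => ->//.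
    by rewrite orbT.
  by rewrite rmorphD addrACA opprD addrACA; apply: JD.
- exists (k * c), S, (io k * n); split; first exact: nilspan_Z.
  by rewrite rmorphM -mulrDr -mulrBr; apply: JM.
- exists 0, (s :: S), (io c * f s + f s * n); split.
    have Hs : nilspan (s :: S) 1 (f s).
      by exists [:: (1, [:: s])]; rewrite /= ?inE ?eqxx // big_seq1 rmorph1 mul1r /= mulr1.
    apply: nilspanD; first exact: nilspan_Z.
    rewrite -[1%N]/(1 + 0)%N; apply: nilspanM => //; apply: nilspanW Hn => // i.
    by rewrite inE orbC => ->.
  by rewrite rmorph0 add0r io_central -mulrDr -mulrBr; apply: JM.
Qed.

(** With c + n = c (1 - m), the element m is nilpotent and the inverse of 1 - m is a finite
    geometric sum. *)
Lemma nilspan_unit S c n : c != 0 -> nilspan S 1 n -> exists b, b * (io c + n) = 1.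
Proof.
move=> c0 Hn; pose m := - (io c^-1 * n).
have Hm : nilspan S 1 m.
  by rewrite /m -mulNr -rmorphN; apply: nilspan_Z.
have m0 : m ^+ (size S).+1 = 0 by apply: (@nilspan_eq0 S (size S).+1); last exact: nilspanX.
exists ((\sum_(i < (size S).+1) m ^+ i) * io c^-1).
have -> : io c + n = io c * (1 - m).
  by rewrite /m opprK mulrDr mulr1 mulrA -rmorphM mulfV // rmorph1 mul1r.
rewrite mulrA -(mulrA _ (io c^-1)) -rmorphM mulVf // rmorph1 mulr1.
rewrite -[1 - m]opprB mulrN.
have -> : (\sum_(i < (size S).+1) m ^+ i) * (m - 1) = m ^+ (size S).+1 - 1.
  rewrite subrX1; apply: commr_sym; apply: commr_sum => i _.
  by apply: commrX; apply: commr_sym; apply: commrB; [apply: commr_refl|apply: commr1].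
by rewrite m0 sub0r opprK.
Qed.

(** The class of x generates R / J as a left module. Elements of [ML] map to nongenerating ones, so
    closure of the latter under addition is what allows linear algebra modulo [ML]. *)
Definition generating (x : R) := exists b, J (b * x - 1).

Hypothesis fspanT : forall x, fspan x.
Hypothesis J1 : ~ J 1.

Lemma generating_decomp x c S n : c != 0 -> nilspan S 1 n -> J (x - (io c + n)) ->
  generating x.
Proof.
move=> c0 Hn Hx; have [b Hb] := nilspan_unit c0 Hn; exists b.
by rewrite -Hb -mulrBr; apply: JM.
Qed.

Lemma generatingM b x : generating (b * x) -> generating x.
Proof. by case=> b' H; exists (b' * b); rewrite -mulrA. Qed.

Lemma not_generating0 : ~ generating 0.
Proof. by case=> b; rewrite mulr0 sub0r => /J_opp; rewrite opprK. Qed.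

(* The highest weight module A / J is local, so its nongenerating vectors form a subspace. *)
Lemma not_generatingD x y : ~ generating x -> ~ generating y -> ~ generating (x + y).
Proof.
move=> Nx Ny [b]; rewrite mulrDr => Hb.
have [c [S [n [Hn Hx]]]] := fspan_decomp (fspanT (b * x)).
have [c' [S' [n' [Hn' Hy]]]] := fspan_decomp (fspanT (b * y)).
case: (eqVneq c 0) => [c0|c0]; last first.
  by apply: Nx; apply: (@generatingM b); exact: generating_decomp c0 Hn Hx.
case: (eqVneq c' 0) => [c0'|c0']; last first.
  by apply: Ny; apply: (@generatingM b); exact: generating_decomp c0' Hn' Hy.
move: Hx Hy; rewrite c0 c0' rmorph0 !add0r => Hx Hy.
(* If both constant terms vanish, 1 is congruent to n + n' modulo [J], so 0 is congruent to -1 + (n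
   + n'), which is invertible. *)
apply: not_generating0; apply: (@generating_decomp _ (- 1) (S ++ S') (n + n')).
- by rewrite oppr_eq0 oner_eq0.
- apply: nilspanD; [apply: nilspanW Hn|apply: nilspanW Hn'] => // i; rewrite mem_cat => ->//.
  by rewrite orbT.
- rewrite rmorphN1 sub0r opprD opprK.
  have -> : 1 - (n + n') = (b * x - n) + (b * y - n') - (b * x + b * y - 1).
    by ncring (@nil R) I.
  by apply: J_sub => //; apply: JD.
Qed.

Lemma not_generating_sum m (a : nat -> K) (y : nat -> R) :
  (forall s, (s < m)%N -> ~ generating (y s)) ->
  ~ generating (\sum_(s < m) io (a s) * y s).
Proof.
elim: m => [|m IH] H; first by rewrite big_ord0; exact: not_generating0.
rewrite big_ord_recr; apply: not_generatingD; first by apply: IH => s /ltnW; apply: H.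
by move/generatingM; apply: H.
Qed.

Lemma not_generating_hankel m (a : nat -> K) :
  ~ generating (\sum_(s < m) io (a s) * f s.+1) ->
  forall r, \sum_(s < m) a s * mu (r + s).+1 = 0.
Proof.
move=> Nx r; apply/eqP/negP => /negP k0; apply: Nx.
apply: (@generatingM (e r.+1)); apply: (@generating_decomp _ _ [::] 0 k0).
  exact: nilspan0.
rewrite addr0 rmorph_sum mulr_sumr -sumrB; apply: J_sum => s _.
rewrite rmorphM mulrA -io_central -mulrA -mulrBr; apply: JM.
have -> : e r.+1 * f s.+1 = dr_h t (r + s).+1 - f s.+1 * e r.+1.
  by rewrite -(dr_ef t_rtt) addrK.
by rewrite addrAC; apply: J_sub; [exact: Jh|apply: JM].
Qed.

End HighestWeight.

(** * Tensor products with evaluation modules *)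

Definition sgb (R : pzRingType) (b : bool) : R := if b then -1 else 1.

Lemma signE (R : pzRingType) n : (-1) ^+ n = sgb R (odd n).
Proof. by rewrite -signr_odd; case: odd. Qed.

(** The exponents of the two RTT signs modulo 2, as booleans, so that signs compute in each of the
    sixteen index cases. *)
Definition spar (i j k l : bool) := (i (+) j) && (k (+) l).
Definition rpar (i j k : bool) := (i && j) (+) (i && k) (+) (j && k).

Lemma sign_spar (R : pzRingType) (i j k l : bool) :
  (-1) ^+ ((i + j) * (k + l)) = sgb R (spar i j k l).
Proof. by rewrite signE oddM !oddD !oddb. Qed.

Lemma sign_rpar (R : pzRingType) (i j k : bool) :
  (-1) ^+ (i * j + i * k + j * k) = sgb R (rpar i j k).
Proof. by rewrite signE !oddD !oddM !oddb. Qed.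

Definition bsum (Q : pzRingType) (F : bool -> bool -> Q) : Q :=
  F false false + F false true + F true false + F true true.

Lemma bsum0 (Q : pzRingType) (F : bool -> bool -> Q) : (forall a b, F a b = 0) -> bsum F = 0.
Proof. by move=> H; rewrite /bsum !H !addr0. Qed.

(* The difference of the two sides of the RTT relation for A (in u) and B (in v). *)
Definition rttE (Q : pzRingType) (z w : Q) (A B : bool -> bool -> Q) (i j k l : bool) : Q :=
  z * (A i j * B k l - sgb Q (spar i j k l) * (B k l * A i j))
  - w * (sgb Q (rpar i j k) * (A k j * B i l - B k j * A i l)).

(* R T_1 T_2 L_1 L_2 = T_2 T_1 R L_1 L_2 = T_2 T_1 L_2 L_1 R, entry by entry. *)
Lemma rttE_mul (Q : pzRingType) (z w : Q) (A B L M : bool -> bool -> Q) :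
  central z -> central w ->
  (forall i j k l, rttE z w A B i j k l = 0) ->
  (forall i j k l, rttE z w L M i j k l = 0) ->
  (forall i j k l, L i j * B k l - sgb Q (spar i j k l) * (B k l * L i j) = 0) ->
  (forall i j k l, M i j * A k l - sgb Q (spar i j k l) * (A k l * M i j) = 0) ->
  forall i j k l,
  rttE z w (fun i j => A i false * L false j + A i true * L true j)
           (fun i j => B i false * M false j + B i true * M true j) i j k l = 0.
Proof.
move=> Hz Hw rA rL EB EA i j k l.
(* [a] and [b] are the intermediate indices of the two matrix products. The first four terms
   exchange L with B and M with A, up to sign; the last two are the RTT relations of the pairs A, B
   and L, M. *)
transitivity (bsum (fun a b =>
   z * A i a * (L a j * B k b - sgb Q (spar a j k b) * (B k b * L a j)) * M b l
 - z * sgb Q (spar i j k l) * B k b *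
     (M b l * A i a - sgb Q (spar b l i a) * (A i a * M b l)) * L a j
 - w * sgb Q (rpar i j k) * A k a * (L a j * B i b - sgb Q (spar a j i b) * (B i b * L a j)) * M b l
 + w * sgb Q (rpar i j k) * B k a * (M a j * A i b - sgb Q (spar a j i b) * (A i b * M a j)) * L b l
 + sgb Q (spar a j k b) * rttE z w A B i a k b * L a j * M b l
 + sgb Q (spar i j k b) * B k b * A i a * rttE z w L M a j b l)); last first.
  by apply: bsum0 => a b; rewrite !EB !EA rA rL !(mulr0, mul0r, addr0, subr0).
have HC := conj Hz (conj Hw I).
by case: i j k l => [] [] [] []; rewrite /bsum /rttE /spar /rpar /sgb /=;
  ncring [:: z; w] HC.
Qed.

Section Coproduct.
Variable B : pzRingType.
Implicit Types t : bool -> bool -> ser B.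

Lemma rttE_xy t : rtt t -> forall i j k l,
  rttE (zv B 0) (wv B) (fun i j => ofx (t i j)) (fun i j => ofy (t i j)) i j k l = 0.
Proof.
move=> H i j k l; rewrite /rttE -sign_spar -sign_rpar.
by apply: eq_subr0; apply: rtt_xy.
Qed.

Lemma rtt_of_xy t : (forall i j, t i j 0%N = (i == j)%:R) ->
  (forall i j k l, rttE (zv B 0) (wv B) (fun i j => ofx (t i j)) (fun i j => ofy (t i j))
                    i j k l = 0) -> rtt t.
Proof.
move=> t0 H; split=> // i j k l r s.
have := ser2_eq (subr0_eq (H i j k l)) r.+1 s.+1; rewrite -sign_spar -sign_rpar.
by rewrite zvM wvM mulr0n subr0 !(ser_sign, serB) !(ofxM, ofyM).
Qed.

(** The evaluation T(u) = 1 + l / u. The relations imposed on [l] below are those of gl(1|1) in the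
    sign convention of RTT, in which [l true true] behaves as -E_22. *)
Definition evalL (l : bool -> bool -> B) i j : ser B := serC (i == j)%:R + serX * serC (l i j).

(** The coproduct formula for t_ij(u). The signs of the super tensor product are absorbed in the
    hypothesis that the entries of [l] supercommute with those of [t]. *)
Definition tensorL t l i j : ser B :=
  t i false * evalL l false j + t i true * evalL l true j.

Variables (t : bool -> bool -> ser B) (l : bool -> bool -> B).
Hypothesis t_rtt : rtt t.
Hypothesis l_gl : forall i j k m,
  l i j * l k m - sgb B (spar i j k m) * (l k m * l i j) =
  sgb B (rpar i j k) * ((k == j)%:R * l i m - (i == m)%:R * l k j).
Hypothesis l_t : forall i j k m r,
  l i j * t k m r = sgb B (spar i j k m) * (t k m r * l i j).

Lemma ofx_X : ofx (serX : ser B) = xv B.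
Proof. by apply: ser2P => -[|[|r]] [|s]. Qed.

Lemma ofx_evalL i j : ofx (evalL l i j) = (i == j)%:R + xv B * serC (serC (l i j)).
Proof.
rewrite /evalL rmorphD rmorphM /= ofx_X rmorph_nat; congr (_ + _ * _).
  by rewrite rmorph_nat.
by apply: ser2P => -[|r] [|s].
Qed.

Lemma ofy_evalL i j : ofy (evalL l i j) = (i == j)%:R + yv B * serC (serC (l i j)).
Proof. by rewrite /evalL rmorphD rmorphM /= !rmorph_nat. Qed.

Lemma sgbE (Q Q' : pzRingType) (f : {rmorphism Q -> Q'}) b : f (sgb Q b) = sgb Q' b.
Proof. by case: b; rewrite /= ?rmorphN ?rmorph1. Qed.

Let cc (x : B) : ser (ser B) := serC (serC x).

Lemma evalL_rttE i j k m :
  rttE (zv B 0) (wv B) (fun i j => ofx (evalL l i j)) (fun i j => ofy (evalL l i j))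
       i j k m = 0.
Proof.
have H := congr1 cc (l_gl i j k m); move: H; rewrite /cc.
rewrite !(rmorphB, rmorphM) /= !(rmorphB, rmorphM, rmorph_nat) /= !sgbE.
rewrite /rttE !ofx_evalL !ofy_evalL /zv mulr0n subr0 /wv => /eq_subr0 H.
have HC := conj (@xv_central B) (conj (@yv_central B) I).
transitivity ((yv B - xv B) * (xv B * yv B) *
  (cc (l i j) * cc (l k m) - sgb _ (spar i j k m) * (cc (l k m) * cc (l i j))
   - sgb _ (rpar i j k) * ((k == j)%:R * cc (l i m) - (i == m)%:R * cc (l k j)))).
  move: {H} (xv B) (yv B) HC => x y HC; rewrite /cc.
  by case: i j k m => [] [] [] []; rewrite /spar /rpar /sgb /= ?mulr1n ?mulr0n;
    ncring [:: x; y] HC.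
by rewrite H mulr0.
Qed.

Lemma comm_signed_ser (a b : ser B) c : (forall r s, a r * b s = sgb B c * (b s * a r)) ->
  ofx a * ofy b - sgb _ c * (ofy b * ofx a) = 0 /\
  ofy a * ofx b - sgb _ c * (ofx b * ofy a) = 0.
Proof.
move=> H; have Es (x : ser (ser B)) r s : (sgb (ser (ser B)) c * x) r s = sgb B c * x r s.
  by case: (c); rewrite /= ?mul1r ?mulN1r.
by split; apply: ser2P => r s; rewrite !serB Es ofxM ofyM H subrr.
Qed.

Lemma evalL_t i j k m r s :
  evalL l i j r * t k m s = sgb B (spar i j k m) * (t k m s * evalL l i j r).
Proof.
rewrite /evalL serD mulrDl mulrDr mulrDr; congr (_ + _).
  rewrite /serC; case: r => [|r] /=; last by rewrite mul0r !mulr0.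
  by case: i j => [] [] /=; rewrite ?mul0r ?mulr0 // mul1r mulr1 /spar /= mul1r.
case: r => [|r]; first by rewrite serXM0 mul0r !mulr0.
by rewrite serXMS /serC; case: r => [|r] /=; rewrite ?l_t // mul0r !mulr0.
Qed.

Lemma tensorL_rtt : rtt (tensorL t l).
Proof.
apply: rtt_of_xy => [i j|i j k m].
  have E a b : evalL l a b 0%N = (a == b)%:R by rewrite /evalL serD serXM0 addr0.
  rewrite /tensorL serD !serM0 !E !(proj1 t_rtt).
  by case: i j => [] []; rewrite /= ?mulr0 ?mulr1 ?addr0 ?add0r.
have EB a b c d := proj1 (comm_signed_ser (fun r s => evalL_t a b c d r s)).
have EA a b c d := proj2 (comm_signed_ser (fun r s => evalL_t a b c d r s)).
have := rttE_mul (@central_zv B 0) (@central_wv B) (rttE_xy t_rtt) evalL_rttE EB EA i j k m.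
have Ex a b : ofx (tensorL t l a b) =
    ofx (t a false) * ofx (evalL l false b) + ofx (t a true) * ofx (evalL l true b).
  by rewrite rmorphD !rmorphM.
have Ey a b : ofy (tensorL t l a b) =
    ofy (t a false) * ofy (evalL l false b) + ofy (t a true) * ofy (evalL l true b).
  by rewrite rmorphD !rmorphM.
by rewrite /rttE !Ex !Ey.
Qed.

End Coproduct.

(** Both sides of RTT are bilinear in t(u) and t(v), so the central factor g(u) g(v) comes out. *)
Lemma rtt_scale (B : pzRingType) (t : bool -> bool -> ser B) (g : ser B) :
  g 0%N = 1 -> (forall n, central (g n)) -> rtt t -> rtt (fun i j => g * t i j).
Proof.
move=> g0 gc H; apply: rtt_of_xy => [i j|i j k l]; first by rewrite serM0 g0 mul1r (proj1 H).
have gx : central (ofx g).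
  apply: ser_central => r; apply: ser_central => -[|s]; first exact: gc.
  by rewrite -[ofx g r s.+1]/(0 : B) => x; rewrite mul0r mulr0.
have gy : central (ofy g).
  apply: ser_central => -[|r]; last first.
    by rewrite -[ofy g r.+1]/(0 : ser B) => x; rewrite mul0r mulr0.
  by apply: ser_central => s.
rewrite -[RHS](mulr0 (ofx g * ofy g)) -(rttE_xy H i j k l) /rttE !rmorphM /=.
move: (@central_zv B 0) (@central_wv B) gx gy.
move: (zv B 0) (wv B) (ofx g) (ofy g) => z w x y z_c w_c x_c y_c.
by case: i j k l => [] [] [] []; rewrite /spar /rpar /sgb /=;
  ncring [:: z; w; x; y] (conj z_c (conj w_c (conj x_c (conj y_c I)))).
Qed.

(** * Finite-dimensional highest weight modules *)

Section FiniteModule.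
Variable K : fieldType.

Definition annv N (v : 'cV[K]_N) (M : 'M[K]_N) : Prop := M *m v = 0.

Lemma annv0 N (v : 'cV[K]_N) : annv v 0. Proof. exact: mul0mx. Qed.
Lemma annvD N (v : 'cV[K]_N) x y : annv v x -> annv v y -> annv v (x + y).
Proof. by rewrite /annv mulmxDl => -> ->; rewrite addr0. Qed.
Lemma annvM N (v : 'cV[K]_N) x y : annv v y -> annv v (x * y).
Proof. by rewrite /annv -mulmxE -mulmxA => ->; rewrite mulmx0. Qed.

Lemma scalar_mx_central N (c : K) : central (c%:M : 'M[K]_N).
Proof. by move=> M; rewrite -mulmxE scalar_mxC. Qed.

(** The weight is prescribed for t_22 instead of d_2 = t_22 - f d_1 e: the two agree on v because
    t_12, hence e, kills it. *)
Definition hwrep N (t : bool -> bool -> ser 'M[K]_N) (v : 'cV[K]_N) (ka : bool -> ser K) : Prop :=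
  [/\ rtt t, v != 0, forall r, annv v (t false true r) &
      forall i, Jeq (@scalar_mx K N) (annv v) (t i i) (ka i)].

(** Multiplying the odd operators of a second tensor factor by P makes them supercommute with the
    t_ij, so super tensor products become block matrices. *)
Definition parity_op N (t : bool -> bool -> ser 'M[K]_N) (P : 'M[K]_N) : Prop :=
  P * P = 1 /\ forall i j r, P * t i j r = sgb _ (i (+) j) * (t i j r * P).

Section Step.
Variables (N : nat) (t : bool -> bool -> ser 'M[K]_N) (v : 'cV[K]_N) (ka : bool -> ser K).
Variables (P : 'M[K]_N) (c : bool -> K).
Hypotheses (t_hw : hwrep t v ka) (t_P : parity_op t P).

Let PP : P * P = 1 := proj1 t_P.

Lemma block_mxM (A1 A2 A3 A4 B1 B2 B3 B4 : 'M[K]_N) :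
  block_mx A1 A2 A3 A4 * block_mx B1 B2 B3 B4 =
  block_mx (A1 * B1 + A2 * B3) (A1 * B2 + A2 * B4) (A3 * B1 + A4 * B3) (A3 * B2 + A4 * B4).
Proof. by rewrite -!mulmxE mulmx_block. Qed.

Definition dbl (M : 'M[K]_N) : 'M[K]_(N + N) := block_mx M 0 0 M.

Fact dbl_zmod : zmod_morphism dbl.
Proof. by move=> A B; rewrite /dbl opp_block_mx add_block_mx !subr0. Qed.
HB.instance Definition _ := GRing.isZmodMorphism.Build 'M[K]_N 'M[K]_(N + N) dbl dbl_zmod.
Fact dbl_monoid : monoid_morphism dbl.
Proof.
split=> [|A B]; first by rewrite /dbl -scalar_mx_block.
by rewrite /dbl block_mxM !(mulr0, mul0r, addr0, add0r).
Qed.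
HB.instance Definition _ := GRing.isMonoidMorphism.Build 'M[K]_N 'M[K]_(N + N) dbl dbl_monoid.

(* The two-dimensional representation of gl(1|1) with highest weight (c 1, c 2), twisted by P. *)
Definition gl_op (i j : bool) : 'M[K]_(N + N) :=
  match i, j with
  | true, false => block_mx 0 0 P 0
  | false, true => block_mx 0 (((c true)%:M - (c false)%:M) * P) 0 0
  | _, _ => block_mx (c i)%:M 0 0 ((c i)%:M - 1)
  end.

Lemma gl_opP i j k m :
  gl_op i j * gl_op k m - sgb _ (spar i j k m) * (gl_op k m * gl_op i j) =
  sgb _ (rpar i j k) * ((k == j)%:R * gl_op i m - (i == m)%:R * gl_op k j).
Proof.
have HC := conj (@scalar_mx_central N (c false)) (conj (@scalar_mx_central N (c true)) I).
have E1 : ((c true)%:M - (c false)%:M) * P * P = (c true)%:M - (c false)%:M.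
  by rewrite -mulrA PP mulr1.
have E2 : P * (((c true)%:M - (c false)%:M) * P) = (c true)%:M - (c false)%:M.
  by rewrite mulrA mulrBr -!scalar_mx_central -mulrBl E1.
rewrite -!(sgbE dbl) -!(rmorph_nat dbl) /dbl.
case: i j k m => [] [] [] []; rewrite /spar /rpar /sgb /gl_op /= ?mulr1n ?mulr0n;
  rewrite !(block_mxM, opp_block_mx, add_block_mx) ?E1 ?E2; congr block_mx;
  ncring [:: (c false)%:M : 'M[K]_N; (c true)%:M] HC.
Qed.

Let v' : 'cV[K]_(N + N) := col_mx v 0.

Lemma gl_op_dbl i j k m r :
  gl_op i j * dbl (t k m r) = sgb _ (spar i j k m) * (dbl (t k m r) * gl_op i j).
Proof.
have HC := conj (@scalar_mx_central N (c false)) (conj (@scalar_mx_central N (c true)) I).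
rewrite -!(sgbE dbl) /dbl; have := proj2 t_P k m r.
case: i j => [] []; rewrite /spar /gl_op !block_mxM /=; case: (k (+) m) => /= E;
  congr block_mx; rewrite -?mulrA ?E;
  ncring [:: (c false)%:M : 'M[K]_N; (c true)%:M] HC.
Qed.

Definition step_t := tensorL (fun i j => ser_map dbl (t i j)) gl_op.

Let dt i j := ser_map dbl (t i j).

Let dt_rtt : rtt dt.
Proof.
case: t_hw => [[t0 tR] _ _ _]; split=> [i j|i j k l r s].
  by rewrite /dt /ser_map t0 rmorph_nat.
have := congr1 dbl (tR i j k l r s); rewrite !(sign_spar, sign_rpar).
by rewrite !(rmorphB, rmorphM) /= !sgbE.
Qed.

Let dt_gl i j k m r : gl_op i j * dt k m r = sgb _ (spar i j k m) * (dt k m r * gl_op i j).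
Proof. exact: gl_op_dbl. Qed.

Lemma step_rtt : rtt step_t.
Proof. exact: tensorL_rtt dt_rtt gl_opP dt_gl. Qed.

Lemma annv_dbl M : annv v M -> annv v' (dbl M).
Proof. by rewrite /annv /v' mul_block_col !mulmx0 mul0mx !addr0 => ->; rewrite col_mx0. Qed.

Lemma annv_gl_op12 : annv v' (gl_op false true).
Proof. by rewrite /annv /v' mul_block_col !mulmx0 !mul0mx !addr0 col_mx0. Qed.

Lemma annv_gl_op i : annv v' (gl_op i i - (c i)%:M).
Proof.
rewrite /annv mulmxBl /v'; apply/eqP; rewrite subr_eq0; apply/eqP.
by case: i; rewrite scalar_mx_block !mul_block_col !mulmx0 !mul0mx !addr0.
Qed.

Definition lin_ser (a : K) : ser K := 1 + serX * serC a.

Lemma annv_evalL12 : Jser (annv v') (evalL gl_op false true).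
Proof.
move=> n; rewrite /evalL rmorph0 add0r; case: n => [|n]; first by rewrite serXM0; apply: annv0.
rewrite serXMS /serC; case: eqP => _; [exact: annv_gl_op12|exact: annv0].
Qed.

Lemma Jeq_evalL i : Jeq (@scalar_mx K (N + N)) (annv v') (evalL gl_op i i) (lin_ser (c i)).
Proof.
move=> n; rewrite /evalL eqxx /lin_ser serB serD /ser_map serD rmorphD /= opprD addrACA.
rewrite rmorph1 !ser1E -(rmorph_nat (@scalar_mx K (N + N))) subrr add0r.
case: n => [|n]; first by rewrite !serXM0 rmorph0 subrr; apply: annv0.
rewrite !serXMS /serC; case: eqP => _; first exact: annv_gl_op.
by rewrite rmorph0 subrr; apply: annv0.
Qed.

Lemma Jeq_dt i : Jeq (@scalar_mx K (N + N)) (annv v') (dt i i) (ka i).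
Proof.
case: t_hw => _ _ _ H n; rewrite -[_ n]/(dbl (t i i n) - (ka i n)%:M).
have -> : (ka i n)%:M = dbl (ka i n)%:M by rewrite /dbl -scalar_mx_block.
by rewrite -rmorphB; apply: annv_dbl; apply: H.
Qed.

Lemma step_hw : hwrep step_t v' (fun i => ka i * lin_ser (c i)).
Proof.
case: t_hw => _ v0 t12 _.
have dt12 r : annv v' (dt false true r) by apply: annv_dbl; apply: t12.
have Jmul a b : Jser (annv v') b -> Jser (annv v') (a * b).
  by apply: Jser_mul; [exact: annv0|exact: annvD|exact: annvM].
have Jadd a b : Jser (annv v') b -> Jser (annv v') a -> Jser (annv v') (a + b).
  by move=> Hb Ha n; rewrite serD; apply: annvD.
have JeqM' := JeqM (@scalar_mx_central (N + N)) (annv0 v') (@annvD _ v') (@annvM _ v').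
split; first exact: step_rtt.
- by rewrite /v' col_mx_eq0 negb_and v0.
- apply: Jadd; last exact: Jmul annv_evalL12.
  have H0 : Jeq (@scalar_mx K (N + N)) (annv v') (dt false true) 0.
    by rewrite /Jeq rmorph0 subr0.
  by have := JeqM' _ _ _ _ H0 (Jeq_evalL true); rewrite /Jeq mul0r rmorph0 subr0.
- have JeqD a b k : Jeq (@scalar_mx K (N + N)) (annv v') a k -> Jser (annv v') b ->
      Jeq (@scalar_mx K (N + N)) (annv v') (a + b) k.
    by move=> Ha Hb; rewrite /Jeq addrAC; apply: Jadd.
  case; first by rewrite /step_t /tensorL addrC; apply: JeqD;
    [exact: JeqM' (Jeq_dt true) (Jeq_evalL true)|exact: Jmul annv_evalL12].
  apply: JeqD; first exact: JeqM' (Jeq_dt false) (Jeq_evalL false).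
  (* The cross term is t_12(u) L_21(u). Here L_21 moves the highest weight vector, but it
     supercommutes with t_12, which can thus be applied first and gives 0. *)
  move=> n; rewrite serM; apply: J_sum => [||i _]; [exact: annv0|exact: annvD|].
  have := evalL_t dt_gl true false false true (n - i)%N i; rewrite -/(dt _ _ _).
  move=> /(congr1 (fun x => sgb _ (spar true false false true) * x)).
  rewrite [in RHS]mulrA; case: spar => /=; rewrite ?mulrN1 ?opprK ?mul1r => <-;
    by rewrite ?mulN1r -?mulNr; apply: annvM.
Qed.

Lemma step_parity : parity_op step_t (block_mx P 0 0 (- P)).
Proof.
have P2 : block_mx P 0 0 (- P) * block_mx P 0 0 (- P) = 1 :> 'M[K]_(N + N).
  by rewrite block_mxM !(mulr0, mul0r, addr0, add0r) mulrNN PP -scalar_mx_block.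
split=> // i j r; set P' := block_mx P 0 0 (- P).
have Pt a b s : P' * dt a b s = sgb _ (a (+) b) * (dt a b s * P').
  rewrite -(sgbE dbl) /P' /dt /ser_map /dbl !block_mxM !(mulr0, mul0r, addr0, add0r).
  by rewrite !mulrN !mulNr (proj2 t_P).
have Pl a b s : P' * evalL gl_op a b s = sgb _ (a (+) b) * (evalL gl_op a b s * P').
  have Pg : P' * gl_op a b = sgb _ (a (+) b) * (gl_op a b * P').
    rewrite -(sgbE dbl) /P' /dbl; case: a b => [] [] /=; rewrite !block_mxM;
      congr block_mx;
      ncring [:: (c false)%:M : 'M[K]_N; (c true)%:M]
        (conj (@scalar_mx_central N (c false)) (conj (@scalar_mx_central N (c true)) I)).
  rewrite /evalL !serD !mulrDl !mulrDr; congr (_ + _).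
    rewrite /serC; case: s => [|s] /=; last by rewrite mul0r !mulr0.
    by case: (a) (b) => [] [] /=; rewrite ?mul0r ?mulr0 // mul1r mulr1 mul1r.
  case: s => [|s]; first by rewrite serXM0 mul0r !mulr0.
  by rewrite serXMS /serC; case: s => [|s] /=; rewrite ?Pg // mul0r !mulr0.
have Pm a b b' (x y : ser 'M[K]_(N + N)) :
    (forall s, P' * x s = sgb _ (a (+) b) * (x s * P')) ->
    (forall s, P' * y s = sgb _ (b (+) b') * (y s * P')) ->
    P' * (x * y) r = sgb _ (a (+) b') * ((x * y) r * P').
  move=> Hx Hy; rewrite serM mulr_sumr mulr_suml mulr_sumr; apply: eq_bigr => q _.
  rewrite (mulrA P') Hx -!mulrA Hy.
  by case: a b b' {Hx Hy} => [] [] [] /=; rewrite ?mulN1r ?mul1r ?mulrN ?opprK.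
by rewrite /step_t /tensorL serD (mulrDr P') mulrDl [RHS]mulrDr; congr (_ + _);
  (apply: Pm; [exact: Pt|exact: Pl]).
Qed.

End Step.
Definition lin_prod (s : seq (K * K)) (i : bool) : ser K :=
  foldr (fun ab ka => ka * lin_ser (if i then ab.2 else ab.1)) 1 s.

(** The trivial one-dimensional representation is tensored once for each pair (a, b); each step
    doubles the dimension and multiplies the weight by (1 + a/u, 1 + b/u). *)
Lemma hwrep_lin_prod s : exists N (t : bool -> bool -> ser 'M[K]_N) v,
  hwrep t v (lin_prod s).
Proof.
suff [N [t [v [P [H _]]]]] : exists N (t : bool -> bool -> ser 'M[K]_N) v P,
    hwrep t v (lin_prod s) /\ parity_op t P by exists N, t, v.
elim: s => [|ab s [N [t [v [P [Ht HP]]]]]]; last first.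
  exists (N + N)%N, (step_t t P (fun i => if i then ab.2 else ab.1)), (col_mx v 0).
  exists (block_mx P 0 0 (- P)); split; last exact: step_parity HP.
  exact: step_hw Ht HP.
exists 1%N, (fun i j => (i == j)%:R), (const_mx 1), 1; split; last first.
  split=> [|i j r]; first by rewrite mulr1.
  by case: i j => [] []; rewrite /= ?mul0r ?mulr0 // mul1r mulr1 mul1r.
split.
- apply: rtt_of_xy => [|i j k l]; first by case=> [] [].
  rewrite /rttE !rmorph_nat.
  by case: i j k l => [] [] [] []; rewrite /spar /rpar /sgb /= ?mulr1n ?mulr0n;
    ncring [:: zv 'M[K]_1 0; wv 'M[K]_1]
      (conj (@central_zv 'M[K]_1 0) (conj (@central_wv 'M[K]_1) I)).
- by apply/eqP => /matrixP/(_ 0 0)/eqP; rewrite !mxE oner_eq0.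
- by move=> r; apply: annv0.
- by move=> i; rewrite eqxx; apply: Jeq1; apply: annv0.
Qed.

Lemma lin_prod0 s i : lin_prod s i 0%N = 1.
Proof.
by elim: s => [|ab s IH] //=; rewrite serM0 IH mul1r /lin_ser serD serXM0 addr0.
Qed.

Lemma ser_mulC (a b : ser K) : a * b = b * a.
Proof. by apply: ser_comm => r s; apply: mulrC. Qed.

(** Only the ratio of the two weights is fixed by the roots. The rescaling series is g = lambda_1 /
    [lin_prod s false], and the cross-multiplied hypothesis shows that it also corrects the second
    weight. *)
Lemma hwrep_exists s (lam : bool -> ser K) :
  (forall i, lam i 0%N = 1) ->
  lam false * lin_prod s true = lam true * lin_prod s false ->
  exists N (t : bool -> bool -> ser 'M[K]_N) v, hwrep t v lam.
Proof.
move=> lam0 E; have [N [t [v [Ht v0 t12 tii]]]] := hwrep_lin_prod s.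
pose g := lam false * ser_inv (lin_prod s false).
have gE i : lam i = g * lin_prod s i.
  have V : ser_inv (lin_prod s false) * lin_prod s false = 1.
    by rewrite ser_mulVr // lin_prod0.
  case: i; last by rewrite /g -mulrA V mulr1.
  by rewrite /g -mulrA (ser_mulC _ (lin_prod s true)) mulrA E -mulrA (ser_mulC (lin_prod s false))
    V mulr1.
have g0 : g 0%N = 1 by rewrite /g serM0 lam0 mul1r.
pose G := ser_map (@scalar_mx K N) g.
exists N, (fun i j => G * t i j), v; split=> // [|r|i].
- apply: rtt_scale => //; first by rewrite /G /ser_map g0.
  by move=> n; apply: scalar_mx_central.
- by apply: Jser_mul => //; [exact: annv0|exact: annvD|exact: annvM].
- rewrite gE; apply: JeqM => //; [exact: scalar_mx_central|exact: annv0|exact: annvD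
    |exact: annvM|by move=> n; rewrite subrr; apply: annv0].
Qed.

End FiniteModule.

(** * The free algebra and its representations *)

Section FreeRing.
Variable K : fieldType.
Implicit Types f g h : F K.

HB.instance Definition _ := gen_eqMixin (F K).
HB.instance Definition _ := gen_choiceMixin (F K).

Definition lderiv (x : gen) f : F K := fun w => f (x :: w).

Lemma mulF_nil f g : mulF f g [::] = f [::] * g [::].
Proof. by rewrite /mulF big_ord1. Qed.

Lemma mulF_cons f g x w : mulF f g (x :: w) = f [::] * g (x :: w) + mulF (lderiv x f) g w.
Proof. by rewrite /mulF big_ord_recl take0 drop0. Qed.

Fact addFA : associative (@addF K).
Proof. by move=> f g h; apply: funext => w; rewrite /addF addrA. Qed.
Fact addFC : commutative (@addF K).
Proof. by move=> f g; apply: funext => w; rewrite /addF addrC. Qed.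
Fact add0F : left_id (@zeroF K) (@addF K).
Proof. by move=> f; apply: funext => w; rewrite /addF add0r. Qed.
Fact addNF : left_inverse (@zeroF K) (@oppF K) (@addF K).
Proof. by move=> f; apply: funext => w; rewrite /addF /oppF /scaleF mulN1r addNr. Qed.
Fact mulFDl : left_distributive (@mulF K) (@addF K).
Proof.
move=> f g h; apply: funext => w; rewrite /addF /mulF -big_split.
by apply: eq_bigr => i _; rewrite mulrDl.
Qed.
Fact mulFDr : right_distributive (@mulF K) (@addF K).
Proof.
move=> f g h; apply: funext => w; rewrite /addF /mulF -big_split.
by apply: eq_bigr => i _; rewrite mulrDr.
Qed.
(** Induction on the word; [lderiv] plays the role of [ser_tail]. *)
Fact mulFA : associative (@mulF K).
Proof.
suff E w f g h : mulF f (mulF g h) w = mulF (mulF f g) h w.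
  by move=> f g h; apply: funext => w.
elim: w f g h => [|x w IH] f g h; first by rewrite !mulF_nil mulrA.
rewrite !mulF_cons mulF_nil IH mulrDr mulrA -addrA; congr (_ + _).
have -> : lderiv x (mulF f g) =
    addF (fun v => f [::] * lderiv x g v) (mulF (lderiv x f) g).
  by apply: funext => v; rewrite /lderiv mulF_cons.
rewrite mulFDl; congr (_ + _).
by rewrite /mulF mulr_sumr; apply: eq_bigr => i _; rewrite mulrA.
Qed.
Fact mul1F : left_id (@oneF K) (@mulF K).
Proof.
move=> f; apply: funext => w; rewrite /mulF big_ord_recl take0 drop0 mul1r.
by rewrite big1 ?addr0 // => i _; case: w i => [[]|x w] // i; rewrite mul0r.
Qed.
Fact mulF1 : right_id (@oneF K) (@mulF K).
Proof.
move=> f; apply: funext => w; elim: w f => [|x w IH] f; first by rewrite mulF_nil mulr1.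
by rewrite mulF_cons IH mulr0 add0r.
Qed.

HB.instance Definition _ := GRing.isZmodule.Build (F K) addFA addFC add0F addNF.
HB.instance Definition _ := GRing.Zmodule_isPzRing.Build (F K) mulFA mul1F mulF1 mulFDl mulFDr.

Lemma scaleFE c f : scaleF c f = scaleF c (oneF K) * f.
Proof.
apply: funext => -[|x w]; first by rewrite [RHS]mulF_nil /scaleF mulr1.
rewrite [RHS]mulF_cons {1 2}/scaleF mulr1 [X in _ + X]big1 ?addr0 // => i _.
by rewrite /lderiv /scaleF mulr0 mul0r.
Qed.

Lemma fin_supp0 : fin_supp (zeroF K). Proof. by exists [::]. Qed.
Lemma fin_suppD f g : fin_supp f -> fin_supp g -> fin_supp (addF f g).
Proof.
move=> [s Hs] [s' Hs']; exists (s ++ s') => w; rewrite mem_cat negb_or => /andP[/Hs E /Hs' E'].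
by rewrite /addF E E' addr0.
Qed.
Lemma fin_suppZ c f : fin_supp f -> fin_supp (scaleF c f).
Proof. by move=> [s Hs]; exists s => w /Hs E; rewrite /scaleF E mulr0. Qed.
Lemma fin_supp1 : fin_supp (oneF K).
Proof. by exists [:: [::]] => w; rewrite inE /oneF => /negbTE->. Qed.
Lemma fin_suppX x : fin_supp (XF K x).
Proof. by exists [:: [:: x]] => w; rewrite inE /XF => /negbTE->. Qed.
Lemma fin_suppM f g : fin_supp f -> fin_supp g -> fin_supp (mulF f g).
Proof.
move=> [s Hs] [s' Hs']; exists [seq a ++ b | a <- s, b <- s'] => w Hw.
rewrite /mulF big1 // => i _; case: (boolP (take i w \in s)) => [ws|/Hs->]; last by rewrite mul0r.
case: (boolP (drop i w \in s')) => [ws'|/Hs'->]; last by rewrite mulr0.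
by case/negP: Hw; rewrite -[w](cat_take_drop i); apply: allpairs_f.
Qed.
Lemma fin_suppN f : fin_supp f -> fin_supp (oppF f). Proof. exact: fin_suppZ. Qed.
Lemma fin_supp_sum I (l : seq I) (G : I -> F K) :
  (forall i, fin_supp (G i)) -> fin_supp (sumF [seq G i | i <- l]).
Proof.
by move=> H; elim: l => [|i l IH] /=; [exact: fin_supp0|apply: fin_suppD].
Qed.
Lemma fin_supp_tt i j r : fin_supp (tt K i j r).
Proof. by case: r => [|r]; [apply: fin_suppZ; apply: fin_supp1|apply: fin_suppX]. Qed.

Definition fin_ser (a : SerF K) := forall n, fin_supp (a n).

Lemma fin_serM a b : fin_ser a -> fin_ser b -> fin_ser (mulSer a b).
Proof. by move=> Ha Hb n; apply: fin_supp_sum => i; apply: fin_suppM. Qed.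

Lemma size_invSer_list (a : SerF K) n : size (invSer_list a n) = n.+1.
Proof. by elim: n => //= n IH; rewrite size_rcons IH. Qed.

Lemma nth_invSer_list (a : SerF K) m n :
  (m <= n)%N -> nth (zeroF K) (invSer_list a n) m = invSer a m.
Proof.
elim: n => [|n IH]; first by rewrite leqn0 => /eqP->.
rewrite leq_eqVlt => /predU1P[->|Hm] //.
by rewrite -[LHS]/(nth _ (rcons _ _) _) nth_rcons size_invSer_list Hm IH.
Qed.

Lemma invSerS (a : SerF K) n : invSer a n.+1 =
  oppF (sumF [seq mulF (a s) (invSer a (n.+1 - s)%N) | s <- iota 1 n.+1]).
Proof.
rewrite /invSer -[LHS]/(nth _ (rcons _ _) _) nth_rcons size_invSer_list ltnn eqxx.
congr (oppF (sumF _)); apply/eq_in_map => s; rewrite mem_iota => /andP[s0 _].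
by rewrite (@nth_invSer_list a _ n) // leq_subLR -add1n leq_add2r.
Qed.

Lemma fin_ser_inv a : fin_ser a -> fin_ser (invSer a).
Proof.
move=> Ha n; have [m] := ubnP n; elim: m n => // m IH [|n] nm; first exact: fin_supp1.
rewrite invSerS; apply: fin_suppN.
have: forall s, s \in iota 1 n.+1 -> fin_supp (mulF (a s) (invSer a (n.+1 - s)%N)).
  move=> s; rewrite mem_iota => /andP[s0 _]; apply: fin_suppM => //; apply: IH.
  by apply: leq_trans (nm : (n.+1 <= m)%N); rewrite ltnS leq_subLR -add1n leq_add2r.
elim: (iota _ _) => [|s l IHl] H /=; first exact: fin_supp0.
by apply: fin_suppD; [apply: H; rewrite mem_head|apply: IHl => i il; apply: H; rewrite inE il orbT].
Qed.

Lemma fin_ser_shift a c : fin_ser a -> fin_ser (shiftSer a c).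
Proof.
move=> Ha [|n]; first exact: Ha.
by apply: (@fin_supp_sum nat (iota 0 n.+1)) => i; apply: fin_suppZ.
Qed.

Lemma fin_ser_prodShift a m : fin_ser a -> fin_ser (prodShift a m).
Proof.
move=> Ha; rewrite /prodShift; elim: (iota _ _) => [[|n]|j l IH] /=.
- exact: fin_supp1.
- exact: fin_supp0.
- by apply: fin_serM => //; apply: fin_ser_shift.
Qed.

Lemma fin_ser_tS i j : fin_ser (tS K i j). Proof. by move=> n; apply: fin_supp_tt. Qed.
Lemma fin_ser_e : fin_ser (eS K).
Proof. by apply: fin_serM; [apply: fin_ser_inv|]; apply: fin_ser_tS. Qed.
Lemma fin_ser_f : fin_ser (fS K).
Proof. by apply: fin_serM; [|apply: fin_ser_inv]; apply: fin_ser_tS. Qed.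
Lemma fin_ser_d i : fin_ser (dS K i).
Proof.
case: i; last exact: fin_ser_tS.
move=> n; apply: fin_suppD; first exact: fin_supp_tt.
apply: fin_suppN; apply: fin_serM; last exact: fin_ser_e.
by apply: fin_serM; [exact: fin_ser_f|exact: fin_ser_tS].
Qed.
Lemma fin_ser_b p i : fin_ser (bS K p i).
Proof.
case: i; apply: fin_ser_prodShift; last exact: fin_ser_tS.
by apply: fin_ser_inv; exact: (fin_ser_d true).
Qed.

Lemma fin_supp_relY i j k l r s : fin_supp (relY K i j k l r s).
Proof.
have H a b c d e q : fin_supp (mulF (tt K a b c) (tt K d e q)).
  by apply: fin_suppM; apply: fin_supp_tt.
apply: fin_suppD; first by apply: fin_suppD; [|apply: fin_suppZ].
apply: fin_suppN; apply: fin_suppZ; apply: fin_supp_sum => q.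
by apply: fin_suppD => //; apply: fin_suppN.
Qed.

End FreeRing.

(** * Representations of the free algebra and the RTT relation *)

Section Frep.
Variables (K : fieldType) (R : pzRingType) (io : {rmorphism K -> R}) (phi : F K -> R).

(** [phi] is defined on all noncommutative power series but is meaningful only on finite support, so
    each clause carries that restriction. *)
Definition frep : Prop :=
  [/\ forall f g, fin_supp f -> fin_supp g -> phi (addF f g) = phi f + phi g,
      forall c f, fin_supp f -> phi (scaleF c f) = io c * phi f,
      forall f g, fin_supp f -> fin_supp g -> phi (mulF f g) = phi f * phi g &
      phi (oneF K) = 1].

Hypothesis phi_rep : frep.

Lemma frepD f g : fin_supp f -> fin_supp g -> phi (addF f g) = phi f + phi g.
Proof. by case: phi_rep => H _ _ _; apply: H. Qed.
Lemma frepZ c f : fin_supp f -> phi (scaleF c f) = io c * phi f.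
Proof. by case: phi_rep => _ H _ _; apply: H. Qed.
Lemma frepM f g : fin_supp f -> fin_supp g -> phi (mulF f g) = phi f * phi g.
Proof. by case: phi_rep => _ _ H _; apply: H. Qed.
Lemma frep1 : phi (oneF K) = 1.
Proof. by case: phi_rep. Qed.
Lemma frep0 : phi (zeroF K) = 0.
Proof.
have -> : zeroF K = scaleF 0 (oneF K) by apply: funext => w; rewrite /scaleF mul0r.
by rewrite frepZ ?rmorph0 ?mul0r //; exact: fin_supp1.
Qed.
Lemma frepN f : fin_supp f -> phi (oppF f) = - phi f.
Proof. by move=> Hf; rewrite frepZ // rmorphN1 mulN1r. Qed.

Lemma frep_sum (I : eqType) (l : seq I) (G : I -> F K) :
  (forall i, i \in l -> fin_supp (G i)) ->
  phi (sumF [seq G i | i <- l]) = \sum_(i <- l) phi (G i) /\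
  fin_supp (sumF [seq G i | i <- l]).
Proof.
elim: l => [|i l IH] H /=; first by rewrite big_nil frep0; split=> //; exact: fin_supp0.
have [E Fs] : phi (sumF [seq G i | i <- l]) = \sum_(i <- l) phi (G i) /\
    fin_supp (sumF [seq G i | i <- l]).
  by apply: IH => j jl; apply: H; rewrite inE jl orbT.
have Hi : fin_supp (G i) by apply: H; rewrite mem_head.
by split; [rewrite big_cons frepD // E|apply: fin_suppD].
Qed.

Definition phis (a : SerF K) : ser R := fun n => phi (a n).

Lemma phisM a b : fin_ser a -> fin_ser b -> phis (mulSer a b) = phis a * phis b.
Proof.
move=> Ha Hb; apply: funext => n; rewrite /phis (proj1 (frep_sum _)).
  rewrite -[iota _ _]/(index_iota 0 n.+1) big_mkord serM.
  by apply: eq_bigr => i _; rewrite frepM.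
by move=> i _; apply: fin_suppM.
Qed.

Lemma phis_inv a : fin_ser a -> phi (a 0%N) = 1 -> phis (invSer a) = ser_inv (phis a).
Proof.
move=> Ha a0; apply: ser_inv_uniq => //; apply: funext => -[|n].
  by rewrite serM0 /phis a0 mul1r frep1.
rewrite serM big_ord_recl subn0 {1}/phis a0 mul1r {1}/phis invSerS.
have Hf s : fin_supp (mulF (a s) (invSer a (n.+1 - s)%N)).
  by apply: fin_suppM => //; apply: fin_ser_inv.
have [E Fs] := @frep_sum _ (iota 1 n.+1) _ (fun s _ => Hf s).
rewrite frepN // E -[iota 1 _]/(index_iota 1 n.+2) big_add1 big_mkord.
rewrite addrC -sumrB big1 // => i _; rewrite frepM ?subrr //; exact: fin_ser_inv.
Qed.

Lemma phis_shift a j : fin_ser a -> phis (shiftSer a j%:R) = ser_shift j (phis a).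
Proof.
move=> Ha; apply: funext => -[|n] //; rewrite /phis.
rewrite -[shiftSer _ _ _]/(sumF _) (proj1 (frep_sum _)); last first.
  by move=> i _; apply: fin_suppZ.
rewrite -[iota _ _]/(index_iota 0 n.+1) big_mkord; apply: eq_bigr => i _.
by rewrite frepZ // rmorphM rmorphXn !rmorph_nat.
Qed.

Lemma phis1 : phis (oneSer K) = 1.
Proof.
by apply: funext => -[|n]; rewrite /phis /oneSer /= ?frep1 ?frep0.
Qed.

Lemma phis_prodShift a m : fin_ser a -> phis (prodShift a m) = prod_shift (phis a) m.
Proof.
move=> Ha; rewrite /prod_shift /prodShift -(big_mkord xpredT (fun j => ser_shift j (phis a))).
rewrite /index_iota subn0; suff: phis (foldr (fun j acc => mulSer (shiftSer a j%:R) acc)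
    (oneSer K) (iota 0 m)) = \prod_(i <- iota 0 m) ser_shift i (phis a) /\
    fin_ser (foldr (fun j acc => mulSer (shiftSer a j%:R) acc) (oneSer K) (iota 0 m)) by case.
elim: (iota 0 m) => [|j l [IH Hf]] /=.
  rewrite big_nil phis1; split=> // -[|n]; [exact: fin_supp1|exact: fin_supp0].
have Hs : fin_ser (shiftSer a j%:R) by apply: fin_ser_shift.
by rewrite big_cons phisM // IH phis_shift //; split=> //; apply: fin_serM.
Qed.

Definition rep_t (i j : bool) : ser R := phis (tS K i j).

Lemma rep_t0 i j : rep_t i j 0%N = (i == j)%:R.
Proof. by rewrite /rep_t /phis /tS /= frepZ ?frep1 ?mulr1 ?rmorph_nat //; exact: fin_supp1. Qed.

Lemma phis_d1 : phis (d1S K) = dr_d1 rep_t. Proof. by []. Qed.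

Lemma phis_d1V : phis (invSer (d1S K)) = ser_inv (dr_d1 rep_t).
Proof. by rewrite phis_inv //; [exact: fin_ser_tS|exact: rep_t0]. Qed.

Lemma phis_e : phis (eS K) = dr_e rep_t.
Proof.
rewrite /eS phisM ?phis_d1V //; last exact: fin_ser_tS.
by apply: fin_ser_inv; exact: fin_ser_tS.
Qed.

Lemma phis_f : phis (fS K) = dr_f rep_t.
Proof.
rewrite /fS phisM ?phis_d1V //; first exact: fin_ser_tS.
by apply: fin_ser_inv; exact: fin_ser_tS.
Qed.

Lemma phis_d2 : phis (d2S K) = dr_d2 rep_t.
Proof.
have Hfd : fin_ser (mulSer (fS K) (d1S K)).
  by apply: fin_serM; [exact: fin_ser_f|exact: fin_ser_tS].
have Hm : fin_ser (mulSer (mulSer (fS K) (d1S K)) (eS K)).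
  by apply: fin_serM => //; exact: fin_ser_e.
have -> : dr_d2 rep_t = rep_t true true - phis (mulSer (mulSer (fS K) (d1S K)) (eS K)).
  rewrite /dr_d2 phisM ?phis_e //; last exact: fin_ser_e.
  by rewrite phisM ?phis_f //; [exact: fin_ser_f|exact: fin_ser_tS].
apply: funext => n; rewrite /phis /d2S /subSer frepD ?frepN //; first exact: fin_supp_tt.
by apply: fin_suppN.
Qed.

Lemma rep_d2_0 : dr_d2 rep_t 0%N = 1.
Proof.
by rewrite /dr_d2 serB !serM0 /dr_f serM0 !rep_t0 !mul0r subr0.
Qed.

Lemma phis_b1 p : phis (b1S K p) = prod_shift (dr_d1 rep_t) p.
Proof. by apply: phis_prodShift; exact: fin_ser_tS. Qed.

Lemma phis_b2 p : phis (b2S K p) = prod_shift (ser_inv (dr_d2 rep_t)) p.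
Proof.
have Hd : fin_ser (d2S K) := @fin_ser_d K true.
rewrite /b2S phis_prodShift; last exact: fin_ser_inv.
by rewrite phis_inv // ?phis_d2 // -[phi _]/(phis (d2S K) 0%N) phis_d2 rep_d2_0.
Qed.

Let Y (k j i l : bool) r s := rep_t k j r * rep_t i l s - rep_t k j s * rep_t i l r.
Let X (i j k l : bool) r s := rep_t i j r * rep_t k l s
  - (-1) ^+ ((i + j) * (k + l)) * (rep_t k l s * rep_t i j r).

Lemma phi_relY i j k l r s : phi (relY K i j k l r s) =
  X i j k l r s - (-1) ^+ (i * j + i * k + j * k) *
  \sum_(q < minn r s) Y k j i l q (r + s - 1 - q)%N.
Proof.
have H a b c d e q : fin_supp (mulF (tt K a b c) (tt K d e q)).
  by apply: fin_suppM; apply: fin_supp_tt.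
have HN a b c d e q : fin_supp (oppF (mulF (tt K a b c) (tt K d e q))) by apply: fin_suppN.
have Hs : fin_supp (sumF [seq addF (mulF (tt K k j q) (tt K i l (r + s - 1 - q)))
      (oppF (mulF (tt K k j (r + s - 1 - q)) (tt K i l q))) | q <- iota 0 (minn r s)]).
  by apply: fin_supp_sum => q; apply: fin_suppD.
have sgnE n : io (sgn K n) = (-1) ^+ n by rewrite /sgn rmorphXn rmorphN1.
have phiT a b c d e q : phi (mulF (tt K a b c) (tt K d e q)) = rep_t a b c * rep_t d e q.
  by rewrite frepM //; apply: fin_supp_tt.
rewrite /relY /supercomm !frepD //; first last.
- by apply: fin_suppN; apply: fin_suppZ.
- by apply: fin_suppD => //; apply: fin_suppZ.
- exact: fin_suppZ.
rewrite frepN ?frepZ //; last exact: fin_suppZ.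
rewrite rmorphN !sgnE !phiT mulNr; congr (_ - _ * _).
rewrite (proj1 (frep_sum _)); last by move=> q _; apply: fin_suppD.
have -> : iota 0 (minn r s) = index_iota 0 (minn r s) by rewrite /index_iota subn0.
rewrite big_mkord; apply: eq_bigr => q _.
by rewrite frepD // frepN // !phiT.
Qed.

(** Going from (r, s+1) to (r+1, s) keeps the summands, since r + s + 1 is unchanged, and alters the
    range by at most one term. That term is Y r s up to antisymmetry; for r = s the ranges agree and
    Y r r = 0. *)
Lemma relY_sum_step (k j i l : bool) r s :
  \sum_(q < minn r.+1 s) Y k j i l q (r.+1 + s - 1 - q)%N
  - \sum_(q < minn r s.+1) Y k j i l q (r + s.+1 - 1 - q)%N = Y k j i l r s.
Proof.
have YN a b : Y k j i l a b = - Y k j i l b a by rewrite /Y opprB.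
rewrite addSn addnS !subSS !subn0; case: (ltngtP r s) => rs.
- rewrite (minn_idPl rs) (minn_idPl (leqW (ltnW rs))) big_ord_recr /=.
  by rewrite addrAC subrr add0r addKn.
- rewrite (minn_idPr (leqW (ltnW rs))) (minn_idPr rs) big_ord_recr /= opprD addrA subrr.
  by rewrite sub0r addnK -YN.
- rewrite -rs (minn_idPr (leqnSn r)) (minn_idPl (leqnSn r)) subrr.
  by rewrite /Y subrr.
Qed.

Lemma X_r0 i j k l r : X i j k l r 0%N = 0.
Proof.
rewrite /X sign_spar rep_t0 /spar.
by case: i j k l => [] [] [] []; rewrite /= ?mulr0 ?mul0r ?mulr0 ?subrr // mulr1 !mul1r subrr.
Qed.

Lemma X_0s i j k l s : X i j k l 0%N s = 0.
Proof.
rewrite /X sign_spar rep_t0 /spar.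
by case: i j k l => [] [] [] []; rewrite /= ?mulr0 ?mul0r ?mulr0 ?subrr // mulr1 !mul1r subrr.
Qed.

(** The defining relations are the telescoped form of RTT: subtracting them at (r, s+1) from (r+1,
    s) gives RTT, and conversely they follow by induction on s from s = 0, where both sides
    vanish. *)
Lemma frep_rtt :
  (forall i j k l r s, (0 < r)%N -> (0 < s)%N -> phi (relY K i j k l r s) = 0) <-> rtt rep_t.
Proof.
split=> [H|[_ H]].
  split=> [|i j k l r s]; first exact: rep_t0.
  rewrite -/(X i j k l r.+1 s) -/(X i j k l r s.+1).
  have E q q' : X i j k l q q' = (-1) ^+ (i * j + i * k + j * k) *
      \sum_(n < minn q q') Y k j i l n (q + q' - 1 - n)%N.
    case: q => [|q]; first by rewrite X_0s min0n big_ord0 mulr0.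
    case: q' => [|q']; first by rewrite X_r0 minn0 big_ord0 mulr0.
    by apply: subr0_eq; rewrite -phi_relY H.
  by rewrite !E -mulrBr relY_sum_step.
move=> i j k l r s _ _; rewrite phi_relY; apply: eq_subr0.
elim: s r => [|s IH] r; first by rewrite X_r0 minn0 big_ord0 mulr0.
have := H i j k l r s; rewrite -/(X i j k l r.+1 s) -/(X i j k l r s.+1) -/(Y k j i l r s).
rewrite IH -(relY_sum_step k j i l r s) mulrBr => /eqP.
by rewrite subr_eq addrC -subr_eq opprB addrC subrK => /eqP/esym.
Qed.

End Frep.

(** * Evaluation of noncommutative polynomials *)

Section Evaluation.
Variables (K : fieldType) (R : pzRingType) (io : {rmorphism K -> R}) (T : gen -> R).
Hypothesis io_central : forall c, central (io c).

Definition weval (w : seq gen) : R := foldr (fun x a => T x * a) 1 w.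

Lemma weval_cat a b : weval (a ++ b) = weval a * weval b.
Proof. by elim: a => [|x a IH] /=; rewrite ?mul1r // IH mulrA. Qed.

(** A duplicate-free list of words covering the support, picked by choice; [sum_cover] shows that
    evaluation does not depend on it. Off finite support the value is a default. *)
Definition fsupp (f : F K) : seq (seq gen) :=
  if pselect (fin_supp f) is left H then undup (projT1 (cid H)) else [::].

Definition feval (f : F K) : R := \sum_(w <- fsupp f) io (f w) * weval w.

Definition covers (s : seq (seq gen)) (f : F K) := forall w, w \notin s -> f w = 0.

Lemma fsuppP f : fin_supp f -> uniq (fsupp f) /\ covers (fsupp f) f.
Proof.
rewrite /fsupp; case: pselect => // H _; split; first exact: undup_uniq.
by move=> w; rewrite mem_undup; case: (cid H) => s Hs; apply: Hs.
Qed.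

Lemma sum_cover (G : seq gen -> R) (f : F K) s s' : uniq s -> uniq s' ->
  covers s f -> covers s' f ->
  \sum_(w <- s) io (f w) * G w = \sum_(w <- s') io (f w) * G w.
Proof.
move=> Us Us' Cs Cs'.
have E q : \sum_(w <- q) io (f w) * G w = \sum_(w <- [seq w <- q | f w != 0]) io (f w) * G w.
  rewrite big_filter (bigID (fun w => f w != 0)) /= addrC big1 ?add0r // => w.
  by rewrite negbK => /eqP->; rewrite rmorph0 mul0r.
rewrite E [RHS]E; apply: perm_big; apply: uniq_perm; rewrite ?filter_uniq // => w.
rewrite !mem_filter; case: eqP => //= /eqP fw.
by apply/idP/idP => _; apply: contraNT fw; [move/Cs'->|move/Cs->].
Qed.

Lemma fevalE f s : uniq s -> covers s f -> feval f = \sum_(w <- s) io (f w) * weval w.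
Proof.
move=> Us Cs; have [] : uniq (fsupp f) /\ covers (fsupp f) f by apply: fsuppP; exists s.
by move=> *; apply: sum_cover.
Qed.

Lemma mulF_cover f g s s' w : uniq s -> uniq s' -> covers s f -> covers s' g ->
  mulF f g w = \sum_(a <- s) \sum_(b <- s') (w == a ++ b)%:R * (f a * g b).
Proof.
move=> Us Us' Cs Cs'.
have E (h : F K) q v : uniq q -> covers q h -> h v = \sum_(a <- q) (v == a)%:R * h a.
  move=> Uq Cq; case: (boolP (v \in q)) => [vq|vq].
    rewrite (bigD1_seq v) //= eqxx mul1r big1 ?addr0 // => a /negbTE av.
    by rewrite eq_sym av mul0r.
  rewrite Cq // big1_seq // => a /andP[_ aq]; case: eqP => [va|]; last by rewrite mul0r.
  by rewrite va aq in vq.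
rewrite /mulF.
under eq_bigr => i _.
  rewrite (E f s (take i w) Us Cs) (E g s' (drop i w) Us' Cs') big_distrl /=.
  under eq_bigr => a _ do rewrite big_distrr /=.
  over.
rewrite exchange_big /=; apply: eq_bigr => a _; rewrite exchange_big /=.
apply: eq_bigr => b _.
under eq_bigr => i _ do rewrite mulrACA -natrM mulnb.
rewrite -big_distrl /=; congr (_ * _); case: (eqVneq w (a ++ b)) => [->|ab].
  have sa : (size a < (size (a ++ b)).+1)%N by rewrite ltnS size_cat leq_addr.
  rewrite (bigD1 (Ordinal sa)) //= take_size_cat // drop_size_cat // !eqxx /=.
  rewrite big1 ?addr0 // => i /eqP ia; case: eqP => //= ta; case: ia; apply: val_inj => /=.
  by rewrite -(size_takel (s := a ++ b) (n0 := i)) ?ta // -ltnS ltn_ord.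
rewrite big1 // => i _; case: eqP => //= ta; case: eqP => //= db.
by rewrite -ta -db cat_take_drop eqxx in ab.
Qed.

Lemma feval_rep : frep io feval.
Proof.
split.
- move=> f g Hf Hg; have [Uf Cf] := fsuppP Hf; have [Ug Cg] := fsuppP Hg.
  pose s := undup (fsupp f ++ fsupp g).
  have ms w : (w \notin s) = (w \notin fsupp f) && (w \notin fsupp g).
    by rewrite mem_undup mem_cat negb_or.
  have Us : uniq s := undup_uniq _.
  have C1 : covers s f by move=> w; rewrite ms => /andP[/Cf].
  have C2 : covers s g by move=> w; rewrite ms => /andP[_ /Cg].
  rewrite (fevalE Us C1) (fevalE Us C2) (@fevalE _ s) //; last first.
    by move=> w Hw; rewrite /addF C1 // C2 // addr0.
  by rewrite -big_split; apply: eq_bigr => w _; rewrite /addF rmorphD mulrDl.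
- move=> c f Hf; have [Uf Cf] := fsuppP Hf; rewrite (fevalE Uf Cf) (@fevalE _ (fsupp f)) //.
    by rewrite mulr_sumr; apply: eq_bigr => w _; rewrite /scaleF rmorphM mulrA.
  by move=> w Hw; rewrite /scaleF Cf // mulr0.
- move=> f g Hf Hg; have [Uf Cf] := fsuppP Hf; have [Ug Cg] := fsuppP Hg.
  pose s := undup [seq a ++ b | a <- fsupp f, b <- fsupp g].
  have Us : uniq s := undup_uniq _.
  rewrite (@fevalE _ s) //; last first.
    move=> w; rewrite mem_undup => Hw; rewrite (mulF_cover w Uf Ug Cf Cg) big1_seq // => a.
    move=> /andP[_ af]; rewrite big1_seq // => b /andP[_ bg]; case: eqP => [wab|]; last first.
      by rewrite mul0r.
    by case/negP: Hw; rewrite wab; apply: allpairs_f.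
  under eq_bigr => w _ do rewrite (mulF_cover w Uf Ug Cf Cg) rmorph_sum mulr_suml.
  rewrite exchange_big /= /feval big_distrl /=; apply: eq_big_seq => a af.
  under eq_bigr => w _ do rewrite rmorph_sum mulr_suml.
  rewrite exchange_big /= big_distrr /=; apply: eq_big_seq => b bg.
  have abs : a ++ b \in s by rewrite mem_undup; apply: allpairs_f.
  rewrite (bigD1_seq (a ++ b)) //= eqxx mul1r big1 ?addr0; last first.
    by move=> w /negbTE->; rewrite mul0r rmorph0 mul0r.
  rewrite weval_cat rmorphM -!mulrA; congr (_ * _).
  by rewrite !mulrA io_central.
- rewrite (@fevalE _ [:: [::]]) // ?big_seq1 ?rmorph1 ?mulr1 //.
  by move=> w; rewrite inE /oneF => /negbTE->.
Qed.

Lemma feval_X x : feval (XF K x) = T x.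
Proof.
rewrite (@fevalE _ [:: [:: x]]) ?big_seq1 /XF ?eqxx ?rmorph1 ?mul1r /= ?mulr1 //.
by move=> w; rewrite inE => /negbTE->.
Qed.

End Evaluation.

(** * The ring Y^[p] as a quotient of the free algebra *)

Section QuotientRing.
Variables (K : fieldType) (p : nat).

Definition finF_pred : {pred (F K)} := [pred f : F K | asbool (fin_supp f)].

Fact finF_subring : subring_closed finF_pred.
Proof.
split=> [|f g /asboolP Hf /asboolP Hg|f g /asboolP Hf /asboolP Hg]; apply/asboolP.
- exact: fin_supp1.
- by apply: fin_suppD => //; apply: fin_suppN.
- exact: fin_suppM.
Qed.
HB.instance Definition _ := GRing.isSubringClosed.Build (F K) finF_pred finF_subring.

Record finF := FinF { finF_val : F K; finF_valP : finF_val \in finF_pred }.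
HB.instance Definition _ := [isSub for finF_val].
HB.instance Definition _ := [Choice of finF by <:].
HB.instance Definition _ := 
  GRing.SubChoice_isSubPzRing.Build (F K) finF_pred finF (GRing.subringClosedP _).

Definition idealY : {pred finF} := [pred a | asbool (ideal2 (relYp p) (finF_val a))].

Lemma idealYP a : reflect (ideal2 (relYp p) (finF_val a)) (a \in idealY).
Proof. exact: asboolP. Qed.

Lemma finFP (a : finF) : fin_supp (finF_val a).
Proof. by apply/asboolP; exact: finF_valP. Qed.

Lemma sumF_cat (l l' : seq (F K)) : sumF (l ++ l') = addF (sumF l) (sumF l').
Proof. by elim: l => [|f l IH] /=; rewrite ?add0F // IH addFA. Qed.

Lemma ideal2D (S : F K -> Prop) f g : ideal2 S f -> ideal2 S g -> ideal2 S (addF f g).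
Proof.
move=> [l [Hl El]] [l' [Hl' El']]; exists (l ++ l'); split.
  by move=> x /in_app_iff[/Hl|/Hl'].
by move=> w; rewrite map_cat sumF_cat /addF El El'.
Qed.

Lemma mulF_sumr (I : Type) f (l : seq I) (G : I -> F K) :
  mulF f (sumF [seq G x | x <- l]) = sumF [seq mulF f (G x) | x <- l].
Proof.
elim: l => [|x l IH] /=; first exact: (@mulr0 (F K)).
by rewrite mulFDr IH.
Qed.
Lemma mulF_suml (I : Type) f (l : seq I) (G : I -> F K) :
  mulF (sumF [seq G x | x <- l]) f = sumF [seq mulF (G x) f | x <- l].
Proof.
elim: l => [|x l IH] /=; first exact: (@mul0r (F K)).
by rewrite mulFDl IH.
Qed.

Lemma ideal2Ml (S : F K -> Prop) f g : fin_supp f -> ideal2 S g -> ideal2 S (mulF f g).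
Proof.
move=> Ff [l [Hl /funext El]]; exists [seq (mulF f x.1.1, x.1.2, x.2) | x <- l]; split.
  by move=> _ /in_map_iff[x [<- /Hl[? ? ?]]]; split=> //; apply: fin_suppM.
rewrite El mulF_sumr -map_comp => w; congr (sumF _ w); apply: eq_map => x /=.
by rewrite !mulFA.
Qed.

Lemma ideal2Mr (S : F K -> Prop) f g : fin_supp f -> ideal2 S g -> ideal2 S (mulF g f).
Proof.
move=> Ff [l [Hl /funext El]]; exists [seq (x.1.1, x.1.2, mulF x.2 f) | x <- l]; split.
  by move=> _ /in_map_iff[x [<- /Hl[? ? ?]]]; split=> //; apply: fin_suppM.
rewrite El mulF_suml -map_comp => w; congr (sumF _ w); apply: eq_map => x /=.
by rewrite !mulFA.
Qed.

Fact idealY_zmod : zmod_closed idealY.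
Proof.
split=> [|a b /idealYP Ha /idealYP Hb]; apply/idealYP; first by exists [::].
rewrite -[finF_val _]/(addF (finF_val a) (oppF (finF_val b))).
apply: ideal2D => //; rewrite /oppF scaleFE.
by apply: ideal2Ml => //; apply: fin_suppZ; exact: fin_supp1.
Qed.
HB.instance Definition _ := GRing.isZmodClosed.Build finF idealY idealY_zmod.

Lemma idealYMl a b : b \in idealY -> a * b \in idealY.
Proof. by move=> /idealYP Hb; apply/idealYP; apply: ideal2Ml => //; apply: finFP. Qed.
Lemma idealYMr a b : b \in idealY -> b * a \in idealY.
Proof. by move=> /idealYP Hb; apply/idealYP; apply: ideal2Mr => //; apply: finFP. Qed.

Local Open Scope quotient_scope.

Definition Yquot := Quotient.quot idealY.
Definition Yp : Type := Yquot.
HB.instance Definition _ := GRing.Zmodule.on Yp.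

Definition Yproj (a : finF) : Yp := \pi_Yquot a.

Fact Yproj_zmod : zmod_morphism Yproj.
Proof.
move=> a b; rewrite /Yproj Quotient.pi_add Quotient.pi_opp.
by [].
Qed.
HB.instance Definition _ := GRing.isZmodMorphism.Build finF Yp Yproj Yproj_zmod.

Lemma Yproj_eq a b : Yproj a = Yproj b <-> a - b \in idealY.
Proof.
rewrite Quotient.idealrBE; split=> [E|/eqP E] //.
by apply/eqP.
Qed.

Definition Yrepr (x : Yp) : finF := repr (x : Yquot).

Lemma YreprK x : Yproj (Yrepr x) = x. Proof. exact: reprK. Qed.

(** Multiplication on chosen representatives; compatibility with the projection, [YprojM], is where
    the ideal must be two-sided. *)
Definition Ymul (x y : Yp) : Yp := Yproj (Yrepr x * Yrepr y).

Lemma YprojM a b : Yproj (a * b) = Ymul (Yproj a) (Yproj b).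
Proof.
apply/Yproj_eq; set a' := Yrepr (Yproj a); set b' := Yrepr (Yproj b).
have Ha : a - a' \in idealY by apply/Yproj_eq; rewrite YreprK.
have Hb : b - b' \in idealY by apply/Yproj_eq; rewrite YreprK.
have -> : a * b - a' * b' = (a - a') * b + a' * (b - b').
  by rewrite mulrBl mulrBr addrA subrK.
by apply: rpredD; [apply: idealYMr|apply: idealYMl].
Qed.

Fact YmulA : associative Ymul.
Proof.
by move=> x y z; rewrite -[x]YreprK -[y]YreprK -[z]YreprK -!YprojM mulrA.
Qed.
Fact Ymul1 : left_id (Yproj 1) Ymul.
Proof. by move=> x; rewrite -[x]YreprK -YprojM mul1r. Qed.
Fact Ymulr1 : right_id (Yproj 1) Ymul.
Proof. by move=> x; rewrite -[x]YreprK -YprojM mulr1. Qed.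
Fact YmulDl : left_distributive Ymul +%R.
Proof.
move=> x y z; rewrite -[x]YreprK -[y]YreprK -[z]YreprK -raddfD -!YprojM -raddfD.
by rewrite mulrDl.
Qed.
Fact YmulDr : right_distributive Ymul +%R.
Proof.
move=> x y z; rewrite -[x]YreprK -[y]YreprK -[z]YreprK -raddfD -!YprojM -raddfD.
by rewrite mulrDr.
Qed.
HB.instance Definition _ := GRing.Zmodule_isPzRing.Build Yp YmulA Ymul1 Ymulr1 YmulDl YmulDr.

Fact Yproj_monoid : monoid_morphism Yproj.
Proof. by split=> // a b; apply: YprojM. Qed.
HB.instance Definition _ := GRing.isMonoidMorphism.Build finF Yp Yproj Yproj_monoid.

Definition toY (f : F K) : Yp :=
  if pselect (fin_supp f) is left H then Yproj (FinF (asboolT H)) else 0.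

Lemma toYE (a : finF) : toY (finF_val a) = Yproj a.
Proof.
rewrite /toY; case: pselect => [H|]; last by case; exact: finFP.
by congr Yproj; apply: val_inj.
Qed.

Lemma finF_of f : fin_supp f -> exists a : finF, finF_val a = f.
Proof. by move=> H; exists (FinF (asboolT H)). Qed.

Fact ioF_subproof (c : K) : scaleF c (oneF K) \in finF_pred.
Proof. by apply/asboolP; apply: fin_suppZ; exact: fin_supp1. Qed.
Definition ioF (c : K) : finF := FinF (ioF_subproof c).

Fact ioF_zmod : zmod_morphism ioF.
Proof.
move=> c d; apply: val_inj; apply: funext => w; rewrite /= /scaleF mulrBl.
by rewrite -mulN1r.
Qed.
HB.instance Definition _ := GRing.isZmodMorphism.Build K finF ioF ioF_zmod.
Fact ioF_monoid : monoid_morphism ioF.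
Proof.
split=> [|c d]; apply: val_inj.
  by apply: funext => w; rewrite /= /scaleF mul1r.
rewrite -[RHS]/(scaleF c (oneF K) * scaleF d (oneF K)) -scaleFE.
by apply: funext => w; rewrite /= /scaleF mulrA.
Qed.
HB.instance Definition _ := GRing.isMonoidMorphism.Build K finF ioF ioF_monoid.

Definition ioY (c : K) : Yp := Yproj (ioF c).
HB.instance Definition _ := GRing.RMorphism.copy ioY (Yproj \o ioF).

Lemma scaleF_mulr (c : K) (f g : F K) : mulF f (scaleF c g) = scaleF c (mulF f g).
Proof.
apply: funext => w; rewrite /mulF /scaleF mulr_sumr; apply: eq_bigr => i _.
by rewrite mulrCA.
Qed.

Lemma ioY_central c : central (ioY c).
Proof.
move=> x; rewrite -[x]YreprK /ioY -!rmorphM; congr Yproj; apply: val_inj => /=.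
rewrite -[LHS]/(scaleF c (oneF K) * finF_val (Yrepr x)) -scaleFE.
rewrite -[RHS]/(mulF (finF_val (Yrepr x)) (scaleF c (oneF K))) scaleF_mulr.
by rewrite (mulF1 (finF_val _)).
Qed.

Lemma toY_rep : frep ioY toY.
Proof.
split.
- move=> f g /finF_of[a <-] /finF_of[b <-]; rewrite -[addF _ _]/(finF_val (a + b)).
  by rewrite !toYE rmorphD.
- move=> c f /finF_of[a <-]; rewrite scaleFE -[_ * _]/(finF_val (ioF c * a)).
  by rewrite !toYE rmorphM.
- move=> f g /finF_of[a <-] /finF_of[b <-]; rewrite -[mulF _ _]/(finF_val (a * b)).
  by rewrite !toYE rmorphM.
- by rewrite -[oneF K]/(finF_val 1) toYE rmorph1.
Qed.

Lemma toY_eq0 f : fin_supp f -> toY f = 0 <-> ideal2 (relYp p) f.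
Proof.
move=> /finF_of[a <-]; rewrite toYE -(rmorph0 Yproj).
by rewrite Yproj_eq subr0; split=> /idealYP.
Qed.

(** Y^[p] is spanned by words in the generators, and words are built by left multiplication. *)
Lemma Yp_ind (P : Yp -> Prop) :
  (forall x y, P x -> P y -> P (x + y)) -> (forall c x, P x -> P (ioY c * x)) ->
  P 1 -> (forall x y, P y -> P (toY (XF K x) * y)) -> forall x, P x.
Proof.
move=> PD PZ P1 PX.
have P0 : P 0 by rewrite -[0](mul0r 1) -(rmorph0 ioY); apply: PZ.
suff H f : fin_supp f -> P (toY f).
  by move=> x; rewrite -[x]YreprK -toYE; apply: H; exact: finFP.
have Pw : forall w, P (toY (fun v => (v == w)%:R)) /\ fin_supp (fun v => (v == w)%:R : K).
  elim=> [|x w [IH Fw]].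
    by rewrite -[fun v => _]/(oneF K) (frep1 toY_rep); split=> //; exact: fin_supp1.
  have -> : (fun v => (v == x :: w)%:R) = mulF (XF K x) (fun v => (v == w)%:R : K).
    apply: funext => -[|y v]; first by rewrite mulF_nil mul0r.
    rewrite mulF_cons mul0r add0r eqseq_cons.
    have -> : lderiv y (XF K x) = scaleF (y == x)%:R (oneF K).
      by apply: funext => u; rewrite /lderiv /XF /scaleF /oneF eqseq_cons -natrM mulnb.
    have Es c (h : F K) : mulF (scaleF c (oneF K)) h = scaleF c h := esym (scaleFE c h).
    by rewrite Es /scaleF -natrM mulnb.
  have FX := fin_suppX K x; split; last exact: fin_suppM.
  by rewrite (frepM toY_rep) //; apply: PX.
move=> [s Hs]; elim: s f Hs => [|w s IH] f Hs.
  have -> : f = zeroF K by apply: funext => v; apply: Hs.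
  by rewrite (frep0 toY_rep).
pose g : F K := fun v => if v == w then 0 else f v.
have Hg v : v \notin s -> g v = 0.
  by rewrite /g => vs; case: eqP => // /eqP vw; apply: Hs; rewrite inE negb_or vw.
have -> : f = addF (scaleF (f w) (fun v => (v == w)%:R)) g.
  apply: funext => v; rewrite /addF /scaleF /g; case: eqP => [->|_].
    by rewrite mulr1 addr0.
  by rewrite mulr0 add0r.
have [Pww Fw] := Pw w; have Fg : fin_supp g by exists s.
rewrite (frepD toY_rep) ?(frepZ toY_rep) //; last exact: fin_suppZ.
by apply: PD; [apply: PZ|apply: IH].
Qed.

End QuotientRing.

(** * The finiteness criterion *)

Section Final.
Variables (K : closedFieldType) (p : nat).
Hypotheses (hp : p \in [pchar K]) (hp2 : (2 < p)%N).
Variable lam : bool -> ser K.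
Hypothesis hlam0 : forall i, lam i 0%N = 1.
Hypothesis hres : forall i, restricted p (lam i).

Lemma natr2_neq0 : 2%:R != 0 :> K.
Proof.
rewrite -(dvdn_pcharf hp); apply/negP => /dvdn_leq => /(_ isT).
by rewrite leqNgt hp2.
Qed.

Lemma two_regular (R : pzRingType) (io : {rmorphism K -> R}) (x : R) : x + x = 0 -> x = 0.
Proof.
move=> x2; transitivity (io 2%:R^-1 * (x + x)); last by rewrite x2 mulr0.
rewrite -mulr2n -[x *+ 2]mulr_natl mulrA -(rmorph_nat io) -rmorphM mulVf ?natr2_neq0 //.
by rewrite rmorph1 mul1r.
Qed.

Lemma prod_shift_lam i : prod_shift (lam i) p = 1.
Proof.
apply: funext => n; rewrite -[RHS]/(oneK K n) -(hres i) /prod_shift /prodShiftK.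
congr (_ n); rewrite -(big_mkord xpredT (fun j => ser_shift j (lam i))).
rewrite /index_iota subn0; elim: (iota 0 p) => [|j l IH]; first by rewrite big_nil.
by rewrite big_cons IH.
Qed.

Lemma ideal2_gen (S : F K -> Prop) g : S g -> ideal2 S g.
Proof.
move=> Sg; exists [:: (oneF K, g, oneF K)]; split.
  by move=> x [<-|//]; split=> //; exact: fin_supp1.
by move=> w; rewrite /= mul1F mulF1 addFC add0F.
Qed.

Lemma idealL_gen (S : F K -> Prop) g : S g -> idealL S g.
Proof.
move=> Sg; exists [:: (oneF K, g)]; split.
  by move=> x [<-|//]; split=> //; exact: fin_supp1.
by move=> w; rewrite /= mul1F addFC add0F.
Qed.

Lemma idealLD (S : F K -> Prop) f g : idealL S f -> idealL S g -> idealL S (addF f g).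
Proof.
move=> [l [Hl El]] [l' [Hl' El']]; exists (l ++ l'); split.
  by move=> x /in_app_iff[/Hl|/Hl'].
by move=> w; rewrite map_cat sumF_cat /addF El El'.
Qed.

Lemma idealLM (S : F K -> Prop) f g : fin_supp f -> idealL S g -> idealL S (mulF f g).
Proof.
move=> Ff [l [Hl /funext El]]; exists [seq (mulF f x.1, x.2) | x <- l]; split.
  by move=> _ /in_map_iff[x [<- /Hl[? ?]]]; split=> //; apply: fin_suppM.
rewrite El mulF_sumr -map_comp => w; congr (sumF _ w); apply: eq_map => x /=.
by rewrite mulFA.
Qed.

Local Notation KZ := (KZ p lam).

Lemma KZ_ideal2 g : ideal2 (relYp p) g -> KZ g.
Proof. by move=> H; apply: idealL_gen; left. Qed.

(** * From finite dimension to a Hankel recurrence *)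

Section Forward.

Local Notation R := (Yp K p).
Local Notation t := (rep_t (@toY K p)).
Let phi_rep := @toY_rep K p.

Definition JY (x : R) : Prop := exists2 a : finF K, KZ (finF_val a) & x = Yproj p a.

Lemma JY0 : JY 0.
Proof. by exists 0; rewrite ?rmorph0 //; exists [::]. Qed.
Lemma JYD x y : JY x -> JY y -> JY (x + y).
Proof. by move=> [a Ha ->] [b Hb ->]; exists (a + b); rewrite ?rmorphD //; apply: idealLD. Qed.
Lemma JYM x y : JY y -> JY (x * y).
Proof.
move=> [b Hb ->]; rewrite -[x]YreprK; exists (Yrepr x * b); rewrite ?rmorphM //.
by apply: idealLM => //; apply: finFP.
Qed.

Lemma JY_of g : fin_supp g -> KZ g -> JY (toY p g).
Proof. by move=> /finF_of[a <-] H; exists a; rewrite ?toYE. Qed.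

Lemma Y_rtt : rtt t.
Proof.
apply/(frep_rtt phi_rep) => i j k l r s r0 s0; apply/toY_eq0; first exact: fin_supp_relY.
by apply: ideal2_gen; left; exists i, j, k, l, r, s.
Qed.

Let R2 := @two_regular R (@ioY K p).

Lemma JY_e r : JY (dr_e t r.+1).
Proof.
rewrite -(phis_e phi_rep); apply: JY_of; first exact: fin_ser_e.
by apply: idealL_gen; right; left; exists r.+1.
Qed.

Lemma JY_d i (d : ser R) : phis (@toY K p) (dS K i) = d -> d 0%N = 1 -> Jeq (@ioY K p) JY d (lam i).
Proof.
move=> dE d0 [|n].
  by rewrite serB d0 /ser_map hlam0 rmorph1 subrr; exact: JY0.
rewrite -dE.
have Fd := @fin_ser_d K i; have F1 := @fin_supp1 K.
have -> : (phis (@toY K p) (dS K i) - ser_map (@ioY K p) (lam i)) n.+1 =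
    toY p (addF (dS K i n.+1) (scaleF (- lam i n.+1) (oneF K))).
  by rewrite (frepD phi_rep) ?(frepZ phi_rep) ?(frep1 phi_rep) ?mulr1 ?rmorphN //; apply: fin_suppZ.
apply: JY_of; first by apply: fin_suppD => //; apply: fin_suppZ.
by apply: idealL_gen; right; right; exists i, n.+1.
Qed.

Lemma JY_d1 : Jeq (@ioY K p) JY (dr_d1 t) (lam false).
Proof. by apply: JY_d => //; exact: (dr_d1_0 Y_rtt). Qed.
Lemma JY_d2 : Jeq (@ioY K p) JY (dr_d2 t) (lam true).
Proof. by apply: JY_d; [exact: (phis_d2 phi_rep)|exact: (dr_d2_0 Y_rtt)]. Qed.

Lemma Y_fspanT x : fspan (@ioY K p) t JY x.
Proof.
have st i j : fstable (@ioY K p) t JY (t i j).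
  exact: (fstable_t (@ioY_central K p) Y_rtt R2 JY0 JYD JYM hlam0 JY_e JY_d1 JY_d2).
elim/Yp_ind: x => [x y|c x||[[i j] r] y Hy].
- exact: fspan_D.
- exact: fspan_Z.
- exact: fspan_1.
- exact: st i j r.+1 y Hy.
Qed.

Lemma JY1 : JY 1 -> KZ (oneF K).
Proof.
move=> [a Ha]; rewrite -(rmorph1 (Yproj p)) => /Yproj_eq/idealYP/KZ_ideal2 H.
have -> : oneF K = addF (finF_val (1 - a)) (finF_val a).
  by rewrite -[addF _ _]/(finF_val (1 - a + a)) subrK.
exact: idealLD.
Qed.

(** If b f is congruent to 1 modulo [JY], lifting to the free algebra writes 1 as an element of [KZ]
    plus a left multiple of f, which membership in [ML] forbids. *)
Lemma ML_not_generating f : ML p lam f -> ~ generating JY (toY p f).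
Proof.
move=> [/finF_of[a Ea] Nf] [b [c Hc E]]; apply: Nf; move: E; rewrite -Ea toYE.
rewrite -[b]YreprK -rmorphM -(rmorph1 (Yproj p)) -rmorphB => /Yproj_eq/idealYP/KZ_ideal2 H.
set b' := Yrepr b in H.
have -> : oneF K = addF (mulF (finF_val b') (finF_val a))
   (addF (mulF (finF_val (- 1)) (finF_val (b' * a - 1 - c))) (mulF (finF_val (- 1)) (finF_val c))).
  rewrite -[RHS]/(finF_val (b' * a + (- 1 * (b' * a - 1 - c) + - 1 * c))).
  rewrite -[LHS]/(finF_val (1 : finF K)); congr finF_val.
  by ncring (@nil (finF K)) I.
apply: idealLD; first by apply: idealLM; [exact: finFP|apply: idealL_gen; right].
by apply: idealLD; (apply: idealLM; [exact: finFP|apply: idealL_gen; left]).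
Qed.

Lemma left_kernel m n (A : 'M[K]_(m, n)) : (n < m)%N ->
  exists2 a : 'rV[K]_m, a != 0 & a *m A = 0.
Proof.
move=> nm; have : kermx A != 0.
  by rewrite kermx_eq0 /row_free neq_ltn (leq_ltn_trans (rank_leq_col A)).
by move/rowV0Pn => [a /sub_kermxP aA a0]; exists a.
Qed.

Lemma toY_comb (cs : seq K) (vs : seq (F K)) : (forall v, In v vs -> fin_supp v) ->
  toY p (sumF [seq scaleF x.1 x.2 | x <- zip cs vs]) =
    \sum_(j < size vs) ioY p cs`_j * toY p (nth (zeroF K) vs j) /\
  fin_supp (sumF [seq scaleF x.1 x.2 | x <- zip cs vs]).
Proof.
elim: vs cs => [|v vs IH] cs Fv.
  by rewrite big_ord0; case: cs => [|c cs] /=; split; rewrite ?(frep0 phi_rep) //; exact: fin_supp0.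
have Fvs : forall u, In u vs -> fin_supp u by move=> u uvs; apply: Fv; right.
have Fv0 : fin_supp v by apply: Fv; left.
case: cs => [|c cs] /=.
  rewrite (frep0 phi_rep) big1; first by split=> //; exact: fin_supp0.
  by move=> i _; rewrite nth_nil rmorph0 mul0r.
have [E Fs] := IH cs Fvs; split; last by apply: fin_suppD => //; apply: fin_suppZ.
rewrite big_ord_recl /= (frepD phi_rep) ?(frepZ phi_rep) // ?E //; exact: fin_suppZ.
Qed.

Lemma fin_dim_hankel : L_fin_dim p lam ->
  exists n (a : 'rV[K]_n), a != 0 /\
    forall r, \sum_(s < n) a 0 s * mu lam (r + s).+1 = 0.
Proof.
move=> [vs [Fvs H]].
have [cs Hcs] := choice (fun s => H (fS K s.+1) (@fin_ser_f K s.+1)).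
(* If 1 were in [KZ], then [ML] would be empty, whereas finite dimension provides elements of it. *)
have J1 : ~ JY 1.
  move=> /JY1 H1; have [_ []] := Hcs 0%N; exact: idealL_gen (or_introl H1).
(* Coordinates of f^(1), f^(2), ... modulo [ML]; one row more than columns forces a nonzero left
   kernel vector. *)
pose A := \matrix_(s < (size vs).+1, j < size vs) (cs s)`_j.
have [a a0 aA] := left_kernel A (ltnSn _); exists (size vs).+1, a; split=> // r.
pose a' (s : nat) := a 0 (inord s).
have a'E (s : 'I_(size vs).+1) : a' s = a 0 s by rewrite /a' inord_val.
under eq_bigr => s _ do rewrite -a'E.
apply: (not_generating_hankel (@ioY_central K p) Y_rtt R2 JY0 JYD JYM hlam0 JY_e JY_d1 JY_d2).
pose y s := toY p (addF (fS K s.+1)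
  (oppF (sumF [seq scaleF x.1 x.2 | x <- zip (cs s) vs]))).
(* The kernel vector cancels the spanning vectors, so f^(s+1) may be replaced by its remainder y_s,
   which lies in [ML]. *)
have -> : \sum_(s < (size vs).+1) ioY p (a' s) * dr_f t s.+1 =
          \sum_(s < (size vs).+1) ioY p (a' s) * y s.
  apply: subr0_eq; rewrite -sumrB.
  transitivity (\sum_(s < (size vs).+1) \sum_(j < size vs)
      ioY p (a 0 s * A s j) * toY p (nth (zeroF K) vs j)).
    apply: eq_bigr => s _; rewrite -mulrBr /y; have [E Fs] := toY_comb (cs s) Fvs.
    rewrite (frepD phi_rep) ?(frepN phi_rep) //; last exact: fin_suppN.
      rewrite -(phis_f phi_rep) opprD opprK addrA subrr add0r E mulr_sumr a'E.
      by apply: eq_bigr => j _; rewrite mxE rmorphM mulrA.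
    exact: fin_ser_f.
  rewrite exchange_big big1 // => j _; rewrite -mulr_suml -rmorph_sum.
  by have /matrixP/(_ 0 j) := aA; rewrite !mxE => ->; rewrite rmorph0 mul0r.
apply: (not_generating_sum (@ioY_central K p) Y_rtt R2 JY0 JYD JYM Y_fspanT J1) => s _.
exact: ML_not_generating.
Qed.

End Forward.
End Final.

(** * Rational series *)

Section Rational.
Variable K : fieldType.
Implicit Types (P Q : {poly K}) (A B : ser K).

Definition rser P : ser K := rcoef P.

(** Dividing by the power of u given by the degree turns the factor u - x into 1 - x/u. *)
Lemma rser_factor P x : P != 0 -> rser (P * ('X - x%:P)) = rser P * lin_ser (- x).
Proof.
move=> P0; rewrite ser_mulC /lin_ser mulrDl mul1r -mulrA.
have [d sP] : exists d, size P = d.+1.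
  by exists (size P).-1; rewrite prednK // lt0n size_poly_eq0.
have sPx : size (P * ('X - x%:P)) = d.+2.
  by rewrite size_Mmonic ?monicXsubC // size_XsubC sP addn2.
have hi k : (d < k)%N -> P`_k = 0 by move=> dk; rewrite nth_default // sP.
have co k : (P * ('X - x%:P))`_k = (if k == 0%N then 0 else P`_k.-1) - x * P`_k.
  by rewrite mulrBr coefB coefMX [P * _]mulrC coefCM.
apply: funext => j; rewrite serD /rser /rcoef sPx /=.
case: j => [|j].
  by rewrite serXM0 addr0 !subn0 co /= sP /= (hi d.+1) // mulr0 subr0.
rewrite serXMS serCM sP /= subSS ltnS co mulNr.
case: (ltngtP j d) => jd.
- by rewrite !ltnS (ltnW jd) jd subn_eq0 leqNgt jd subnS.
- by rewrite !ltnS leqNgt jd /= ltnNge (ltnW jd) /= mulr0 subr0.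
- by rewrite jd ltnS leqnn ltnn subnn /= !sub0r.
Qed.

Lemma rser0 P : P \is monic -> rser P 0%N = 1.
Proof.
move=> mP; rewrite /rser /rcoef subn0 lt0n size_poly_eq0 monic_neq0 //.
exact/eqP.
Qed.

Lemma lin_ser0 (a : K) : lin_ser a 0%N = 1.
Proof. by rewrite /lin_ser serD serXM0 addr0. Qed.

(** A common root x contributes the invertible factor 1 - x/u to both sides; removing it lowers the
    degree. *)
Lemma coprime_quotient A B P Q : P \is monic -> Q \is monic -> size P = size Q ->
  A * rser Q = B * rser P ->
  exists P' Q' : {poly K}, [/\ P' \is monic, Q' \is monic, size P' = size Q',
    forall x, ~ (root P' x /\ root Q' x) & A * rser Q' = B * rser P'].
Proof.
have [n] := ubnP (size P); elim: n P Q => // n IH P Q Pn mP mQ sPQ E.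
case: (pselect (exists x, root P x /\ root Q x)) => [[x [Px Qx]]|N]; last first.
  by exists P, Q; split=> // x Hx; apply: N; exists x.
have [P1 EP] := factor_theorem _ _ Px; have [Q1 EQ] := factor_theorem _ _ Qx.
have mx := monicXsubC x.
have mP1 : P1 \is monic by move: mP; rewrite EP monicMr.
have mQ1 : Q1 \is monic by move: mQ; rewrite EQ monicMr.
have sz P0 : P0 \is monic -> size (P0 * ('X - x%:P)) = (size P0).+1.
  by move=> m0; rewrite size_Mmonic ?monic_neq0 // size_XsubC addn2.
apply: (IH P1 Q1) => //.
- by move: Pn; rewrite EP sz.
- by move: sPQ; rewrite EP EQ !sz // => -[].
- apply: (@ser_mulIr _ (lin_ser (- x))); first exact: lin_ser0.
  by rewrite -!mulrA -!rser_factor ?monic_neq0 // -EP -EQ.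
Qed.

(** P is the monic multiple of the polynomial with coefficients a_s, and d its degree. By the
    recurrence, u^-d P(u) m(u) has no terms beyond u^-d, so it equals u^-d Q(u) for a polynomial Q,
    monic of degree d since m has constant term 1. *)
Lemma hankel_rational A B n (a : 'rV[K]_n) : A 0%N = 1 -> B 0%N = 1 -> a != 0 ->
  (forall r, \sum_(s < n) a 0 s * (ser_inv A * B) (r + s).+1 = 0) ->
  exists P Q : {poly K}, [/\ P \is monic, Q \is monic, size P = size Q &
    A * rser Q = B * rser P].
Proof.
move=> A0 B0 a0 H; set m := ser_inv A * B in H.
have m0 : m 0%N = 1 by rewrite /m serM0 B0 ser_inv0 mul1r.
pose Q0 := \poly_(s < n) (if insub s is Some i then a 0 i else 0).
have Q0E (s : 'I_n) : Q0`_s = a 0 s by rewrite coef_poly ltn_ord valK.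
have Q0n0 : Q0 != 0.
  apply: contra a0 => /eqP Q00; apply/eqP/matrixP => i s.
  by rewrite ord1 mxE -Q0E Q00 coef0.
pose P := (lead_coef Q0)^-1 *: Q0.
have lc0 : lead_coef Q0 != 0 by rewrite lead_coef_eq0.
have mP : P \is monic by rewrite monicE lead_coefZ mulVf.
have HP r : \sum_(s < n) P`_s * m (r + s).+1 = 0.
  rewrite -[RHS](mulr0 (lead_coef Q0)^-1) -[in RHS](H r) mulr_sumr; apply: eq_bigr => s _.
  by rewrite coefZ Q0E mulrA.
have sPn : (size P <= n)%N by rewrite size_scale ?invr_neq0 // size_poly.
have [d sP] : exists d, size P = d.+1.
  by exists (size P).-1; rewrite prednK // lt0n size_poly_eq0 monic_neq0.
(* The coefficient of u^-j is the recurrence at r = j - d - 1. *)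
have tailP j : (d < j)%N -> (rser P * m) j = 0.
  move=> dj; rewrite -[RHS](HP (j - d.+1)%N).
  have dn : (d.+1 <= n)%N by rewrite -sP.
  have -> : \sum_(s < n) P`_s * m (j - d.+1 + s).+1 =
            \sum_(s < d.+1) P`_s * m (j - d.+1 + s).+1.
    rewrite (big_ord_widen n (fun s => P`_s * m (j - d.+1 + s).+1) dn).
    rewrite [LHS](bigID (fun s : 'I_n => (s < d.+1)%N)) /= [X in _ + X]big1 ?addr0 // => s.
    by rewrite -leqNgt => ds; rewrite nth_default ?mul0r // sP.
  rewrite serM; have dj1 : (d.+1 <= j.+1)%N by rewrite ltnS ltnW.
  transitivity (\sum_(i < d.+1) P`_(d - i) * m (j - i)%N).
    rewrite (big_ord_widen j.+1 (fun i => P`_(d - i) * m (j - i)%N) dj1).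
    rewrite [LHS](bigID (fun i : 'I_j.+1 => (i < d.+1)%N)) /= [X in _ + X]big1 ?addr0; last first.
      by move=> i /negbTE id; rewrite /rser /rcoef sP id mul0r.
    by apply: eq_bigr => i id; rewrite /rser /rcoef sP id.
  rewrite (reindex_inj rev_ord_inj) /=; apply: eq_bigr => i _.
  rewrite subSS subKn -1?ltnS //; congr (_ * m _).
  have id : (i <= d)%N by rewrite -ltnS.
  by rewrite subnBA // -addSn subnSK // addnBAC // ltnW.
pose Q := \poly_(k < d.+1) (rser P * m) (d - k)%N.
have Qd : Q`_d = 1 by rewrite coef_poly leqnn subnn serM0 m0 mulr1 rser0.
have sQ : size Q = d.+1.
  apply/eqP; rewrite eqn_leq size_poly ltnNge; apply/negP => /leq_sizeP/(_ d (leqnn d)).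
  by rewrite Qd => /eqP; rewrite oner_eq0.
have mQ : Q \is monic by rewrite monicE lead_coefE sQ Qd.
exists P, Q; split=> //; first by rewrite sQ sP.
have -> : rser Q = rser P * m.
  apply: funext => j; rewrite {1}/rser /rcoef sQ /=; case: (ltnP j d.+1) => jd; last first.
    by rewrite tailP.
  by rewrite coef_poly ltnS leq_subr subKn // -ltnS.
by rewrite (ser_mulC (rser P)) mulrA /m mulrA ser_mulrV // mul1r.
Qed.

Lemma rser_lin_prod (r1 r2 : seq K) : size r1 = size r2 ->
  let s := zip [seq - x | x <- r1] [seq - x | x <- r2] in
  rser (\prod_(x <- r1) ('X - x%:P)) = lin_prod s false /\
  rser (\prod_(x <- r2) ('X - x%:P)) = lin_prod s true.
Proof.
have rser1 : rser 1 = 1.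
  by apply: funext => -[|j]; rewrite /rser /rcoef size_poly1 //= coef1.
elim: r1 r2 => [|x r1 IH] [|y r2] //=; first by rewrite !big_nil.
move=> [/IH[E1 E2]]; have mo (q : seq K) : \prod_(z <- q) ('X - z%:P) != 0.
  by rewrite monic_neq0 // monic_prod_XsubC.
by rewrite !big_cons !(mulrC ('X - _)) !rser_factor // E1 E2.
Qed.
End Rational.

(** * From a highest weight matrix representation to finite dimension *)

Section Backward.
Variables (K : closedFieldType) (p : nat).
Hypotheses (hp : p \in [pchar K]) (hp2 : (2 < p)%N).
Variable lam : bool -> ser K.
Hypothesis hlam0 : forall i, lam i 0%N = 1.
Hypothesis hres : forall i, restricted p (lam i).
Variables (N : nat) (t : bool -> bool -> ser 'M[K]_N) (v : 'cV[K]_N).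
Hypothesis t_hw : hwrep t v lam.

Local Notation io := (@scalar_mx K N).
Local Notation J := (annv v).

Definition mx_eval : F K -> 'M[K]_N := feval io (fun x : gen => t x.1.1 x.1.2 x.2.+1).

Let phi_rep : frep io mx_eval := feval_rep _ (@scalar_mx_central K N).

Lemma mx_rep_t : rep_t mx_eval = t.
Proof.
apply: funext => i; apply: funext => j; apply: funext => -[|r].
  by rewrite (rep_t0 phi_rep); case: t_hw => [[-> _] _ _ _].
by rewrite /rep_t /phis /tS /= /mx_eval feval_X.
Qed.

Let t_rtt : rtt t. Proof. by case: t_hw. Qed.
Let R2 : forall x : 'M[K]_N, x + x = 0 -> x = 0 := @two_regular K p hp hp2 _ io.
Let Kp : p%:R = 0 :> K. Proof. exact: pcharf0. Qed.

Lemma J_e r : J (dr_e t r.+1).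
Proof.
apply: (Jser_mul (annv0 v) (@annvD _ _ v) (@annvM _ _ v)) => n.
by case: t_hw => _ _ H _; apply: H.
Qed.

Lemma J_d1 : Jeq io J (dr_d1 t) (lam false). Proof. by case: t_hw => _ _ _; apply. Qed.

Lemma J_d2 : Jeq io J (dr_d2 t) (lam true).
Proof.
rewrite /dr_d2 => n; rewrite !serB addrAC -serB -serB; apply: annvD.
  by case: t_hw => _ _ _ /(_ true n).
rewrite /annv mulNmx; apply/eqP; rewrite oppr_eq0; apply/eqP.
apply: (Jser_mul (annv0 v) (@annvD _ _ v) (@annvM _ _ v)) => -[|m]; last exact: J_e.
by rewrite (dr_e_0 t_rtt); apply: annv0.
Qed.

Lemma mx_fspan (f : F K) : fspan io t J (mx_eval f).
Proof.
have st i j : fstable io t J (t i j).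
  exact: (fstable_t (@scalar_mx_central K N) t_rtt R2 (annv0 v) (@annvD _ _ v)
          (@annvM _ _ v) hlam0 J_e J_d1 J_d2).
rewrite /mx_eval /feval; elim/big_ind: _ => [||w _].
- by apply: fspan_J; apply: annv0.
- exact: fspan_D.
- by apply: fspan_Z; elim: w => [|x w IH] /=; [apply: fspan_1|apply: st].
Qed.

Lemma fin_supp_ideal2 (g : F K) : ideal2 (relYp p) g -> fin_supp g.
Proof.
move=> [l [Hl /funext->]]; elim: l Hl => [|x l IH] Hl /=; first exact: fin_supp0.
apply: fin_suppD; last by apply: IH => y yl; apply: Hl; right.
have [F1 G F2] := Hl x (or_introl erefl); apply: fin_suppM => //; apply: fin_suppM => //.
case: G => [[i [j [k [m [r [s [_ [_ ->]]]]]]]]|[i [r [_ ->]]]]; first exact: fin_supp_relY.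
exact: fin_ser_b.
Qed.

(** The ideal is two-sided, so each relation must kill every vector obtained from v, not just v. The
    RTT relations vanish as matrices; for b_1 and b_2 this is [J_b1] and [J_b2], as [mx_fspan]
    reaches all these vectors through the f^(s). *)
Lemma J_ideal2 (g : F K) : ideal2 (relYp p) g -> J (mx_eval g).
Proof.
move=> [l [Hl /funext->]]; have: J (mx_eval (sumF [seq mulF (mulF x.1.1 x.1.2) x.2 | x <- l])) /\
    fin_supp (sumF [seq mulF (mulF x.1.1 x.1.2) x.2 | x <- l]); last by case.
elim: l Hl => [|x l IH] Hl /=.
  by rewrite (frep0 phi_rep); split; [apply: annv0|exact: fin_supp0].
have [Jl Fl] : _ /\ _ := IH (fun y yl => Hl y (or_intror yl)).
have [F1 G F2] := Hl x (or_introl erefl).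
have [FG JG] : fin_supp x.1.2 /\ J (mx_eval x.1.2 * mx_eval x.2).
  case: G => [[i [j [k [m [r [s [r0 [s0 ->]]]]]]]]|[i [r [r0 ->]]]].
    split; first exact: fin_supp_relY.
    have H : rtt (rep_t mx_eval) by rewrite mx_rep_t.
    by rewrite (proj2 (frep_rtt phi_rep) H) // mul0r; apply: annv0.
  split; first exact: fin_ser_b.
  have rp : (0 < r * p)%N by rewrite muln_gt0 r0 (leq_trans _ hp2).
  have Hl1 := prod_shift_lam hres.
  case: i.
    rewrite -[mx_eval _]/(phis mx_eval (b2S K p) _) (phis_b2 phi_rep) mx_rep_t.
    exact: (J_b2 (@scalar_mx_central K N) t_rtt R2 (annv0 v) (@annvD _ _ v) (@annvM _ _ v)
      hlam0 J_d2 Kp Hl1 rp (mx_fspan _)).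
  rewrite -[mx_eval _]/(phis mx_eval (b1S K p) _) (phis_b1 phi_rep) mx_rep_t.
  exact: (J_b1 (@scalar_mx_central K N) t_rtt (annv0 v) (@annvD _ _ v) (@annvM _ _ v)
    J_d1 Kp Hl1 rp (mx_fspan _)).
have F3 : fin_supp (mulF x.1.1 x.1.2) by apply: fin_suppM.
split; last by apply: fin_suppD => //; apply: fin_suppM.
rewrite (frepD phi_rep) ?(frepM phi_rep) //; last exact: fin_suppM.
by apply: annvD => //; rewrite -mulrA; apply: annvM.
Qed.

Lemma J_idealL (S : F K -> Prop) (f : F K) : (forall g, S g -> fin_supp g /\ J (mx_eval g)) ->
  idealL S f -> fin_supp f /\ J (mx_eval f).
Proof.
move=> HS [l [Hl /funext->]]; elim: l Hl => [|x l IH] Hl /=.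
  by rewrite (frep0 phi_rep); split; [exact: fin_supp0|apply: annv0].
have [Fl Jl] := IH (fun y yl => Hl y (or_intror yl)).
have [F1 /HS[F2 JG]] := Hl x (or_introl erefl).
have F3 : fin_supp (mulF x.1 x.2) by apply: fin_suppM.
split; first exact: fin_suppD.
by rewrite (frepD phi_rep) // (frepM phi_rep) //; apply: annvD => //; apply: annvM.
Qed.

Lemma J_KZ (f : F K) : KZ p lam f -> fin_supp f /\ J (mx_eval f).
Proof.
apply: J_idealL => g [H|[[r [r0 ->]]|[i [r [r0 ->]]]]].
- by split; [exact: fin_supp_ideal2|exact: J_ideal2].
- split; first exact: fin_ser_e.
  rewrite -[mx_eval _]/(phis mx_eval (eS K) r) (phis_e phi_rep) mx_rep_t.
  by case: r r0 => // r _; apply: J_e.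
- have Fd := @fin_ser_d K i; have F1 := @fin_supp1 K.
  have FZ : fin_supp (scaleF (- lam i r) (oneF K)) by apply: fin_suppZ.
  split; first exact: fin_suppD.
  rewrite (frepD phi_rep) // (frepZ phi_rep) // (frep1 phi_rep) mulr1 rmorphN /=.
  have -> : mx_eval (dS K i r) = (if i then dr_d2 t else dr_d1 t) r.
    rewrite -[LHS]/(phis mx_eval (dS K i) r); case: i {Fd FZ}.
      by rewrite (phis_d2 phi_rep) mx_rep_t.
    by rewrite (phis_d1 mx_eval) mx_rep_t.
  by case: i {Fd FZ}; [exact: J_d2|exact: J_d1].
Qed.

(** [KZ] and a both lie in the annihilator of v, a left ideal that is proper because v is
    nonzero. *)
Lemma ML_of_J (a : F K) : fin_supp a -> J (mx_eval a) -> ML p lam a.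
Proof.
move=> Fa Ja; split=> // H.
have [_] : fin_supp (oneF K) /\ J (mx_eval (oneF K)).
  by apply: J_idealL H => g [/J_KZ|->].
rewrite (frep1 phi_rep) /annv mul1mx; apply/eqP; by case: t_hw.
Qed.

(** Vectors are transposed because subspaces are encoded as row spaces. *)
Definition orbit_span (vs : seq (F K)) : 'M[K]_N :=
  (\sum_(g <- vs) <<(mx_eval g *m v)^T>>)%MS.

Lemma orbit_spanP vs (x : 'rV[K]_N) : (x <= orbit_span vs)%MS ->
  exists2 cs : seq K, size cs = size vs &
    x = \sum_(z <- zip cs vs) z.1 *: (mx_eval z.2 *m v)^T.
Proof.
rewrite /orbit_span; elim: vs x => [|g vs IH] x.
  by rewrite big_nil submx0 => /eqP->; exists [::]; rewrite ?big_nil.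
rewrite big_cons => /sub_addsmxP[[u1 u2] /= ->].
have : (u1 *m <<(mx_eval g *m v)^T>> <= (mx_eval g *m v)^T)%MS.
  by rewrite (submx_trans (submxMl _ _)) // genmxE.
move/sub_rVP => [c ->]; have [cs sz ->] := IH _ (submxMl u2 _).
by exists (c :: cs); rewrite /= ?sz // big_cons.
Qed.

(** Ranks are bounded by N; a family of maximal rank cannot be enlarged, so it spans the orbit of
    v. *)
Lemma orbit_basis : exists2 vs : seq (F K), (forall g, In g vs -> fin_supp g) &
  forall f, fin_supp f -> ((mx_eval f *m v)^T <= orbit_span vs)%MS.
Proof.
pose P n := `[< exists2 vs : seq (F K), (forall g, In g vs -> fin_supp g) &
  \rank (orbit_span vs) = n >].
have exP : exists n, P n by exists (\rank (orbit_span [::])); apply/asboolP; exists [::].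
have ubP n : P n -> (n <= N)%N by move/asboolP => [vs _ <-]; apply: rank_leq_col.
case: (ex_maxnP exP ubP) => n /asboolP[vs Fvs <-] maxP.
exists vs => // f Ff.
have sub : (orbit_span vs <= orbit_span (f :: vs))%MS.
  by rewrite /orbit_span big_cons addsmxSr.
have /maxP r1 : P (\rank (orbit_span (f :: vs))).
  by apply/asboolP; exists (f :: vs) => // g [<-//|/Fvs].
have eqS : (orbit_span vs == orbit_span (f :: vs))%MS.
  by rewrite -(mxrank_leqif_eq sub) eqn_leq r1 mxrankS.
have /andP[_ s2] := eqS; apply: submx_trans s2.
by rewrite /orbit_span big_cons (submx_trans _ (addsmxSl _ _)) // genmxE.
Qed.

Lemma hwrep_fin_dim : L_fin_dim p lam.
Proof.
have [vs Fvs Hvs] := orbit_basis; exists vs; split=> // f Ff.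
have [cs sz E] := orbit_spanP (Hvs f Ff); exists cs.
have [Es Fs] : mx_eval (sumF [seq scaleF x.1 x.2 | x <- zip cs vs]) *m v =
    \sum_(z <- zip cs vs) z.1 *: (mx_eval z.2 *m v) /\
    fin_supp (sumF [seq scaleF x.1 x.2 | x <- zip cs vs]).
  elim: vs cs Fvs {Hvs E sz} => [|g vs IH] [|c cs] Fvs /=;
    rewrite ?big_nil ?(frep0 phi_rep) ?mul0mx; try by split; [|exact: fin_supp0].
  have [E' F'] := IH cs (fun u uv => Fvs u (or_intror uv)).
  have Fg : fin_supp g := Fvs g (or_introl erefl).
  split; last by apply: fin_suppD => //; apply: fin_suppZ.
  rewrite big_cons (frepD phi_rep) ?(frepZ phi_rep) //; last exact: fin_suppZ.
  by rewrite mulmxDl E' -mulmxE -mulmxA mul_scalar_mx.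
apply: ML_of_J; first by apply: fin_suppD => //; apply: fin_suppN.
rewrite (frepD phi_rep) ?(frepN phi_rep) //; last exact: fin_suppN.
rewrite /annv mulmxBl Es; apply/eqP; rewrite subr_eq0; apply/eqP/trmx_inj; rewrite E.
by rewrite linear_sum; apply: eq_bigr => z _; rewrite linearZ.
Qed.

End Backward.

Theorem theorem3p9 (K : closedFieldType) (p : nat)
    (hp : p \in [pchar K]) (hp2 : (2 < p)%N)
    (lam : bool -> nat -> K)
    (hlam0 : forall i, lam i 0%N = 1)
    (hres : forall i, restricted p (lam i)) :
  L_fin_dim p lam <->
  exists P1 P2 : {poly K},
    [/\ P1 \is monic, P2 \is monic, size P1 = size P2,
        (forall x, ~ (root P1 x /\ root P2 x)) &
        (* lambda_1(u) / lambda_2(u) = P1(u) / P2(u), i.e.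
           lambda_1(u) u^{-n} P2(u) = lambda_2(u) u^{-n} P1(u), n = deg *)
        forall q, \sum_(r < q.+1) lam false r * rcoef P2 (q - r)%N
                = \sum_(r < q.+1) lam true r * rcoef P1 (q - r)%N].
Proof.
split=> [/(fin_dim_hankel hp hp2 hlam0)[n [a [a0 H]]]|[P1 [P2 [m1 m2 s12 _ E]]]].
  have [P [Q [mP mQ sPQ E]]] := hankel_rational (hlam0 false) (hlam0 true) a0 H.
  have [P1 [P2 [m1 m2 s12 N12 E12]]] := coprime_quotient mP mQ sPQ E.
  by exists P1, P2; split=> // q; rewrite -[LHS]/(((lam false : ser K) * rser P2) q) E12.
have [r1 E1] := closed_field_poly_normal P1; have [r2 E2] := closed_field_poly_normal P2.
rewrite (monicP m1) scale1r in E1; rewrite (monicP m2) scale1r in E2.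
have sr : size r1 = size r2.
  by move: s12; rewrite E1 E2 !size_prod_XsubC => -[].
have [L1 L2] := rser_lin_prod sr.
(* The negated roots appear because u - x becomes 1 - x/u. *)
have [|N [t [v Ht]]] := @hwrep_exists K
    (zip [seq - x | x <- r1] [seq - x | x <- r2]) lam hlam0.
  by rewrite -L1 -L2 -E1 -E2; apply: funext => q; apply: E.
exact: (hwrep_fin_dim hp hp2 hlam0 hres Ht).
Qed.
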